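(* $\mathsf{RCA}_0$ proves the following: (a) For any continuous function $f\colon\mathbb R\to\mathbb R$ and any open set $V\subseteq\mathbb R$, the preimage $f^{-1}(V)$ is again open. (b) For any open set $U\subseteq\mathbb R$, there is a continuous $g\colon\mathbb R\to[0,1]$ with $U=g^{-1}((0,1])$.
   Context: $\mathsf{RCA}_0$ is the usual base system of second-order arithmetic (basic arithmetic axioms, $\Sigma^0_1$-induction, $\Delta^0_1$-comprehension). Reals. A real is a Cauchy sequence $x=(x_n)_{n\in\mathbb N}$ of rationals with no rate of convergence given: for each rational $\varepsilon>0$ there is an $N\in\mathbb N$ with $|x_m-x_n|<\varepsilon$ for all $m,n\geq N$. For reals $x,y$: $x\leq y$ means that for each rational $\varepsilon>0$ there is an $N$ with $x_n\leq y_n+\varepsilon$ for all $n\geq N$; $x=y$ means $x\leq y$ and $y\leq x$; $x<y$ means $x\leq y$ but not $x=y$. Addition, multiplication and absolute value are defined pointwise; rationals are identified with constant sequences. Put $B_\delta(y)=\{z\in\mathbb R:|y-z|<\delta\}$. Open sets. A code for an open set is a set $U\subseteq\mathbb N\times\mathbb Q\times\mathbb Q_{>0}$. For a real $x$, write $x\in U$ if there are $N\in\mathbb N$ and $(a,r)\in\mathbb Q\times\mathbb Q_{>0}$ such that $x\in B_r(a)$ and $(n,a,r)\in U$ for all $n\geq N$. A class of reals is open if there is a code $U$ such that a real $x$ belongs to the class precisely if $x\in U$. Continuous functions. A partial continuous function on $\mathbb R$ is (represented by) an arbitrary function $f\colon\mathbb Q\to\mathbb Q^{\mathbb N}$, $f(q)=(f(q)_i)_{i\in\mathbb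 N}$. A real $x$ lies in $\operatorname{dom}(f)$ if each $\varepsilon>0$ admits a (positive) $N\in\mathbb N$ such that $|f(q)_i-f(r)_j|<\varepsilon$ for all rationals $q,r\in B_{1/N}(x)$ and all $i,j\geq N$. For $x=(x_i)\in\operatorname{dom}(f)$ the value is the real $f(x)=(f(x_i)_i)_{i\in\mathbb N}$. A continuous function $f\colon D\to\mathbb R$ is such an $f$ with $D\subseteq\operatorname{dom}(f)$; $f\colon D\to E$ means in addition that $f(x)\in E$ for all $x\in D$. *)

(* Defs.v *)
From Stdlib Require Import List.
Import ListNotations.

(** * Second-order arithmetic

    Two-sorted first-order syntax in de Bruijn style.  Number variables and set
    variables are indexed independently: [FAllN]/[FExN] bind number variable 0,
    [FAllS]/[FExS] bind set variable 0. *)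

Inductive tm : Type :=
| TVar (n : nat)
| TZero
| TOne
| TAdd (s t : tm)
| TMul (s t : tm).

Inductive fm : Type :=
| FBot
| FEq (s t : tm)
| FLt (s t : tm)
| FMem (t : tm) (X : nat)
| FAnd (A B : fm)
| FOr (A B : fm)
| FImp (A B : fm)
| FAllN (A : fm)
| FExN (A : fm)
| FAllS (A : fm)
| FExS (A : fm).

Definition FNot (A : fm) : fm := FImp A FBot.
Definition FIff (A B : fm) : fm := FAnd (FImp A B) (FImp B A).

Definition scons {T : Type} (a : T) (s : nat -> T) (n : nat) : T :=
  match n with 0 => a | S m => s m end.

Fixpoint tsubst (s : nat -> tm) (t : tm) : tm :=
  match t with
  | TVar n => s n
  | TZero => TZero
  | TOne => TOne
  | TAdd t u => TAdd (tsubst s t) (tsubst s u)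
  | TMul t u => TMul (tsubst s t) (tsubst s u)
  end.

Definition tshift (n : nat) : tm := TVar (S n).
Definition upN (s : nat -> tm) : nat -> tm :=
  scons (TVar 0) (fun n => tsubst tshift (s n)).
Definition upS (r : nat -> nat) : nat -> nat :=
  scons 0 (fun n => S (r n)).

(** Simultaneous substitution of terms for number variables and of set
    variables for set variables (the language has no other set terms). *)
Fixpoint subst (s : nat -> tm) (r : nat -> nat) (A : fm) : fm :=
  match A with
  | FBot => FBot
  | FEq t u => FEq (tsubst s t) (tsubst s u)
  | FLt t u => FLt (tsubst s t) (tsubst s u)
  | FMem t X => FMem (tsubst s t) (r X)
  | FAnd A B => FAnd (subst s r A) (subst s r B)
  | FOr A B => FOr (subst s r A) (subst s r B)
  | FImp A B => FImp (subst s r A) (subst s r B)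
  | FAllN A => FAllN (subst (upN s) r A)
  | FExN A => FExN (subst (upN s) r A)
  | FAllS A => FAllS (subst s (upS r) A)
  | FExS A => FExS (subst s (upS r) A)
  end.

Definition liftN : fm -> fm := subst tshift (fun X => X).
Definition liftS : fm -> fm := subst TVar S.
Definition instN (t : tm) : fm -> fm := subst (scons t TVar) (fun X => X).
Definition instS (X : nat) : fm -> fm := subst TVar (scons X (fun Y => Y)).

(** Classical natural deduction with equality.  The members of [T] are
    non-logical axioms standing for their universal closures: [p_ax] makes them
    available in every context, and only the hypotheses in the list are lifted
    when a variable is generalized. *)
Inductive prf (T : fm -> Prop) : list fm -> fm -> Prop :=
| p_ax G A : T A -> prf T G A
| p_hyp G A : In A G -> prf T G A
| p_raa G A : prf T (FNot A :: G) FBot -> prf T G A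
| p_impI G A B : prf T (A :: G) B -> prf T G (FImp A B)
| p_impE G A B : prf T G (FImp A B) -> prf T G A -> prf T G B
| p_andI G A B : prf T G A -> prf T G B -> prf T G (FAnd A B)
| p_andE1 G A B : prf T G (FAnd A B) -> prf T G A
| p_andE2 G A B : prf T G (FAnd A B) -> prf T G B
| p_orI1 G A B : prf T G A -> prf T G (FOr A B)
| p_orI2 G A B : prf T G B -> prf T G (FOr A B)
| p_orE G A B C :
    prf T G (FOr A B) -> prf T (A :: G) C -> prf T (B :: G) C -> prf T G C
| p_allNI G A : prf T (map liftN G) A -> prf T G (FAllN A)
| p_allNE G A t : prf T G (FAllN A) -> prf T G (instN t A)
| p_exNI G A t : prf T G (instN t A) -> prf T G (FExN A)
| p_exNE G A B :
    prf T G (FExN A) -> prf T (A :: map liftN G) (liftN B) -> prf T G B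
| p_allSI G A : prf T (map liftS G) A -> prf T G (FAllS A)
| p_allSE G A X : prf T G (FAllS A) -> prf T G (instS X A)
| p_exSI G A X : prf T G (instS X A) -> prf T G (FExS A)
| p_exSE G A B :
    prf T G (FExS A) -> prf T (A :: map liftS G) (liftS B) -> prf T G B
| p_refl G t : prf T G (FEq t t)
| p_eqE G A s t : prf T G (FEq s t) -> prf T G (instN s A) -> prf T G (instN t A).

Definition proves (T : fm -> Prop) (A : fm) : Prop := prf T [] A.

(** * The system RCA_0 *)

(** Bounded (Delta^0_0) formulas, with set parameters allowed; [tsubst tshift t]
    expresses that the bound does not mention the quantified variable. *)
Inductive bounded : fm -> Prop :=
| b_bot : bounded FBot
| b_eq s t : bounded (FEq s t)
| b_lt s t : bounded (FLt s t)
| b_mem t X : bounded (FMem t X)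
| b_and A B : bounded A -> bounded B -> bounded (FAnd A B)
| b_or A B : bounded A -> bounded B -> bounded (FOr A B)
| b_imp A B : bounded A -> bounded B -> bounded (FImp A B)
| b_all t A :
    bounded A -> bounded (FAllN (FImp (FLt (TVar 0) (tsubst tshift t)) A))
| b_ex t A :
    bounded A -> bounded (FExN (FAnd (FLt (TVar 0) (tsubst tshift t)) A)).

Definition Sigma01 (A : fm) : Prop := exists B, bounded B /\ A = FExN B.
Definition Pi01 (A : fm) : Prop := exists B, bounded B /\ A = FAllN B.

Inductive RCA0 : fm -> Prop :=
| succ_neq0 : RCA0 (FNot (FEq (TAdd (TVar 0) TOne) TZero))
| succ_inj :
    RCA0 (FImp (FEq (TAdd (TVar 0) TOne) (TAdd (TVar 1) TOne)) (FEq (TVar 0) (TVar 1)))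
| add_zero : RCA0 (FEq (TAdd (TVar 0) TZero) (TVar 0))
| add_succ :
    RCA0 (FEq (TAdd (TVar 0) (TAdd (TVar 1) TOne)) (TAdd (TAdd (TVar 0) (TVar 1)) TOne))
| mul_zero : RCA0 (FEq (TMul (TVar 0) TZero) TZero)
| mul_succ :
    RCA0 (FEq (TMul (TVar 0) (TAdd (TVar 1) TOne)) (TAdd (TMul (TVar 0) (TVar 1)) (TVar 0)))
| lt_zero : RCA0 (FNot (FLt (TVar 0) TZero))
| lt_succ :
    RCA0 (FIff (FLt (TVar 0) (TAdd (TVar 1) TOne))
              (FOr (FLt (TVar 0) (TVar 1)) (FEq (TVar 0) (TVar 1))))
| Sigma01_induction A :
    Sigma01 A ->
    RCA0 (FImp
      (FAnd (instN TZero A)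
           (FAllN (FImp A
              (subst (scons (TAdd (TVar 0) TOne) tshift) (fun X => X) A))))
      (FAllN A))
| Delta01_comprehension A B :
    Sigma01 A -> Pi01 B ->
    RCA0 (FImp (FAllN (FIff A B)) (FExS (FAllN (FIff (FMem (TVar 0) 0) (liftS A))))).

(** * Writing formulas with named binders

    A [form] yields a formula once the numbers [k] and [l] of enclosing number
    and set binders are known; likewise for terms and set variables.  The
    variable bound when [k] binders are already open has index [k' - S k] at
    any later depth [k'].  Hence [allN x, A], with [x] an ordinary Rocq
    variable, can be used at any depth without explicit lifting. *)

Definition term := nat -> tm.
Definition setv := nat -> nat.
Definition form := nat -> nat -> fm.

Definition bound_num (k : nat) : term := fun k' => TVar (k' - S k).
Definition bound_set (l : nat) : setv := fun l' => l' - S l.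

Definition f_allN (F : term -> form) : form :=
  fun k l => FAllN (F (bound_num k) (S k) l).
Definition f_exN (F : term -> form) : form :=
  fun k l => FExN (F (bound_num k) (S k) l).
Definition f_allS (F : setv -> form) : form :=
  fun k l => FAllS (F (bound_set l) k (S l)).
Definition f_exS (F : setv -> form) : form :=
  fun k l => FExS (F (bound_set l) k (S l)).

Definition f_bot : form := fun _ _ => FBot.
Definition f_and (A B : form) : form := fun k l => FAnd (A k l) (B k l).
Definition f_or (A B : form) : form := fun k l => FOr (A k l) (B k l).
Definition f_imp (A B : form) : form := fun k l => FImp (A k l) (B k l).
Definition f_eq (s t : term) : form := fun k _ => FEq (s k) (t k).
Definition f_lt (s t : term) : form := fun k _ => FLt (s k) (t k).
Definition f_mem (t : term) (X : setv) : form := fun k l => FMem (t k) (X l).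

Definition t_zero : term := fun _ => TZero.
Definition t_one : term := fun _ => TOne.
Definition t_add (s t : term) : term := fun k => TAdd (s k) (t k).
Definition t_mul (s t : term) : term := fun k => TMul (s k) (t k).

Definition sentence (A : form) : fm := A 0 0.

Declare Scope L2_scope.
Delimit Scope L2_scope with L2.
Bind Scope L2_scope with term form.

Notation "'allN' x .. y , A" := (f_allN (fun x => .. (f_allN (fun y => A)) ..))
  (at level 200, x binder, y binder, right associativity) : L2_scope.
Notation "'exN' x .. y , A" := (f_exN (fun x => .. (f_exN (fun y => A)) ..))
  (at level 200, x binder, y binder, right associativity) : L2_scope.
Notation "'allS' X .. Y , A" := (f_allS (fun X => .. (f_allS (fun Y => A)) ..))
  (at level 200, X binder, Y binder, right associativity) : L2_scope.
Notation "'exS' X .. Y , A" := (f_exS (fun X => .. (f_exS (fun Y => A)) ..))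
  (at level 200, X binder, Y binder, right associativity) : L2_scope.

Notation "0" := t_zero : L2_scope.
Notation "1" := t_one : L2_scope.
Notation "s + t" := (t_add s t) : L2_scope.
Notation "s * t" := (t_mul s t) : L2_scope.
Notation "s = t" := (f_eq s t) : L2_scope.
Notation "s < t" := (f_lt s t) : L2_scope.
Notation "s <= t" := (f_or (f_lt s t) (f_eq s t)) : L2_scope.
Notation "t 'inS' X" := (f_mem t X) (at level 70) : L2_scope.
Notation "A /\ B" := (f_and A B) : L2_scope.
Notation "A \/ B" := (f_or A B) : L2_scope.
Notation "A -> B" := (f_imp A B) : L2_scope.
Notation "A <-> B" := (f_and (f_imp A B) (f_imp B A)) : L2_scope.
Notation "~ A" := (f_imp A f_bot) : L2_scope.

Local Open Scope L2_scope.

(** * Coding *)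

(** The pairing [(s + t)^2 + s] is injective. *)
Definition cpair (s t : term) : term := (s + t) * (s + t) + s.

Definition t_divides (s t : term) : form := exN c, t = s * c.
Definition t_coprime (s t : term) : form :=
  allN c, t_divides c s /\ t_divides c t -> c = 1.

(** [ratio q m n d]: the number [q] codes the rational [(m - n) / d] in lowest
    terms, with [m = 0] or [n = 0].  Every rational has exactly one code, so
    equality of rationals is equality of codes. *)
Definition ratio (q m n d : term) : form :=
  q = cpair (cpair m n) d /\ 0 < d /\ (m = 0 \/ n = 0) /\ t_coprime (m + n) d.

Definition is_rat (q : term) : form := exN m n d, ratio q m n d.

Definition q_zero : term := cpair (cpair 0 0) 1.
Definition q_one : term := cpair (cpair 1 0) 1.
(** [1 / n], for [0 < n]. *)
Definition q_inv (n : term) : term := cpair (cpair 1 0) n.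

Definition q_lt (p q : term) : form :=
  exN m n d m' n' d', ratio p m n d /\ ratio q m' n' d' /\
    m * d' + n' * d < m' * d + n * d'.
Definition q_le (p q : term) : form :=
  exN m n d m' n' d', ratio p m n d /\ ratio q m' n' d' /\
    m * d' + n' * d <= m' * d + n * d'.

(** [p + q = s]. *)
Definition q_sum (p q s : term) : form :=
  exN m1 n1 d1 m2 n2 d2 m3 n3 d3,
    ratio p m1 n1 d1 /\ ratio q m2 n2 d2 /\ ratio s m3 n3 d3 /\
    m1 * (d2 * d3) + m2 * (d1 * d3) + n3 * (d1 * d2) =
    n1 * (d2 * d3) + n2 * (d1 * d3) + m3 * (d1 * d2).

(** [|p| = q]. *)
Definition q_abs (p q : term) : form :=
  exN m n d, ratio p m n d /\ q = cpair (cpair (m + n) 0) d.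

Definition is_pos_rat (q : term) : form := is_rat q /\ q_lt q_zero q.

(** [|p - q| < e]. *)
Definition q_dist_lt (p q e : term) : form :=
  exN s t, q_sum s q p /\ q_abs s t /\ q_lt t e.

(** [F] is (the graph of) a function from the class [D] to the class [E]. *)
Definition is_function (D E : term -> form) (F : setv) : form :=
  (allN c, c inS F -> exN a b, c = cpair a b /\ D a /\ E b) /\
  (allN a, D a -> exN b, cpair a b inS F) /\
  (allN a b b', cpair a b inS F /\ cpair a b' inS F -> b = b').

Definition any_nat (n : term) : form := n = n.
Definition rat_nat_pair (c : term) : form := exN q i, c = cpair q i /\ is_rat q.

(** * Reals *)

(** A sequence of rationals is given by the relation "the entry with index [n]
    is [q]"; thus sequences defined pointwise from others need not be
    introduced through set quantifiers. *)
Definition seqn : Type := term -> term -> form.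

Definition seq_of (X : setv) : seqn := fun n q => cpair n q inS X.
Definition r_const (a : term) : seqn := fun _ q => q = a.
Definition r_sub (x y : seqn) : seqn :=
  fun n q => exN u v, x n u /\ y n v /\ q_sum q v u.
Definition r_abs (x : seqn) : seqn := fun n q => exN u, x n u /\ q_abs u q.

Definition is_real (X : setv) : form :=
  is_function any_nat is_rat X /\
  allN e, is_pos_rat e -> exN N, allN m n, N <= m /\ N <= n ->
    exN u v, seq_of X m u /\ seq_of X n v /\ q_dist_lt u v e.

Definition r_le (x y : seqn) : form :=
  allN e, is_pos_rat e -> exN N, allN n, N <= n ->
    exN u v w, x n u /\ y n v /\ q_sum v e w /\ q_le u w.
Definition r_eq (x y : seqn) : form := r_le x y /\ r_le y x.
Definition r_lt (x y : seqn) : form := r_le x y /\ ~ r_eq x y.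

(** [z] belongs to the ball with center [y] and rational radius [d]. *)
Definition in_ball (d : term) (y z : seqn) : form :=
  r_lt (r_abs (r_sub y z)) (r_const d).

(** * Open sets *)

Definition is_open_code (U : setv) : form :=
  allN c, c inS U ->
    exN n a r, c = cpair (cpair n a) r /\ is_rat a /\ is_pos_rat r.

Definition in_open (x : seqn) (U : setv) : form :=
  exN N a r, is_rat a /\ is_pos_rat r /\ in_ball r (r_const a) x /\
    allN n, N <= n -> cpair (cpair n a) r inS U.

(** * Continuous functions *)

(** A function from [Q] to [Q^N] is coded as a function from [Q * N] to [Q]. *)
Definition is_partial_cont (F : setv) : form :=
  is_function rat_nat_pair is_rat F.

Definition entry (F : setv) (q i u : term) : form := cpair (cpair q i) u inS F.

Definition in_dom (x : seqn) (F : setv) : form :=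
  allN e, is_pos_rat e -> exN N, 0 < N /\
    allN q r i j,
      is_rat q /\ is_rat r /\
      in_ball (q_inv N) x (r_const q) /\ in_ball (q_inv N) x (r_const r) /\
      N <= i /\ N <= j ->
      exN u v, entry F q i u /\ entry F r j v /\ q_dist_lt u v e.

Definition value (F : setv) (x : seqn) : seqn :=
  fun n q => exN u, x n u /\ entry F u n q.

(** [F] represents a continuous function defined on all reals. *)
Definition is_cont (F : setv) : form :=
  is_partial_cont F /\ allS X, is_real X -> in_dom (seq_of X) F.

(* Main.v *)
(** By the completeness theorem it suffices to argue in an arbitrary model of
    RCA_0.  Its coded rationals form an ordered field, and Sigma^0_1-induction and
    comprehension apply to every predicate given by a bounded formula with
    parameters.

    (a) Put [(n, a, r)] into [U] if [r = 1/d] where [d] codes data [(N, b, s, j)]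
    such that, as far as can be seen below [n], the ball [B_s(b)] is in [V] from
    stage [N] on and [|f(q)_i - b| <= s - 1/N] for all [q] in [B_r(a)] and
    [i >= N].  Since the radius carries the witness, it cannot drift as [n] grows,
    so "for all large [n]" really yields one ball of [V].

    (b) Let [g(q)_i] be the maximum of [0] and of [min (1/(k+1)) (r - |q - a|)] for
    the codes [k <= i] of triples [(N, a, r)] with [(n, a, r)] in [U] for
    [N <= n <= i].  A maximum, unlike the usual weighted sum, has a bounded
    definition without recursion.  Only finitely many [k] matter up to a given
    precision, and by strong Sigma^0_1-collection there is a stage after which none
    of these is discarded any more; hence [g] converges uniformly. *)
Require Import Defs.
From Stdlib Require Import List Arith Lia Ring Cantor.
From Stdlib Require Import Classical ClassicalEpsilon FunctionalExtensionality.
From Stdlib Require Import PropExtensionality ProofIrrelevance.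
Import ListNotations.

(** * Completeness of the deduction system *)

(** The model may be nonstandard, so Rocq recursion along its numbers is out of reach: a finite
    product or maximum exists only as far as $\Sigma^0_1$-induction yields a code for it, and every
    set must come from a bounded formula. This is why predicates travel with a definability
    certificate [D0]. Classical choice outside the model is still allowed for reasoning about it,
    for instance to turn a coded sequence into a Rocq function.

    Membership in an open set reads: some ball is listed at all large stages. So a $\Pi^0_1$ fact
    about one fixed ball can be recorded by listing the ball as long as no counterexample has shown
    up. The obstacle in (a) is that such a fact comes behind an existential quantifier whose witness
    might change from stage to stage. In (b), ordinary collection cannot bound the stages at which
    balls are discarded, because it is not decidable which balls are ever discarded; hence the
    strong form.

    Equality in the term model has to be Leibniz equality, so that the coded rationals become a
    genuine MathComp ordered field and [ring] and [lra] apply to them. *)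

Lemma tsubst_comp (s1 s2 : nat -> tm) (t : tm) :
  tsubst s2 (tsubst s1 t) = tsubst (fun n => tsubst s2 (s1 n)) t.
Proof. induction t; simpl; congruence. Qed.

Lemma tsubst_id (t : tm) : tsubst TVar t = t.
Proof. induction t; simpl; congruence. Qed.

Lemma upN_comp (s1 s2 : nat -> tm) :
  (fun n => tsubst (upN s2) (upN s1 n)) = upN (fun n => tsubst s2 (s1 n)).
Proof.
  apply functional_extensionality; intros [|n]; simpl; [reflexivity|].
  now rewrite !tsubst_comp.
Qed.

Lemma upS_comp (r1 r2 : nat -> nat) :
  (fun n => upS r2 (upS r1 n)) = upS (fun n => r2 (r1 n)).
Proof. apply functional_extensionality; intros [|n]; reflexivity. Qed.

Lemma upN_id : upN TVar = TVar.
Proof. apply functional_extensionality; intros [|n]; reflexivity. Qed.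

Lemma upS_id : upS (fun n => n) = (fun n => n).
Proof. apply functional_extensionality; intros [|n]; reflexivity. Qed.

Lemma subst_comp (A : fm) : forall s1 s2 r1 r2,
  subst s2 r2 (subst s1 r1 A) = subst (fun n => tsubst s2 (s1 n)) (fun n => r2 (r1 n)) A.
Proof.
  induction A; intros; simpl; rewrite ?tsubst_comp, ?IHA1, ?IHA2; try reflexivity.
  - now rewrite IHA, upN_comp.
  - now rewrite IHA, upN_comp.
  - rewrite IHA, upS_comp. reflexivity.
  - rewrite IHA, upS_comp. reflexivity.
Qed.

Lemma subst_id (A : fm) : subst TVar (fun n => n) A = A.
Proof.
  induction A; simpl; rewrite ?tsubst_id, ?upN_id, ?upS_id; congruence.
Qed.

(** * Free variables and agreement of substitutions *)

Fixpoint tbound (t : tm) : nat :=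
  match t with
  | TVar n => S n
  | TZero | TOne => 0
  | TAdd s t | TMul s t => max (tbound s) (tbound t)
  end.

Fixpoint nbound (A : fm) : nat :=
  match A with
  | FBot => 0
  | FEq s t | FLt s t => max (tbound s) (tbound t)
  | FMem t _ => tbound t
  | FAnd A B | FOr A B | FImp A B => max (nbound A) (nbound B)
  | FAllN A | FExN A => pred (nbound A)
  | FAllS A | FExS A => nbound A
  end.

Fixpoint sbound (A : fm) : nat :=
  match A with
  | FBot | FEq _ _ | FLt _ _ => 0
  | FMem _ X => S X
  | FAnd A B | FOr A B | FImp A B => max (sbound A) (sbound B)
  | FAllN A | FExN A => sbound A
  | FAllS A | FExS A => pred (sbound A)
  end.

Lemma tsubst_agree (s1 s2 : nat -> tm) (t : tm) :
  (forall n, n < tbound t -> s1 n = s2 n) -> tsubst s1 t = tsubst s2 t.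
Proof.
  induction t; simpl; intros H; try reflexivity; try (apply H; lia);
    f_equal; (apply IHt1 || apply IHt2); intros; apply H; lia.
Qed.

Lemma upN_agree (s1 s2 : nat -> tm) (m : nat) :
  (forall n, n < pred m -> s1 n = s2 n) -> forall n, n < m -> upN s1 n = upN s2 n.
Proof. intros H [|n] Hn; simpl; [reflexivity|]. rewrite H; [reflexivity|lia]. Qed.

Lemma upS_agree (r1 r2 : nat -> nat) (m : nat) :
  (forall n, n < pred m -> r1 n = r2 n) -> forall n, n < m -> upS r1 n = upS r2 n.
Proof. intros H [|n] Hn; simpl; [reflexivity|]. rewrite H; [reflexivity|lia]. Qed.

Lemma subst_agree (A : fm) : forall s1 s2 r1 r2,
  (forall n, n < nbound A -> s1 n = s2 n) -> (forall n, n < sbound A -> r1 n = r2 n) ->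
  subst s1 r1 A = subst s2 r2 A.
Proof.
  induction A; simpl; intros s1 s2 r1 r2 Hs Hr; try reflexivity; f_equal;
    try (apply tsubst_agree; intros; apply Hs; lia);
    try (apply Hr; lia);
    try ((apply IHA1 || apply IHA2); intros; (apply Hs || apply Hr); lia);
    apply IHA; eauto using upN_agree, upS_agree.
Qed.

(** * Admissible rules of the deduction system *)

Section Deduction.
Variable T : fm -> Prop.

Lemma prf_weaken G A : prf T G A -> forall G', incl G G' -> prf T G' A.
Proof.
  induction 1; intros G' HG.
  - now apply p_ax.
  - apply p_hyp; auto.
  - apply p_raa, IHprf. now apply incl_cons; [left | apply incl_tl].
  - apply p_impI, IHprf. now apply incl_cons; [left | apply incl_tl].
  - eapply p_impE; eauto.
  - apply p_andI; auto.
  - eapply p_andE1; eauto.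
  - eapply p_andE2; eauto.
  - apply p_orI1; auto.
  - apply p_orI2; auto.
  - eapply p_orE; [eauto | apply IHprf2 | apply IHprf3];
      now apply incl_cons; [left | apply incl_tl].
  - apply p_allNI, IHprf, incl_map, HG.
  - apply p_allNE; auto.
  - eapply p_exNI; eauto.
  - eapply p_exNE; [eauto | apply IHprf2].
    apply incl_cons; [now left | apply incl_tl, incl_map, HG].
  - apply p_allSI, IHprf, incl_map, HG.
  - apply p_allSE; auto.
  - eapply p_exSI; eauto.
  - eapply p_exSE; [eauto | apply IHprf2].
    apply incl_cons; [now left | apply incl_tl, incl_map, HG].
  - apply p_refl.
  - eapply p_eqE; eauto.
Qed.

Fixpoint nall (n : nat) (A : fm) : fm :=
  match n with 0 => A | S n => nall n (FAllN A) end.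
Fixpoint sall (n : nat) (A : fm) : fm :=
  match n with 0 => A | S n => sall n (FAllS A) end.
Fixpoint sconss {X : Type} (l : list X) (s : nat -> X) : nat -> X :=
  match l with [] => s | t :: l => scons t (sconss l s) end.

Lemma sconss_map_seq {X : Type} (s s' : nat -> X) n : forall m i,
  i < n -> sconss (map s (seq m n)) s' i = s (m + i).
Proof.
  induction n; intros m i Hi; [lia|]; simpl.
  destruct i; simpl; [now rewrite Nat.add_0_r|].
  rewrite IHn by lia. f_equal. lia.
Qed.

Lemma nall_intro n : forall A, prf T [] A -> prf T [] (nall n A).
Proof. induction n; simpl; intros A H; [exact H|]. apply IHn. now apply p_allNI. Qed.

Lemma sall_intro n : forall A, prf T [] A -> prf T [] (sall n A).
Proof. induction n; simpl; intros A H; [exact H|]. apply IHn. now apply p_allSI. Qed.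

Lemma nall_elim (l : list tm) : forall A,
  prf T [] (nall (length l) A) -> prf T [] (subst (sconss l TVar) (fun n => n) A).
Proof.
  induction l as [|t l IH]; simpl; intros A H; [now rewrite subst_id|].
  apply IH in H. simpl in H. apply p_allNE with (t := t) in H.
  unfold instN in H. rewrite subst_comp in H. erewrite subst_agree; [exact H| |reflexivity].
  intros [|n] _; simpl; [reflexivity|].
  rewrite tsubst_comp; simpl. now rewrite tsubst_id.
Qed.

Lemma sall_elim (l : list nat) : forall A,
  prf T [] (sall (length l) A) -> prf T [] (subst TVar (sconss l (fun n => n)) A).
Proof.
  induction l as [|t l IH]; simpl; intros A H; [now rewrite subst_id|].
  apply IH in H. simpl in H. apply p_allSE with (X := t) in H.
  unfold instS in H. rewrite subst_comp in H. erewrite subst_agree; [exact H|reflexivity|].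
  now intros [|n] _.
Qed.

(** Induction on the derivation would break at [p_ax], because [T] need not be closed under
    substitution. Instead the number variables of the theorem are generalized and instantiated with
    the values of [s], and then its set variables with those of [r]. *)
Lemma closed_subst A s r : prf T [] A -> prf T [] (subst s r A).
Proof.
  intros H.
  apply (nall_intro (nbound A)) in H.
  rewrite <- (length_seq (nbound A) 0), <- (length_map s) in H.
  apply nall_elim in H.
  rewrite (subst_agree A _ s _ (fun n => n)) in H;
    [ | intros n Hn; now rewrite sconss_map_seq | reflexivity ].
  apply (sall_intro (sbound (subst s (fun n => n) A))) in H.
  rewrite <- (length_seq (sbound (subst s (fun n => n) A)) 0), <- (length_map r) in H.
  apply sall_elim in H.
  rewrite (subst_agree _ _ TVar _ r), subst_comp in H;
    [ | reflexivity | intros n Hn; now rewrite sconss_map_seq ].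
  erewrite subst_agree; [exact H | | reflexivity].
  intros; symmetry; apply tsubst_id.
Qed.

(** Moving the context into the formula extends [closed_subst] to derivations with hypotheses. *)
Fixpoint imps (G : list fm) (A : fm) : fm :=
  match G with [] => A | B :: G => imps G (FImp B A) end.

Lemma imps_intro G : forall A, prf T G A -> prf T [] (imps G A).
Proof. induction G; simpl; intros A H; [exact H|]. apply IHG. now apply p_impI. Qed.

Lemma imps_elim G : forall A, prf T [] (imps G A) -> prf T G A.
Proof.
  induction G as [|B G IH]; simpl; intros A H; [exact H|].
  apply IH in H. eapply p_impE; [|apply p_hyp; now left].
  eapply prf_weaken; [exact H|]. apply incl_tl, incl_refl.
Qed.

Lemma subst_imps s r G : forall A,
  subst s r (imps G A) = imps (map (subst s r) G) (subst s r A).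
Proof. induction G; simpl; intros; [reflexivity|]. now rewrite IHG. Qed.

Lemma prf_subst s r G A : prf T G A -> prf T (map (subst s r) G) (subst s r A).
Proof.
  intros H. apply imps_elim. rewrite <- subst_imps. now apply closed_subst, imps_intro.
Qed.

Lemma prf_efq G A : prf T G FBot -> prf T G A.
Proof. intros H. apply p_raa. eapply prf_weaken; [exact H|]. apply incl_tl, incl_refl. Qed.

Lemma subst_instN t s r A :
  subst s r (instN t A) = subst (scons (tsubst s t) s) r A.
Proof.
  unfold instN. rewrite subst_comp. apply subst_agree; [|reflexivity].
  now intros [|n] _.
Qed.

Lemma subst_instS X s r A :
  subst s r (instS X A) = subst s (scons (r X) r) A.
Proof.
  unfold instS. rewrite subst_comp. apply subst_agree; [reflexivity|].
  now intros [|n] _.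
Qed.

Lemma instN_subst_up t s r A :
  instN t (subst (upN s) r A) = subst (scons t s) r A.
Proof.
  unfold instN. rewrite subst_comp. apply subst_agree; [|reflexivity].
  intros [|n] _; simpl; [reflexivity|]. rewrite tsubst_comp. apply tsubst_id.
Qed.

Lemma instS_subst_up X s r A :
  instS X (subst s (upS r) A) = subst s (scons X r) A.
Proof.
  unfold instS. rewrite subst_comp. apply subst_agree; [|now intros [|n] _].
  intros n _. apply tsubst_id.
Qed.

Lemma fresh_ex_number G A k :
  nbound A <= S k -> (forall B, In B G -> nbound B <= k) ->
  prf T G (FExN A) -> prf T (instN (TVar k) A :: G) FBot -> prf T G FBot.
Proof.
  intros HA HG Hex H.
  set (s := fun n => if n =? k then TVar 0 else TVar (S n)).
  apply (prf_subst s (fun n => n)) in H. simpl in H.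
  rewrite subst_instN in H.
  assert (Hk : tsubst s (TVar k) = TVar 0) by (simpl; unfold s; now rewrite Nat.eqb_refl).
  assert (Hs : forall n, n < k -> s n = TVar (S n)).
  { intros n Hn. unfold s. destruct (Nat.eqb_spec n k); [lia | reflexivity]. }
  rewrite Hk, (subst_agree A _ TVar _ (fun n => n)), subst_id in H; auto.
  - eapply p_exNE; [exact Hex|]. simpl.
    replace (map liftN G) with (map (subst s (fun n => n)) G); [exact H|].
    apply map_ext_in. intros B HB. apply subst_agree; [|reflexivity].
    intros n Hn. apply Hs. specialize (HG B HB). lia.
  - intros [|n] Hn; simpl; [reflexivity|]. apply Hs. lia.
Qed.

Lemma fresh_ex_set G A k :
  sbound A <= S k -> (forall B, In B G -> sbound B <= k) ->
  prf T G (FExS A) -> prf T (instS k A :: G) FBot -> prf T G FBot.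
Proof.
  intros HA HG Hex H.
  set (r := fun n => if n =? k then 0 else S n).
  apply (prf_subst TVar r) in H. simpl in H.
  rewrite subst_instS in H.
  assert (Hk : r k = 0) by (unfold r; now rewrite Nat.eqb_refl).
  assert (Hs : forall n, n < k -> r n = S n).
  { intros n Hn. unfold r. destruct (Nat.eqb_spec n k); [lia | reflexivity]. }
  rewrite Hk, (subst_agree A _ TVar _ (fun n => n)), subst_id in H; auto.
  - eapply p_exSE; [exact Hex|]. simpl.
    replace (map liftS G) with (map (subst TVar r) G); [exact H|].
    apply map_ext_in. intros B HB. apply subst_agree; [reflexivity|].
    intros n Hn. apply Hs. specialize (HG B HB). lia.
  - intros [|n] Hn; simpl; [reflexivity|]. apply Hs. lia.
Qed.

Lemma not_all_ex_notN G A : prf T G (FNot (FAllN A)) -> prf T G (FExN (FNot A)).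
Proof.
  intros H. apply p_raa.
  eapply p_impE; [eapply prf_weaken; [exact H | apply incl_tl, incl_refl]|].
  apply p_allNI, p_raa. eapply p_impE; [apply p_hyp; right; left; reflexivity|].
  apply (p_exNI T _ _ (TVar 0)).
  change (FImp (subst (upN tshift) (fun X => X) A) FBot)
    with (subst (upN tshift) (fun X => X) (FNot A)).
  rewrite instN_subst_up, (subst_agree _ _ TVar _ (fun n => n)), subst_id; auto.
  - apply p_hyp; now left.
  - now intros [|n] _.
Qed.

Lemma not_all_ex_notS G A : prf T G (FNot (FAllS A)) -> prf T G (FExS (FNot A)).
Proof.
  intros H. apply p_raa.
  eapply p_impE; [eapply prf_weaken; [exact H | apply incl_tl, incl_refl]|].
  apply p_allSI, p_raa. eapply p_impE; [apply p_hyp; right; left; reflexivity|].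
  apply (p_exSI T _ _ 0).
  change (FImp (subst TVar (upS S) A) FBot)
    with (subst TVar (upS S) (FNot A)).
  rewrite instS_subst_up, (subst_agree _ _ TVar _ (fun n => n)), subst_id; auto.
  - apply p_hyp; now left.
  - now intros [|n] _.
Qed.

End Deduction.

(** * Enumeration of formulas *)

Definition pcode (p : nat * nat) : nat := to_nat p.

Lemma pcode_inj p q : pcode p = pcode q -> p = q.
Proof. apply to_nat_inj. Qed.

Opaque pcode.

Fixpoint tcode (t : tm) : nat :=
  match t with
  | TVar n => pcode (0, n)
  | TZero => pcode (1, 0)
  | TOne => pcode (2, 0)
  | TAdd s t => pcode (3, pcode (tcode s, tcode t))
  | TMul s t => pcode (4, pcode (tcode s, tcode t))
  end.

Fixpoint fcode (A : fm) : nat :=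
  match A with
  | FBot => pcode (0, 0)
  | FEq s t => pcode (1, pcode (tcode s, tcode t))
  | FLt s t => pcode (2, pcode (tcode s, tcode t))
  | FMem t X => pcode (3, pcode (tcode t, X))
  | FAnd A B => pcode (4, pcode (fcode A, fcode B))
  | FOr A B => pcode (5, pcode (fcode A, fcode B))
  | FImp A B => pcode (6, pcode (fcode A, fcode B))
  | FAllN A => pcode (7, fcode A)
  | FExN A => pcode (8, fcode A)
  | FAllS A => pcode (9, fcode A)
  | FExS A => pcode (10, fcode A)
  end.

Ltac inv_pcode :=
  repeat match goal with
  | H : pcode _ = pcode _ |- _ => apply pcode_inj in H; injection H; clear H; intros
  | H : (_, _) = (_, _) |- _ => injection H; clear H; intros
  end.

Lemma tcode_inj (s : tm) : forall t, tcode s = tcode t -> s = t.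
Proof.
  induction s; destruct t; cbn [tcode]; intros H; inv_pcode; try discriminate;
    f_equal; auto.
Qed.

Lemma fcode_inj (A : fm) : forall B, fcode A = fcode B -> A = B.
Proof.
  induction A; destruct B; cbn [fcode]; intros H; inv_pcode; try discriminate;
    f_equal; auto using tcode_inj.
Qed.

(** Numbers that code no formula get an arbitrary value. This is harmless: the construction below
    only needs every formula to occur, and [extend] keeps consistency for any formula. *)
Definition enum (n : nat) : fm := epsilon (inhabits FBot) (fun A => fcode A = n).

Lemma enum_fcode A : enum (fcode A) = A.
Proof. apply fcode_inj. unfold enum. apply epsilon_spec. now exists A. Qed.

(** * Structures and satisfaction *)

Record model : Type := Model {
  num : Type;
  set : Type;
  some_set : set;
  zero : num;
  one : num;
  add : num -> num -> num;
  mul : num -> num -> num;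
  lt : num -> num -> Prop;
  elem : num -> set -> Prop
}.

Section Semantics.
Variable M : model.

Fixpoint teval (s : nat -> num M) (t : tm) : num M :=
  match t with
  | TVar n => s n
  | TZero => zero M
  | TOne => one M
  | TAdd t u => add M (teval s t) (teval s u)
  | TMul t u => mul M (teval s t) (teval s u)
  end.

Fixpoint sat (s : nat -> num M) (r : nat -> set M) (A : fm) : Prop :=
  match A with
  | FBot => False
  | FEq t u => teval s t = teval s u
  | FLt t u => lt M (teval s t) (teval s u)
  | FMem t X => elem M (teval s t) (r X)
  | FAnd A B => sat s r A /\ sat s r B
  | FOr A B => sat s r A \/ sat s r B
  | FImp A B => sat s r A -> sat s r B
  | FAllN A => forall x, sat (scons x s) r A
  | FExN A => exists x, sat (scons x s) r A
  | FAllS A => forall X, sat s (scons X r) A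
  | FExS A => exists X, sat s (scons X r) A
  end.

Lemma teval_tsubst s f t : teval s (tsubst f t) = teval (fun n => teval s (f n)) t.
Proof. induction t; simpl; congruence. Qed.

Lemma sat_subst A : forall s r f g,
  sat s r (subst f g A) <-> sat (fun n => teval s (f n)) (fun n => r (g n)) A.
Proof.
  assert (HN : forall x s f, (fun n => teval (scons x s) (upN f n))
                             = scons x (fun n => teval s (f n))).
  { intros. apply functional_extensionality. intros [|n]; simpl; [reflexivity|].
    now rewrite teval_tsubst. }
  assert (HS : forall X (r : nat -> set M) g, (fun n => scons X r (upS g n))
                             = scons X (fun n => r (g n))).
  { intros. apply functional_extensionality. now intros [|n]. }
  induction A; simpl; intros; rewrite ?teval_tsubst; try reflexivity.
  - now rewrite IHA1, IHA2.
  - now rewrite IHA1, IHA2.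
  - now rewrite IHA1, IHA2.
  - split; intros H x; [rewrite <- HN; now apply IHA | apply IHA; now rewrite HN].
  - split; intros [x H]; exists x; [rewrite <- HN; now apply IHA | apply IHA; now rewrite HN].
  - split; intros H x; [rewrite <- HS; now apply IHA | apply IHA; now rewrite HS].
  - split; intros [x H]; exists x; [rewrite <- HS; now apply IHA | apply IHA; now rewrite HS].
Qed.

End Semantics.

Definition models (T : fm -> Prop) (M : model) : Prop :=
  forall A, T A -> forall s r, sat M s r A.

(** * Henkin's construction *)

Section Completeness.
Variable T : fm -> Prop.
Variable A0 : fm.
Hypothesis unprovable : ~ prf T [] A0.

Definition consistent (G : list fm) : Prop := ~ prf T G FBot.

Definition fresh_num (G : list fm) : nat := list_max (map nbound G).
Definition fresh_set (G : list fm) : nat := list_max (map sbound G).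

Lemma fresh_num_spec G B : In B G -> nbound B <= fresh_num G.
Proof.
  intros H. pose proof (proj1 (list_max_le (map nbound G) (fresh_num G)) (le_n _)) as HF.
  rewrite Forall_forall in HF. now apply HF, in_map.
Qed.

Lemma fresh_set_spec G B : In B G -> sbound B <= fresh_set G.
Proof.
  intros H. pose proof (proj1 (list_max_le (map sbound G) (fresh_set G)) (le_n _)) as HF.
  rewrite Forall_forall in HF. now apply HF, in_map.
Qed.

(** The witness variable is taken beyond all free variables of [A :: G], as [fresh_ex_number] and
    [fresh_ex_set] require. *)
Definition witnesses (G : list fm) (A : fm) : list fm :=
  match A with
  | FExN B => [instN (TVar (fresh_num (A :: G))) B]
  | FExS B => [instS (fresh_set (A :: G)) B]
  | _ => []
  end.

Definition extend (G : list fm) (A : fm) : list fm :=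
  if excluded_middle_informative (consistent (A :: G))
  then witnesses G A ++ A :: G
  else FNot A :: G.

Lemma extend_incl G A : incl G (extend G A).
Proof.
  unfold extend. destruct excluded_middle_informative.
  - apply incl_appr, incl_tl, incl_refl.
  - apply incl_tl, incl_refl.
Qed.

Lemma extend_consistent G A : consistent G -> consistent (extend G A).
Proof.
  intros HG. unfold extend. destruct excluded_middle_informative as [H|H].
  - destruct A; simpl; try exact H; intros H'; apply H.
    + eapply (fresh_ex_number T _ A (fresh_num (FExN A :: G))); [| | |exact H'].
      * pose proof (fresh_num_spec (FExN A :: G) (FExN A) (or_introl eq_refl)) as E.
        change (pred (nbound A) <= fresh_num (FExN A :: G)) in E. lia.
      * apply fresh_num_spec.
      * apply p_hyp. now left.
    + eapply (fresh_ex_set T _ A (fresh_set (FExS A :: G))); [| | |exact H'].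
      * pose proof (fresh_set_spec (FExS A :: G) (FExS A) (or_introl eq_refl)) as E.
        change (pred (sbound A) <= fresh_set (FExS A :: G)) in E. lia.
      * apply fresh_set_spec.
      * apply p_hyp. now left.
  - intros H'. apply HG. unfold consistent in H. apply NNPP in H.
    eapply p_impE; [apply p_impI, H'|]. now apply p_impI.
Qed.

Fixpoint stage (n : nat) : list fm :=
  match n with 0 => [FNot A0] | S n => extend (stage n) (enum n) end.

Lemma stage_consistent n : consistent (stage n).
Proof.
  induction n; simpl; [|now apply extend_consistent].
  intros H. apply unprovable. now apply p_raa.
Qed.

Lemma stage_mono m n : m <= n -> incl (stage m) (stage n).
Proof.
  induction 1; [apply incl_refl|]. eapply incl_tran; [exact IHle | apply extend_incl].
Qed.

(** Derivability from some finite stage takes the place of membership in the maximal consistent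
    theory, so that closure under the rules is immediate from weakening. *)
Definition holds (A : fm) : Prop := exists n, prf T (stage n) A.

Lemma holds_closed A B C :
  (forall G, prf T G A -> prf T G B -> prf T G C) -> holds A -> holds B -> holds C.
Proof.
  intros H [n Hn] [m Hm]. exists (max n m). apply H.
  - eapply prf_weaken; [exact Hn|]. apply stage_mono. lia.
  - eapply prf_weaken; [exact Hm|]. apply stage_mono. lia.
Qed.

Lemma holds_closed1 A C : (forall G, prf T G A -> prf T G C) -> holds A -> holds C.
Proof. intros H HA. eapply holds_closed with (A := A) (B := A); eauto. Qed.

Lemma holds_bot : ~ holds FBot.
Proof. intros [n Hn]. now apply (stage_consistent n). Qed.

Lemma holds_dec A : holds A \/ holds (FNot A).
Proof.
  pose proof (enum_fcode A) as E. set (n := fcode A) in *.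
  assert (Hn : prf T (stage (S n)) A \/ prf T (stage (S n)) (FNot A)).
  { simpl. rewrite E. unfold extend. destruct excluded_middle_informative.
    - left. apply p_hyp, in_or_app. right. now left.
    - right. apply p_hyp. now left. }
  destruct Hn; [left | right]; eexists; eassumption.
Qed.

Lemma holds_not A : holds (FNot A) <-> ~ holds A.
Proof.
  split.
  - intros H1 H2. apply holds_bot. revert H1 H2. apply holds_closed. intros G. apply p_impE.
  - intros H. destruct (holds_dec A); [contradiction | assumption].
Qed.

Lemma holds_imp A B : holds (FImp A B) <-> (holds A -> holds B).
Proof.
  split.
  - apply holds_closed. intros G. apply p_impE.
  - intros H. destruct (holds_dec A) as [HA|HA].
    + apply H in HA. revert HA. apply holds_closed1. intros G HB.
      apply p_impI. eapply prf_weaken; [exact HB | apply incl_tl, incl_refl].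
    + revert HA. apply holds_closed1. intros G HA. apply p_impI, prf_efq.
      eapply p_impE; [|apply p_hyp; now left].
      eapply prf_weaken; [exact HA | apply incl_tl, incl_refl].
Qed.

Lemma holds_and A B : holds (FAnd A B) <-> holds A /\ holds B.
Proof.
  split.
  - intros H. split; revert H; apply holds_closed1; intros G.
    + apply p_andE1.
    + apply p_andE2.
  - intros [HA HB]. revert HA HB. apply holds_closed. intros G. apply p_andI.
Qed.

Lemma holds_or A B : holds (FOr A B) <-> holds A \/ holds B.
Proof.
  split.
  - intros H. destruct (holds_dec A) as [HA|HA]; [now left|right].
    revert H HA. apply holds_closed. intros G H HA.
    eapply p_orE; [exact H | | apply p_hyp; now left].
    apply prf_efq. eapply p_impE; [|apply p_hyp; now left].
    eapply prf_weaken; [exact HA | apply incl_tl, incl_refl].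
  - intros [H|H]; revert H; apply holds_closed1; intros G; [apply p_orI1 | apply p_orI2].
Qed.

Lemma holds_witnesses A :
  holds A -> exists G, forall B, In B (witnesses G A) -> holds B.
Proof.
  intros HA. pose proof (enum_fcode A) as E. set (n := fcode A) in *.
  exists (stage n). intros B HB.
  exists (S n). apply p_hyp. simpl. rewrite E. unfold extend.
  destruct excluded_middle_informative as [H|H].
  - apply in_or_app. now left.
  (* A formula is rejected only if its own stage refutes it, and then its negation holds; so a
     formula that holds was accepted, together with its witness. *)
  - exfalso. apply NNPP in H. apply (proj1 (holds_not A)); [|exact HA].
    exists n. now apply p_impI.
Qed.

Lemma holds_exN A : holds (FExN A) <-> exists t, holds (instN t A).
Proof.
  split.
  - intros H. destruct (holds_witnesses (FExN A) H) as [G HG].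
    eexists. apply HG. now left.
  - intros [t H]. revert H. apply holds_closed1. intros G. apply p_exNI.
Qed.

Lemma holds_exS A : holds (FExS A) <-> exists X, holds (instS X A).
Proof.
  split.
  - intros H. destruct (holds_witnesses (FExS A) H) as [G HG].
    eexists. apply HG. now left.
  - intros [t H]. revert H. apply holds_closed1. intros G. apply p_exSI.
Qed.

Lemma holds_allN A : holds (FAllN A) <-> forall t, holds (instN t A).
Proof.
  split.
  - intros H t. revert H. apply holds_closed1. intros G H. now apply p_allNE.
  - intros H. destruct (holds_dec (FAllN A)) as [|HA]; [assumption|].
    exfalso. eapply holds_closed1 in HA; [|intros G; apply not_all_ex_notN].
    apply holds_exN in HA as [t Ht].
    change (holds (FNot (instN t A))) in Ht. now apply (proj1 (holds_not _) Ht).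
Qed.

Lemma holds_allS A : holds (FAllS A) <-> forall X, holds (instS X A).
Proof.
  split.
  - intros H t. revert H. apply holds_closed1. intros G H. now apply p_allSE.
  - intros H. destruct (holds_dec (FAllS A)) as [|HA]; [assumption|].
    exfalso. eapply holds_closed1 in HA; [|intros G; apply not_all_ex_notS].
    apply holds_exS in HA as [t Ht].
    change (holds (FNot (instS t A))) in Ht. now apply (proj1 (holds_not _) Ht).
Qed.

Lemma holds_refl t : holds (FEq t t).
Proof. exists 0. apply p_refl. Qed.

Lemma holds_eqE A s t : holds (FEq s t) -> holds (instN s A) -> holds (instN t A).
Proof. apply holds_closed. intros G. apply p_eqE. Qed.

Lemma instN_shift t u : tsubst (scons t TVar) (tsubst tshift u) = u.
Proof. rewrite tsubst_comp. simpl. apply tsubst_id. Qed.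

Lemma holds_sym s t : holds (FEq s t) -> holds (FEq t s).
Proof.
  intros H. pose proof (holds_eqE (FEq (TVar 0) (tsubst tshift s)) s t H) as E.
  unfold instN in E. simpl in E. rewrite !instN_shift in E. apply E, holds_refl.
Qed.

Lemma holds_trans s t u : holds (FEq s t) -> holds (FEq t u) -> holds (FEq s u).
Proof.
  intros H1 H2. pose proof (holds_eqE (FEq (tsubst tshift s) (TVar 0)) t u H2) as E.
  unfold instN in E. simpl in E. rewrite !instN_shift in E. now apply E.
Qed.

(** Here [f] is [TAdd] or [TMul]; the hypothesis says that it commutes with instantiation. The
    equality rule replaces one argument at a time. *)
Lemma holds_cong (f : tm -> tm -> tm) s t s' t' :
  (forall u v a, tsubst (scons a TVar) (f u v)
     = f (tsubst (scons a TVar) u) (tsubst (scons a TVar) v)) ->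
  holds (FEq s s') -> holds (FEq t t') -> holds (FEq (f s t) (f s' t')).
Proof.
  intros Hf H1 H2.
  apply holds_trans with (f s' t).
  - pose proof (holds_eqE (FEq (tsubst tshift (f s t)) (f (TVar 0) (tsubst tshift t))) s s' H1) as E.
    unfold instN in E. simpl in E. rewrite !Hf, !instN_shift in E. apply E, holds_refl.
  - pose proof (holds_eqE (FEq (tsubst tshift (f s' t)) (f (tsubst tshift s') (TVar 0))) t t' H2) as E.
    unfold instN in E. simpl in E. rewrite !Hf, !instN_shift in E. apply E, holds_refl.
Qed.

Lemma holds_lt s t s' t' :
  holds (FEq s s') -> holds (FEq t t') -> holds (FLt s t) -> holds (FLt s' t').
Proof.
  intros H1 H2 H.
  pose proof (holds_eqE (FLt (TVar 0) (tsubst tshift t)) s s' H1) as E.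
  unfold instN in E. simpl in E. rewrite !instN_shift in E. apply E in H. clear E.
  pose proof (holds_eqE (FLt (tsubst tshift s') (TVar 0)) t t' H2) as E.
  unfold instN in E. simpl in E. rewrite !instN_shift in E. now apply E in H.
Qed.

Lemma holds_mem s s' X : holds (FEq s s') -> holds (FMem s X) -> holds (FMem s' X).
Proof. intros H1. apply (holds_eqE (FMem (TVar 0) X) s s' H1). Qed.

(* Canonical representatives turn provable equality into Leibniz equality. *)
Definition rep (t : tm) : tm := epsilon (inhabits t) (fun u => holds (FEq t u)).

Lemma holds_rep t : holds (FEq t (rep t)).
Proof. unfold rep. apply epsilon_spec. exists t. apply holds_refl. Qed.

Lemma rep_eq s t : holds (FEq s t) <-> rep s = rep t.
Proof.
  split.
  - intros H. unfold rep.
    replace (fun u => holds (FEq t u)) with (fun u => holds (FEq s u)).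
    + f_equal. apply proof_irrelevance.
    + apply functional_extensionality. intros u. apply propositional_extensionality.
      split; apply holds_trans; [now apply holds_sym | assumption].
  - intros E. eapply holds_trans; [apply holds_rep|]. rewrite E.
    apply holds_sym, holds_rep.
Qed.

Definition henkin_num : Type := {t : tm | rep t = t}.

Definition cls (t : tm) : henkin_num :=
  exist _ (rep t) (eq_sym (proj1 (rep_eq t (rep t)) (holds_rep t))).

Lemma cls_eq s t : cls s = cls t <-> holds (FEq s t).
Proof.
  rewrite rep_eq. split; [intros E; exact (f_equal (@proj1_sig _ _) E)|].
  intros E. unfold cls. apply eq_sig_uncurried. exists E. apply proof_irrelevance.
Qed.

Lemma cls_val (a : henkin_num) : cls (proj1_sig a) = a.
Proof.
  destruct a as [t Ht]. apply eq_sig_uncurried. exists Ht. apply proof_irrelevance.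
Qed.

Definition henkin : model := {|
  num := henkin_num;
  set := nat;
  some_set := 0;
  zero := cls TZero;
  one := cls TOne;
  add a b := cls (TAdd (proj1_sig a) (proj1_sig b));
  mul a b := cls (TMul (proj1_sig a) (proj1_sig b));
  lt a b := holds (FLt (proj1_sig a) (proj1_sig b));
  elem a X := holds (FMem (proj1_sig a) X)
|}.

Lemma henkin_teval s t : teval henkin (fun n => cls (s n)) t = cls (tsubst s t).
Proof.
  induction t; simpl; try reflexivity; rewrite IHt1, IHt2; apply cls_eq;
    apply holds_cong; auto using holds_sym, holds_rep.
Qed.

Lemma henkin_sat A : forall s r,
  sat henkin (fun n => cls (s n)) r A <-> holds (subst s r A).
Proof.
  assert (HN : forall s1 t, scons (cls t) (fun n => cls (s1 n)) = (fun n => cls (scons t s1 n))).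
  { intros. apply functional_extensionality. now intros [|n]. }
  induction A as [|t u|t u|t X|A IHA1 B IHA2|A IHA1 B IHA2|A IHA1 B IHA2|A IHA|A IHA|A IHA|A IHA]; simpl; intros s r; rewrite ?henkin_teval.
  - split; [tauto | apply holds_bot].
  - apply cls_eq.
  - split; apply holds_lt; auto using holds_sym, holds_rep.
  - split; apply holds_mem; auto using holds_sym, holds_rep.
  - now rewrite IHA1, IHA2, holds_and.
  - now rewrite IHA1, IHA2, holds_or.
  - now rewrite IHA1, IHA2, holds_imp.
  - rewrite holds_allN. split.
    + intros H t. rewrite instN_subst_up, <- IHA, <- HN. apply H.
    + intros H a. rewrite <- (cls_val a), HN. apply IHA. rewrite <- instN_subst_up. apply H.
  - rewrite holds_exN. split.
    + intros [a H]. exists (proj1_sig a). rewrite instN_subst_up, <- IHA, <- HN.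
      now rewrite cls_val.
    + intros [t H]. exists (cls t). rewrite HN. apply IHA. now rewrite <- instN_subst_up.
  - rewrite holds_allS. split.
    + intros H X. rewrite instS_subst_up, <- IHA. apply H.
    + intros H X. apply IHA. rewrite <- instS_subst_up. apply H.
  - rewrite holds_exS. split.
    + intros [X H]. exists X. now rewrite instS_subst_up, <- IHA.
    + intros [X H]. exists X. apply IHA. now rewrite <- instS_subst_up.
Qed.

(** Every assignment consists of classes of terms and hence is a substitution in disguise, so
    [closed_subst] turns an axiom into each of its instances. *)
Lemma henkin_models : models T henkin.
Proof.
  intros A HA s r.
  replace s with (fun n => cls (proj1_sig (s n))).
  - apply henkin_sat. exists 0. eapply prf_weaken; [|apply incl_nil_l].
    apply closed_subst. now apply p_ax.
  - apply functional_extensionality. intros n. apply cls_val.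
Qed.

Lemma henkin_refutes : ~ sat henkin (fun n => cls (TVar n)) (fun n => n) A0.
Proof.
  rewrite henkin_sat, subst_id, <- holds_not. exists 0. apply p_hyp. now left.
Qed.

End Completeness.

Theorem completeness (T : fm -> Prop) (A : fm) :
  (forall M, models T M -> forall s r, sat M s r A) -> proves T A.
Proof.
  intros H. apply NNPP. intros HA.
  apply (henkin_refutes T A HA). apply H. now apply henkin_models.
Qed.

(** * Predicates defined by bounded formulas *)

(** Interleaving leaves infinitely many slots for parameters, so that combining formulas never
    disturbs the positions of the proper variables. *)
Definition mix {X : Type} (a b : nat -> X) (n : nat) : X :=
  if Nat.even n then a (Nat.div2 n) else b (Nat.div2 n).

Lemma mix_even {X : Type} (a b : nat -> X) n : mix a b (2 * n) = a n.
Proof.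
  unfold mix. now rewrite Nat.even_even, Nat.div2_double.
Qed.

Lemma mix_odd {X : Type} (a b : nat -> X) n : mix a b (S (2 * n)) = b n.
Proof.
  unfold mix. replace (Nat.even (S (2 * n))) with false.
  - now rewrite Nat.div2_succ_double.
  - symmetry. rewrite <- Nat.add_1_r. apply Nat.even_odd.
Qed.

Lemma mix_ext {X : Type} (f g : nat -> X) :
  (forall n, f (2 * n) = g (2 * n)) -> (forall n, f (S (2 * n)) = g (S (2 * n))) -> f = g.
Proof.
  intros H1 H2. apply functional_extensionality. intros n.
  destruct (Nat.Even_or_Odd n) as [[k ->]|[k ->]]; [apply H1|].
  rewrite Nat.add_1_r. apply H2.
Qed.

Lemma bounded_subst A : bounded A -> forall s r, bounded (subst s r A).
Proof.
  assert (Ht : forall s t, tsubst (upN s) (tsubst tshift t) = tsubst tshift (tsubst s t)).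
  { intros. now rewrite !tsubst_comp. }
  induction 1; intros; simpl; rewrite ?Ht; constructor; auto.
Qed.

Section Definability.
Variable M : model.

(* In the assignment [mix e s] the values [e] are the variables of a definable
   predicate or function and [s] holds its number parameters. *)
Definition Rep (A : fm) s r (P : (nat -> num M) -> Prop) : Prop :=
  bounded A /\ forall e, P e <-> sat M (mix e s) r A.
Definition D0 (P : (nat -> num M) -> Prop) : Prop := exists A s r, Rep A s r P.
Definition TRep (u : tm) s (t : (nat -> num M) -> num M) : Prop :=
  forall e, t e = teval M (mix e s) u.
Definition DT (t : (nat -> num M) -> num M) : Prop := exists u s, TRep u s t.

(** Two formulas with parameter lists [s1] and [s2] are brought to the common list [mix s1 s2]:
    parameter [m] moves to place [2 * m] for the first formula and, by [tagr], to [2 * m + 1] for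
    the second. *)
Definition tagl (n : nat) : nat := if Nat.even n then n else S (2 * (2 * Nat.div2 n)).
Definition tagr (n : nat) : nat := if Nat.even n then n else S (2 * (S (2 * Nat.div2 n))).

Lemma even_double n : Nat.even (2 * n) = true.
Proof. apply Nat.even_even. Qed.

Lemma even_succ_double n : Nat.even (S (2 * n)) = false.
Proof. rewrite <- Nat.add_1_r. apply Nat.even_odd. Qed.

Lemma mix_tagl {X : Type} (e s1 s2 : nat -> X) :
  (fun n => mix e (mix s1 s2) (tagl n)) = mix e s1.
Proof.
  apply mix_ext; intros n; unfold tagl.
  - now rewrite even_double, !mix_even.
  - now rewrite even_succ_double, Nat.div2_succ_double, !mix_odd, mix_even.
Qed.

Lemma mix_tagr {X : Type} (e s1 s2 : nat -> X) :
  (fun n => mix e (mix s1 s2) (tagr n)) = mix e s2.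
Proof.
  apply mix_ext; intros n; unfold tagr.
  - now rewrite even_double, !mix_even.
  - now rewrite even_succ_double, Nat.div2_succ_double, !mix_odd.
Qed.

Lemma Rep_l A s1 s2 r1 r2 P : Rep A s1 r1 P ->
  Rep (subst (fun n => TVar (tagl n)) (fun n => 2 * n) A) (mix s1 s2) (mix r1 r2) P.
Proof.
  intros [HA H]. split; [now apply bounded_subst|]. intros e.
  rewrite H, sat_subst. cbn [teval]. rewrite mix_tagl.
  replace (fun n => mix r1 r2 (2 * n)) with r1; [reflexivity|].
  apply functional_extensionality. intros n. now rewrite mix_even.
Qed.

Lemma Rep_r A s1 s2 r1 r2 P : Rep A s2 r2 P ->
  Rep (subst (fun n => TVar (tagr n)) (fun n => S (2 * n)) A) (mix s1 s2) (mix r1 r2) P.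
Proof.
  intros [HA H]. split; [now apply bounded_subst|]. intros e.
  rewrite H, sat_subst. cbn [teval]. rewrite mix_tagr.
  replace (fun n => mix r1 r2 (S (2 * n))) with r2; [reflexivity|].
  apply functional_extensionality. intros n. now rewrite mix_odd.
Qed.

Lemma TRep_l u s1 s2 t : TRep u s1 t ->
  TRep (tsubst (fun n => TVar (tagl n)) u) (mix s1 s2) t.
Proof. intros H e. rewrite H, teval_tsubst. cbn [teval]. now rewrite mix_tagl. Qed.

Lemma TRep_r u s1 s2 t : TRep u s2 t ->
  TRep (tsubst (fun n => TVar (tagr n)) u) (mix s1 s2) t.
Proof. intros H e. rewrite H, teval_tsubst. cbn [teval]. now rewrite mix_tagr. Qed.

Lemma D0_reindex (f : nat -> nat) P : D0 P -> D0 (fun e => P (fun n => e (f n))).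
Proof.
  intros (A & s & r & HA & H).
  exists (subst (fun n => TVar (if Nat.even n then 2 * f (Nat.div2 n) else n)) (fun X => X) A), s, r.
  split; [now apply bounded_subst|]. intros e. rewrite H, sat_subst. cbn [teval].
  match goal with |- sat _ ?a _ _ <-> sat _ ?b _ _ => replace b with a; [reflexivity|] end.
  apply mix_ext; intros n.
  - now rewrite even_double, Nat.div2_double, !mix_even.
  - now rewrite even_succ_double, !mix_odd.
Qed.

Lemma DT_var n : DT (fun e => e n).
Proof.
  exists (TVar (2 * n)), (fun _ => zero M). intros e. cbn [teval]. now rewrite mix_even.
Qed.

Lemma DT_const a : DT (fun _ => a).
Proof. exists (TVar 1), (fun _ => a). intros e. reflexivity. Qed.

Lemma DT_add t u : DT t -> DT u -> DT (fun e => add M (t e) (u e)).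
Proof.
  intros (t' & s1 & H1) (u' & s2 & H2).
  apply (TRep_l _ s1 s2) in H1. apply (TRep_r _ s1 s2) in H2.
  eexists (TAdd _ _), _. intros e. cbn [teval]. now rewrite H1, H2.
Qed.

Lemma DT_mul t u : DT t -> DT u -> DT (fun e => mul M (t e) (u e)).
Proof.
  intros (t' & s1 & H1) (u' & s2 & H2).
  apply (TRep_l _ s1 s2) in H1. apply (TRep_r _ s1 s2) in H2.
  eexists (TMul _ _), _. intros e. cbn [teval]. now rewrite H1, H2.
Qed.

Lemma DT_reindex (f : nat -> nat) t : DT t -> DT (fun e => t (fun n => e (f n))).
Proof.
  intros (u & s & H).
  exists (tsubst (fun n => TVar (if Nat.even n then 2 * f (Nat.div2 n) else n)) u), s.
  intros e. rewrite H, teval_tsubst. cbn [teval]. f_equal.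
  apply mix_ext; intros n.
  - now rewrite even_double, Nat.div2_double, !mix_even.
  - now rewrite even_succ_double, !mix_odd.
Qed.

Lemma D0_eq t u : DT t -> DT u -> D0 (fun e => t e = u e).
Proof.
  intros (t' & s1 & H1) (u' & s2 & H2).
  apply (TRep_l _ s1 s2) in H1. apply (TRep_r _ s1 s2) in H2.
  eexists (FEq _ _), _, (fun _ => some_set M). split; [constructor|].
  intros e. cbn [sat]. now rewrite H1, H2.
Qed.

Lemma D0_lt t u : DT t -> DT u -> D0 (fun e => lt M (t e) (u e)).
Proof.
  intros (t' & s1 & H1) (u' & s2 & H2).
  apply (TRep_l _ s1 s2) in H1. apply (TRep_r _ s1 s2) in H2.
  eexists (FLt _ _), _, (fun _ => some_set M). split; [constructor|].
  intros e. cbn [sat]. now rewrite H1, H2.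
Qed.

Lemma D0_mem t X : DT t -> D0 (fun e => elem M (t e) X).
Proof.
  intros (t' & s & H).
  eexists (FMem t' 0), s, (fun _ => X). split; [constructor|].
  intros e. cbn [sat]. now rewrite H.
Qed.

Lemma D0_False : D0 (fun _ => False).
Proof.
  exists FBot, (fun _ => zero M), (fun _ => some_set M). split; [constructor | reflexivity].
Qed.

Lemma D0_and P Q : D0 P -> D0 Q -> D0 (fun e => P e /\ Q e).
Proof.
  intros (A & s1 & r1 & H1) (B & s2 & r2 & H2).
  apply (Rep_l _ s1 s2 r1 r2) in H1. apply (Rep_r _ s1 s2 r1 r2) in H2.
  eexists (FAnd _ _), _, _. split; [constructor; [apply H1 | apply H2]|].
  intros e. cbn [sat]. now rewrite (proj2 H1), (proj2 H2).
Qed.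

Lemma D0_or P Q : D0 P -> D0 Q -> D0 (fun e => P e \/ Q e).
Proof.
  intros (A & s1 & r1 & H1) (B & s2 & r2 & H2).
  apply (Rep_l _ s1 s2 r1 r2) in H1. apply (Rep_r _ s1 s2 r1 r2) in H2.
  eexists (FOr _ _), _, _. split; [constructor; [apply H1 | apply H2]|].
  intros e. cbn [sat]. now rewrite (proj2 H1), (proj2 H2).
Qed.

Lemma D0_imp P Q : D0 P -> D0 Q -> D0 (fun e => P e -> Q e).
Proof.
  intros (A & s1 & r1 & H1) (B & s2 & r2 & H2).
  apply (Rep_l _ s1 s2 r1 r2) in H1. apply (Rep_r _ s1 s2 r1 r2) in H2.
  eexists (FImp _ _), _, _. split; [constructor; [apply H1 | apply H2]|].
  intros e. cbn [sat]. now rewrite (proj2 H1), (proj2 H2).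
Qed.

(** A binder shifts all indices by one and thereby exchanges even and odd places. This renaming
    repairs the parity: the bound value stays at 0, variables step down by one and parameters step
    up by one. *)
Definition open_var (n : nat) : nat :=
  match n with 0 => 0 | S m => if Nat.even m then S (S m) else m end.

Lemma mix_scons {X : Type} (e s : nat -> X) y :
  (fun n => scons y (mix e s) (open_var n)) = mix (scons y e) s.
Proof.
  apply mix_ext; intros n.
  - rewrite mix_even. destruct n as [|n]; [reflexivity|].
    replace (2 * S n) with (S (S (2 * n))) by lia. cbn [open_var].
    rewrite even_succ_double. cbn [scons]. apply mix_even.
  - rewrite mix_odd. cbn [open_var]. rewrite even_double. cbn [scons]. apply mix_odd.
Qed.

Lemma sat_open A s r e y :
  sat M (scons y (mix e s)) r (subst (fun n => TVar (open_var n)) (fun X => X) A)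
  <-> sat M (mix (scons y e) s) r A.
Proof. rewrite sat_subst. cbn [teval]. now rewrite mix_scons. Qed.

Lemma D0_ex t Q :
  DT t -> D0 (fun e => Q (fun n => e (S n)) (e 0)) ->
  D0 (fun e => exists y, lt M y (t e) /\ Q e y).
Proof.
  intros (u & s1 & H1) (A & s2 & r & H2).
  apply (TRep_l _ s1 s2) in H1. apply (Rep_r _ s1 s2 r r) in H2.
  eexists (FExN (FAnd (FLt (TVar 0) (tsubst tshift _))
     (subst (fun n => TVar (open_var n)) (fun X => X) _))), _, _.
  split; [constructor; apply bounded_subst, H2|].
  intros e. cbn [sat]. split; intros [y H]; exists y; revert H;
    rewrite teval_tsubst, sat_open, <- (proj2 H2), H1; exact (fun H => H).
Qed.

Lemma D0_all t Q :
  DT t -> D0 (fun e => Q (fun n => e (S n)) (e 0)) ->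
  D0 (fun e => forall y, lt M y (t e) -> Q e y).
Proof.
  intros (u & s1 & H1) (A & s2 & r & H2).
  apply (TRep_l _ s1 s2) in H1. apply (Rep_r _ s1 s2 r r) in H2.
  eexists (FAllN (FImp (FLt (TVar 0) (tsubst tshift _))
     (subst (fun n => TVar (open_var n)) (fun X => X) _))), _, _.
  split; [constructor; apply bounded_subst, H2|].
  intros e. cbn [sat]. split; intros H y; specialize (H y); revert H;
    rewrite teval_tsubst, sat_open, <- (proj2 H2), H1; exact (fun H => H).
Qed.

Lemma D0_ext P Q : (forall e, Q e <-> P e) -> D0 P -> D0 Q.
Proof.
  intros E (A & s & r & HA & H). exists A, s, r. split; [exact HA|].
  intros e. now rewrite E.
Qed.

Lemma D0_not P : D0 P -> D0 (fun e => ~ P e).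
Proof. intros H. apply D0_imp; [exact H | apply D0_False]. Qed.

End Definability.

Record rca_model : Type := RCAModel { base :> model; base_rca : models RCA0 base }.

(** * Induction and comprehension for bounded predicates *)

Section Principles.
Variable M : rca_model.
Notation N := (num M).

Let e0 : nat -> N := fun _ => zero M.

Definition open_fm (A : fm) : fm := subst (fun n => TVar (open_var n)) (fun X => X) A.

Lemma sat_open1 A s r x :
  sat M (scons x (mix e0 s)) r (open_fm A) <-> sat M (mix (scons x e0) s) r A.
Proof. apply sat_open. Qed.

Lemma sat_open2 A s r x :
  sat M (scons x (mix e0 s)) r (open_fm (FExN (open_fm A))) <->
  exists y, sat M (mix (scons y (scons x e0)) s) r A.
Proof.
  rewrite sat_open1. cbn [sat].
  split; intros [y H]; exists y; revert H; unfold open_fm; rewrite sat_open; exact (fun H => H).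
Qed.

(** In the certificate, slot 0 is the existential witness and slot 1 the induction variable,
    matching the order in which the binders are opened. *)
Lemma sigma1_ind (P : N -> N -> Prop) :
  D0 M (fun e => P (e 1) (e 0)) ->
  (exists y, P (zero M) y) ->
  (forall x, (exists y, P x y) -> exists y, P (add M x (one M)) y) ->
  forall x, exists y, P x y.
Proof.
  intros (A & s & r & HA & H) H0 HS x.
  set (B := open_fm (FExN (open_fm A))).
  assert (HB : forall x, sat M (scons x (mix e0 s)) r B <-> exists y, P x y).
  { intros x'. unfold B. rewrite sat_open2.
    split; intros [y Hy]; exists y; apply (H (scons y (scons x' e0))), Hy. }
  assert (Sigma01 B) as HS1.
  { eexists. split; [|reflexivity]. now apply bounded_subst, bounded_subst. }
  pose proof (base_rca M _ (Sigma01_induction B HS1) (mix e0 s) r) as HI.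
  cbn [sat] in HI. apply HB, HI. split.
  - unfold instN. rewrite sat_subst.
    replace (fun n => teval M (mix e0 s) (scons TZero TVar n)) with (scons (zero M) (mix e0 s));
      [now apply HB|].
    apply functional_extensionality. now intros [|n].
  - intros z Hz. rewrite sat_subst.
    replace (fun n => teval M (scons z (mix e0 s)) (scons (TAdd (TVar 0) TOne) tshift n))
      with (scons (add M z (one M)) (mix e0 s)); [apply HB, HS, HB, Hz|].
    apply functional_extensionality. now intros [|n].
Qed.

Lemma delta0_ind (P : N -> Prop) :
  D0 M (fun e => P (e 0)) -> P (zero M) ->
  (forall x, P x -> P (add M x (one M))) -> forall x, P x.
Proof.
  intros HD H0 HS x.
  destruct (sigma1_ind (fun x y => P x /\ y = y)) with (x := x) as [y [Hy _]]; auto.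
  - apply D0_and; [|apply D0_eq; apply DT_var].
    exact (D0_reindex M S _ HD).
  - now exists (zero M).
  - intros z [y [Hz _]]. exists (zero M). auto.
Qed.

(** With a dummy quantified variable the same bounded formula is both $\Sigma^0_1$ and $\Pi^0_1$, so
    the equivalence demanded by the axiom is trivial. *)
Lemma delta0_comprehension (P : N -> Prop) :
  D0 M (fun e => P (e 0)) -> exists X, forall x, elem M x X <-> P x.
Proof.
  intros HD.
  assert (D0 M (fun e => P (e 1))) as (A & s & r & HA & H) by exact (D0_reindex M S _ HD).
  set (B := open_fm (FExN (open_fm A))).
  set (C := open_fm (FAllN (open_fm A))).
  assert (HB : forall x, sat M (scons x (mix e0 s)) r B <-> P x).
  { intros x'. unfold B. rewrite sat_open2. split.
    - intros [y Hy]. apply (H (scons y (scons x' e0))), Hy.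
    - intros Hx. exists (zero M). now apply (H (scons (zero M) (scons x' e0))). }
  assert (HC : forall x, sat M (scons x (mix e0 s)) r C <-> P x).
  { intros x'. unfold C. rewrite sat_open1. cbn [sat]. unfold open_fm. split.
    - intros Hx. specialize (Hx (zero M)). rewrite sat_open in Hx.
      now apply (H (scons (zero M) (scons x' e0))).
    - intros Hx y. rewrite sat_open. now apply (H (scons y (scons x' e0))). }
  assert (Sigma01 B) as HS1.
  { eexists. split; [|reflexivity]. now apply bounded_subst, bounded_subst. }
  assert (Pi01 C) as HS2.
  { eexists. split; [|reflexivity]. now apply bounded_subst, bounded_subst. }
  pose proof (base_rca M _ (Delta01_comprehension B C HS1 HS2) (mix e0 s) r) as HI.
  cbn [sat FIff] in HI. destruct HI as [X HX].
  - intros x. now rewrite HB, HC.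
  - exists X. intros x. specialize (HX x). unfold liftS in HX. rewrite !sat_subst in HX.
    cbn [teval scons] in HX.
    change (fun n : nat => scons x (mix e0 s) n) with (scons x (mix e0 s)) in HX.
    change (fun n : nat => r n) with r in HX. rewrite HB in HX. exact HX.
Qed.

End Principles.

(** * Arithmetic in a model *)

(** Extension point of [definable]: it is redefined whenever further predicates and terms have been
    shown definable. *)
Ltac definable_hook := fail.

Ltac definable :=
  cbv beta;
  first
  [ apply DT_const
  | apply DT_var
  | apply DT_add; definable
  | apply DT_mul; definable
  | apply D0_False
  | apply D0_eq; definable
  | apply D0_lt; definable
  | apply D0_mem; definable
  | apply D0_and; definable
  | apply D0_or; definable
  | apply D0_not; definable
  | apply D0_ex; definable
  | apply D0_all; definable
  | apply D0_imp; definable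
  | definable_hook
  | assumption ].

Section Arithmetic.
Variable M : rca_model.
Notation N := (num M).
Notation "0" := (zero M).
Notation "1" := (one M).
Notation "x + y" := (add M x y).
Notation "x * y" := (mul M x y).
Notation "x < y" := (lt M x y).

Definition le (x y : N) : Prop := x < y \/ x = y.
Notation "x <= y" := (le x y).

Lemma D0_le t u : DT M t -> DT M u -> D0 M (fun e => t e <= u e).
Proof. intros; unfold le; definable. Qed.

Let env (x y : N) : nat -> N := scons x (scons y (fun _ => 0)).

Ltac axiom A x y :=
  exact (base_rca M _ A (env x y) (fun _ => some_set M)).

Lemma succ_nonzero x : x + 1 <> 0. Proof. axiom succ_neq0 x x. Qed.
Lemma succ_injective x y : x + 1 = y + 1 -> x = y. Proof. axiom succ_inj x y. Qed.
Lemma addn0 x : x + 0 = x. Proof. axiom add_zero x x. Qed.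
Lemma addnS x y : x + (y + 1) = (x + y) + 1. Proof. axiom add_succ x y. Qed.
Lemma muln0 x : x * 0 = 0. Proof. axiom mul_zero x x. Qed.
Lemma mulnS x y : x * (y + 1) = x * y + x. Proof. axiom mul_succ x y. Qed.
Lemma ltn0 x : ~ x < 0. Proof. axiom lt_zero x x. Qed.
Lemma ltnS x y : x < y + 1 <-> x < y \/ x = y. Proof. axiom lt_succ x y. Qed.

Lemma add0n x : 0 + x = x.
Proof.
  pattern x; apply delta0_ind; [definable | apply addn0 |].
  intros y IH. now rewrite addnS, IH.
Qed.

Lemma addSn x y : (x + 1) + y = (x + y) + 1.
Proof.
  pattern y; apply delta0_ind; [definable | now rewrite !addn0 |].
  intros z IH. now rewrite !addnS, IH.
Qed.

Lemma addnC x y : x + y = y + x.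
Proof.
  pattern y; apply delta0_ind; [definable | now rewrite addn0, add0n |].
  intros z IH. now rewrite addnS, addSn, IH.
Qed.

Lemma addnA x y z : x + (y + z) = (x + y) + z.
Proof.
  pattern z; apply delta0_ind; [definable | now rewrite !addn0 |].
  intros u IH. now rewrite !addnS, IH.
Qed.

Lemma mul0n x : 0 * x = 0.
Proof.
  pattern x; apply delta0_ind; [definable | apply muln0 |].
  intros y IH. now rewrite mulnS, IH, addn0.
Qed.

Lemma mulSn x y : (x + 1) * y = x * y + y.
Proof.
  pattern y; apply delta0_ind; [definable | now rewrite !muln0, addn0 |].
  intros z IH. rewrite !mulnS, IH, <- !addnA, !addnS. f_equal. f_equal.
  now rewrite (addnC z x).
Qed.

Lemma mulnC x y : x * y = y * x.
Proof.
  pattern y; apply delta0_ind; [definable | now rewrite muln0, mul0n |].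
  intros z IH. now rewrite mulnS, mulSn, IH.
Qed.

Lemma mulnDr x y z : x * (y + z) = x * y + x * z.
Proof.
  pattern z; apply delta0_ind; [definable | now rewrite muln0, !addn0 |].
  intros u IH. now rewrite addnS, !mulnS, IH, addnA.
Qed.

Lemma mulnA x y z : x * (y * z) = (x * y) * z.
Proof.
  pattern z; apply delta0_ind; [definable | now rewrite !muln0 |].
  intros u IH. now rewrite !mulnS, mulnDr, IH.
Qed.

Lemma mul1n x : 1 * x = x.
Proof. rewrite <- (add0n 1), mulSn, mul0n. apply add0n. Qed.

Lemma mulnDl x y z : (x + y) * z = x * z + y * z.
Proof. now rewrite mulnC, mulnDr, (mulnC z), (mulnC z). Qed.

Lemma model_semiring : semi_ring_theory 0 1 (add M) (mul M) eq.
Proof.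
  constructor; auto using add0n, addnC, addnA, mul1n, mul0n, mulnC, mulnA, mulnDl.
Qed.

Add Ring model_ring : model_semiring.

Lemma lt0S x : 0 < x + 1.
Proof.
  pattern x; apply delta0_ind; [definable | apply ltnS; now right |].
  intros y IH. apply ltnS. now left.
Qed.

Lemma ltSS x y : x < y -> x + 1 < y + 1.
Proof.
  pattern y; apply delta0_ind; [definable | now intros H%ltn0 |].
  intros z IH [H%IH | ->]%ltnS; apply ltnS; auto.
Qed.

(** The bound on [z] makes the statement a bounded formula, so that it can be proved by induction;
    [lt_def] drops it. Other bounds on witnesses below have the same origin. *)
Lemma lt_ex x y : x < y -> exists z, z < y /\ y = x + (z + 1).
Proof.
  pattern y; apply delta0_ind; [definable | now intros H%ltn0 |].
  intros w IH [H | ->]%ltnS.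
  - destruct (IH H) as (z & Hz & ->). exists (z + 1). split; [now apply ltSS | ring].
  - exists 0. split; [apply lt0S | ring].
Qed.

Lemma lt_addS x z : x < x + (z + 1).
Proof.
  pattern z; apply delta0_ind; [definable | |].
  - rewrite add0n. apply ltnS. now right.
  - intros w IH. rewrite addnS. apply ltnS. now left.
Qed.

Lemma lt_def x y : x < y <-> exists z, y = x + (z + 1).
Proof.
  split.
  - intros (z & _ & H)%lt_ex. now exists z.
  - intros [z ->]. apply lt_addS.
Qed.

Lemma addIn z x y : x + z = y + z -> x = y.
Proof.
  pattern z; apply delta0_ind; [definable | now rewrite !addn0 |].
  intros w IH. rewrite !addnS. intros H%succ_injective. auto.
Qed.

Lemma addnI z x y : z + x = z + y -> x = y.
Proof. rewrite !(addnC z). apply addIn. Qed.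

Lemma zero_or_succ x : x = 0 \/ exists y, y < x /\ x = y + 1.
Proof.
  pattern x; apply delta0_ind; [definable | now left |].
  intros y _. right. exists y. split; [|reflexivity]. apply ltnS. now right.
Qed.

Lemma addn_eq0 x y : x + y = 0 -> x = 0 /\ y = 0.
Proof.
  destruct (zero_or_succ y) as [->|(z & _ & ->)].
  - now rewrite addn0.
  - rewrite addnS. now intros H%succ_nonzero.
Qed.

Lemma le_def x y : x <= y <-> exists z, y = x + z.
Proof.
  split.
  - intros [[z H]%lt_def | ->]; [eauto | exists 0; ring].
  - intros [z ->]. destruct (zero_or_succ z) as [->|(w & _ & ->)].
    + right. ring.
    + left. apply lt_addS.
Qed.

Lemma leN_refl x : x <= x. Proof. now right. Qed.

Lemma le0n x : 0 <= x. Proof. apply le_def. exists x. ring. Qed.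

Lemma le_lt_total x y : x <= y \/ y < x.
Proof.
  pattern x; apply delta0_ind; [definable; unfold le; definable | left; apply le0n |].
  intros z [[H|H]|H].
  - apply lt_def in H as [w ->]. left. apply le_def. exists w. ring.
  - subst. right. apply ltnS. now right.
  - right. apply ltnS. now left.
Qed.

Lemma ltN_irrefl x : ~ x < x.
Proof.
  intros [z H]%lt_def. rewrite <- (addn0 x) in H at 1. apply addnI in H.
  now apply (succ_nonzero z).
Qed.

Lemma leN_trans y x z : x <= y -> y <= z -> x <= z.
Proof. intros [a ->]%le_def [b ->]%le_def. apply le_def. exists (a + b). ring. Qed.

Lemma ltN_leN_trans y x z : x < y -> y <= z -> x < z.
Proof. intros [a ->]%lt_def [b ->]%le_def. apply lt_def. exists (a + b). ring. Qed.

Lemma leN_ltN_trans y x z : x <= y -> y < z -> x < z.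
Proof. intros [a ->]%le_def [b ->]%lt_def. apply lt_def. exists (a + b). ring. Qed.

Lemma ltNW x y : x < y -> x <= y. Proof. now left. Qed.

Lemma le_not_lt x y : x <= y <-> ~ y < x.
Proof.
  split.
  - intros H1 H2. apply (ltN_irrefl x). eapply leN_ltN_trans; eauto.
  - destruct (le_lt_total x y); tauto.
Qed.

Lemma lt_not_le x y : x < y <-> ~ y <= x.
Proof. rewrite le_not_lt. split; [tauto | apply NNPP]. Qed.

Lemma leN_antisym x y : x <= y -> y <= x -> x = y.
Proof. intros [H|H] H'; [|assumption]. now apply lt_not_le in H. Qed.

Lemma le_ltS x y : x <= y <-> x < y + 1.
Proof. symmetry. apply ltnS. Qed.

Lemma ltS_le x y : x < y <-> x + 1 <= y.
Proof.
  rewrite lt_def, le_def. split; intros [z ->]; exists z; ring.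
Qed.

Lemma lt0_neq0 x : 0 < x <-> x <> 0.
Proof.
  split; [intros H ->; now apply (ltN_irrefl 0)|].
  intros H. destruct (le0n x) as [|E]; [assumption | now destruct H].
Qed.

Lemma le_addr x y : x <= x + y. Proof. apply le_def. now exists y. Qed.
Lemma le_addl x y : x <= y + x. Proof. apply le_def. exists y. ring. Qed.

Lemma le_add a b c d : a <= b -> c <= d -> a + c <= b + d.
Proof. intros [x ->]%le_def [y ->]%le_def. apply le_def. exists (x + y). ring. Qed.

Lemma le_mul a b c d : a <= b -> c <= d -> a * c <= b * d.
Proof.
  intros [x ->]%le_def [y ->]%le_def. apply le_def. exists (x * c + a * y + x * y). ring.
Qed.

Lemma muln_gt0 x y : 0 < x -> 0 < y -> 0 < x * y.
Proof.
  intros [a ->]%lt_def [b ->]%lt_def. apply lt_def. exists (a * b + a + b). ring.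
Qed.

Lemma ltn_mul2r z x y : 0 < z -> (x * z < y * z <-> x < y).
Proof.
  intros [c ->]%lt_def. split.
  - rewrite lt_not_le. intros H. apply lt_not_le. intros [w ->]%le_def. apply H.
    apply le_def. exists (w * (c + 1)). ring.
  - intros [w ->]%lt_def. apply lt_def. exists (w * c + w + c). ring.
Qed.

Lemma mulIn z x y : 0 < z -> x * z = y * z -> x = y.
Proof.
  intros Hz E. apply leN_antisym; apply le_not_lt; intros H;
    apply (ltn_mul2r z) in H; auto; rewrite E in H; now apply ltN_irrefl in H.
Qed.

Lemma le_sqr x : x <= x * x.
Proof.
  destruct (zero_or_succ x) as [->|(y & _ & ->)].
  - rewrite mul0n. apply leN_refl.
  - apply le_def. exists (y * y + y). ring.
Qed.

(** * Pairing *)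

Definition cp (s t : N) : N := (s + t) * (s + t) + s.

Lemma DT_cp t u : DT M t -> DT M u -> DT M (fun e => cp (t e) (u e)).
Proof. intros; unfold cp; definable. Qed.

Lemma le_cp_l s t : s <= cp s t. Proof. apply le_addl. Qed.

Lemma le_cp_r s t : t <= cp s t.
Proof.
  unfold cp. eapply leN_trans; [|apply le_addr]. eapply leN_trans; [|apply le_sqr]. apply le_addl.
Qed.

(** [cp s t] is at least the square of [s + t] and less than the next square, so a larger sum forces
    a larger pair. *)
Lemma cp_le_sum s t s' t' : cp s t = cp s' t' -> s + t <= s' + t'.
Proof.
  intros E. apply le_not_lt. intros H. apply (ltN_irrefl (cp s t)). rewrite E at 1.
  apply ltS_le in H. unfold cp.
  apply ltN_leN_trans with ((s' + t' + 1) * (s' + t' + 1)).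
  - apply lt_def. exists (s' + t' + t'). ring.
  - eapply leN_trans; [|apply le_addr]. now apply le_mul.
Qed.

Lemma cp_inj s t s' t' : cp s t = cp s' t' -> s = s' /\ t = t'.
Proof.
  intros E.
  assert (H : s + t = s' + t') by (apply leN_antisym; now apply cp_le_sum).
  unfold cp in E. rewrite H in E. apply addnI in E. subst s'.
  split; [reflexivity|]. now apply addnI in H.
Qed.

(** * Least number principles and collection *)

Lemma delta0_least (P : N -> Prop) x :
  D0 M (fun e => P (e 0%nat)) -> P x -> exists m, P m /\ forall y, y < m -> ~ P y.
Proof.
  intros HD Hx. apply NNPP. intros H.
  assert (E : forall z, forall y, y < z -> ~ P y).
  { intros z. pattern z; apply delta0_ind.
    - definable.
    - intros y Hy. now apply ltn0 in Hy.
    - intros w IH y [Hy| ->]%ltnS; [now apply IH|]. intros Hw. apply H. now exists w. }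
  apply (E (x + 1) x); [|assumption]. apply le_ltS, leN_refl.
Qed.

(** The induction runs over initial segments, with the common bound as $\Sigma^0_1$ witness. The
    extra guard [k < K] is there because witnesses are only promised below [K]. *)
Lemma sigma1_collection (P : N -> N -> Prop) (K : N) :
  D0 M (fun e => P (e 1%nat) (e 0%nat)) -> (forall k, k < K -> exists y, P k y) ->
  exists b, forall k, k < K -> exists y, y < b /\ P k y.
Proof.
  intros HD H.
  assert (E : forall x, exists b, forall k, k < x -> k < K -> exists y, y < b /\ P k y).
  { apply sigma1_ind.
    - definable.
    - exists 0. intros k Hk. now apply ltn0 in Hk.
    - intros x [b Hb]. destruct (classic (x < K)) as [Hx|Hx].
      + destruct (H x Hx) as [y Hy]. exists (b + (y + 1)).
        intros k [Hk| ->]%ltnS Hk'.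
        * destruct (Hb k Hk Hk') as (z & Hz & Hz'). exists z. split; [|assumption].
          eapply ltN_leN_trans; [exact Hz | apply le_addr].
        * exists y. split; [|assumption]. rewrite addnS. apply le_ltS, le_addl.
      + exists b. intros k [Hk| ->]%ltnS Hk'; [auto | contradiction]. }
  destruct (E K) as [b Hb]. exists b. auto.
Qed.

(** If there were no least element, induction would refute every number. Asking for one bound [b] on
    the counterexamples of all [y < x] keeps the unbounded quantifier in front, so the induction
    statement is $\Sigma^0_1$. *)
Lemma pi1_least (P : N -> N -> Prop) (x : N) :
  D0 M (fun e => P (e 1%nat) (e 0%nat)) -> (forall z, P x z) ->
  exists m, (forall z, P m z) /\ forall y, y < m -> exists z, ~ P y z.
Proof.
  intros HD Hx. apply NNPP. intros H.
  assert (E : forall x, exists b, forall y, y < x -> exists z, z < b /\ ~ P y z).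
  { apply sigma1_ind.
    - definable.
    - exists 0. intros k Hk. now apply ltn0 in Hk.
    - intros m [b Hb]. destruct (classic (forall z, P m z)) as [Hm|Hm].
      + exfalso. apply H. exists m. split; [assumption|].
        intros y Hy. destruct (Hb y Hy) as (z & _ & Hz). now exists z.
      + apply not_all_ex_not in Hm as [z Hz]. exists (b + (z + 1)).
        intros y [Hy| ->]%ltnS.
        * destruct (Hb y Hy) as (w & Hw & Hw'). exists w. split; [|assumption].
          eapply ltN_leN_trans; [exact Hw | apply le_addr].
        * exists z. split; [|assumption]. rewrite addnS. apply le_ltS, le_addl. }
  destruct (E (x + 1)) as [b Hb]. destruct (Hb x) as (z & _ & Hz); [apply le_ltS, leN_refl|].
  now apply Hz.
Qed.

Lemma euclid a b : 0 < b -> exists q r, a = b * q + r /\ r < b.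
Proof.
  intros Hb.
  assert (E : exists q, q < a + 1 /\ exists r, r < b /\ a = b * q + r).
  { pattern a; apply delta0_ind; [definable | |].
    - exists 0. split; [apply lt0S|]. exists 0. split; [assumption | ring].
    - intros x (q & Hq & r & Hr & E). apply ltS_le in Hr as [Hr|Hr].
      + exists q. split; [apply ltnS; now left|]. exists (r + 1). split; [assumption|].
        rewrite E. ring.
      + exists (q + 1). split; [now apply ltSS|]. exists 0. split; [assumption|].
        rewrite E, <- Hr. ring. }
  destruct E as (q & _ & r & Hr & E). eauto.
Qed.

(** * Divisibility and reduced fractions *)

Definition dvd (a b : N) : Prop := exists c, b = a * c.
Definition coprime (a b : N) : Prop := forall c, dvd c a /\ dvd c b -> c = 1.

Lemma dvd_bounded a b : dvd a b <-> exists c, c < b + 1 /\ b = a * c.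
Proof.
  split; [|intros (c & _ & H); now exists c].
  intros [c ->]. destruct (zero_or_succ a) as [->|(a' & _ & ->)].
  - exists 0. split; [apply lt0S | ring].
  - exists c. split; [|reflexivity]. apply le_ltS, le_def. exists (a' * c). ring.
Qed.

Lemma D0_dvd t u : DT M t -> DT M u -> D0 M (fun e => dvd (t e) (u e)).
Proof.
  intros Ht Hu. eapply D0_ext; [intros e; apply dvd_bounded|].
  apply D0_ex; [definable|]. apply D0_eq.
  - exact (DT_reindex M S _ Hu).
  - apply DT_mul; [exact (DT_reindex M S _ Ht) | definable].
Qed.

Ltac definable_hook ::=
  first [ apply D0_le; definable | apply D0_dvd; definable | apply DT_cp; definable ].

Lemma dvd_refl a : dvd a a. Proof. exists 1. ring. Qed.

Lemma dvd_trans b a c : dvd a b -> dvd b c -> dvd a c.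
Proof. intros [x ->] [y ->]. exists (x * y). ring. Qed.

Lemma dvd_mulr a b c : dvd a b -> dvd a (b * c).
Proof. intros [x ->]. exists (x * c). ring. Qed.

Lemma dvd_mull a b c : dvd a b -> dvd a (c * b).
Proof. intros [x ->]. exists (x * c). ring. Qed.

Lemma dvd_add_cancel a x y : dvd a x -> dvd a (x + y) -> dvd a y.
Proof.
  intros [v ->] [u E]. destruct (le_lt_total v u) as [[w ->]%le_def | [w ->]%lt_def].
  - exists w. rewrite mulnDr in E. now apply addnI in E.
  - exists 0. rewrite muln0. rewrite mulnDr, <- addnA in E.
    rewrite <- (addn0 (a * u)) in E at 2. apply addnI in E. now apply addn_eq0 in E.
Qed.

Lemma dvd_le a b : dvd a b -> b <> 0 -> a <= b.
Proof.
  intros [c ->] H. destruct (zero_or_succ c) as [->|(d & _ & ->)].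
  - now rewrite muln0 in H.
  - apply le_def. exists (a * d). ring.
Qed.

Lemma dvd_antisym a b : dvd a b -> dvd b a -> a = b.
Proof.
  intros H1 H2. destruct (classic (b = 0)) as [->|Hb].
  - destruct H2 as [c ->]. ring.
  - destruct (classic (a = 0)) as [->|Ha].
    + destruct H1 as [c ->]. ring.
    + now apply leN_antisym; apply dvd_le.
Qed.

Lemma muln_eq1 a b : a * b = 1 -> a = 1.
Proof.
  intros E. apply dvd_antisym; [now exists b | exists a; ring].
Qed.

(** Bezout's identity would need subtraction. Instead let [y] be the least positive number with [a]
    dividing [y * c]. Division with remainder shows that [y] divides every [z] with this property;
    both [a] and [b] have it, so [y = 1]. *)
Lemma gauss a b c : coprime a b -> dvd a (b * c) -> dvd a c.
Proof.
  intros Hab H. destruct (classic (a = 0)) as [->|Ha].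
  { assert (b = 1) as ->; [|now rewrite mul1n in H].
    apply Hab. split; [exists 0; ring | apply dvd_refl]. }
  apply lt0_neq0 in Ha.
  destruct (delta0_least (fun y => 0 < y /\ dvd a (y * c)) a) as (y & [Hy Hyc] & Hmin).
  - definable.
  - split; [assumption|]. apply dvd_mulr, dvd_refl.
  - assert (D : forall z, dvd a (z * c) -> dvd y z).
    { intros z Hz. destruct (euclid z y Hy) as (q & r & E & Hr).
      destruct (classic (r = 0)) as [->|Hr0]; [exists q; rewrite E; ring|].
      exfalso. apply (Hmin r Hr). split; [now apply lt0_neq0|].
      apply dvd_add_cancel with (q * (y * c)); [now apply dvd_mull|].
      replace (q * (y * c) + r * c) with (z * c) by (rewrite E; ring). exact Hz. }
    assert (y = 1) as ->; [|now rewrite mul1n in Hyc].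
    apply Hab. split; apply D; [apply dvd_mulr, dvd_refl | assumption].
Qed.

Lemma coprime_sym a b : coprime a b -> coprime b a.
Proof. intros H c [H1 H2]. apply H. tauto. Qed.

Definition ratio (q m n d : N) : Prop :=
  q = cp (cp m n) d /\ 0 < d /\ (m = 0 \/ n = 0) /\ coprime (m + n) d.
Definition is_rat (q : N) : Prop := exists m n d, ratio q m n d.

Lemma coprime_bounded a b :
  0 < b -> (coprime a b <-> forall c, c < b + 1 -> dvd c a /\ dvd c b -> c = 1).
Proof.
  intros Hb. split; [auto|]. intros H c Hc. apply H; [|exact Hc].
  apply le_ltS, dvd_le; [apply Hc | now apply lt0_neq0].
Qed.

Lemma ratio_bounded q m n d : ratio q m n d <->
  q = cp (cp m n) d /\ 0 < d /\ (m = 0 \/ n = 0) /\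
  forall c, c < d + 1 -> dvd c (m + n) /\ dvd c d -> c = 1.
Proof.
  unfold ratio. split; intros (E & Hd & H0 & H); repeat split; auto; now apply coprime_bounded.
Qed.

Lemma cp_bounds m n d : m < cp (cp m n) d + 1 /\ n < cp (cp m n) d + 1 /\ d < cp (cp m n) d + 1.
Proof.
  repeat split; apply le_ltS.
  - eapply leN_trans; [|apply le_cp_l]. apply le_cp_l.
  - eapply leN_trans; [|apply le_cp_l]. apply le_cp_r.
  - apply le_cp_r.
Qed.

Lemma is_rat_bounded q : is_rat q <->
  exists m, m < q + 1 /\ exists n, n < q + 1 /\ exists d, d < q + 1 /\
    (q = cp (cp m n) d /\ 0 < d /\ (m = 0 \/ n = 0) /\
     forall c, c < d + 1 -> dvd c (m + n) /\ dvd c d -> c = 1).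
Proof.
  split.
  - intros (m & n & d & H%ratio_bounded). pose proof (cp_bounds m n d) as B.
    destruct H as [E H]. rewrite <- E in B. exists m; split; [apply B|].
    exists n; split; [apply B|]. exists d; split; [apply B|]. now split.
  - intros (m & _ & n & _ & d & _ & H%ratio_bounded). now exists m, n, d.
Qed.

(** Substituting a term is simulated by a bounded quantifier over its value, so a definability proof
    for a variable argument is enough. *)
Lemma D0_comp (P : N -> Prop) t :
  D0 M (fun e => P (e 0%nat)) -> DT M t -> D0 M (fun e => P (t e)).
Proof.
  intros HP Ht. apply (D0_ext M (fun e => exists x, x < t e + 1 /\ (x = t e /\ P x))).
  - intros e. split.
    + intros H. exists (t e). split; [apply le_ltS, leN_refl | now split].
    + now intros (x & _ & -> & H).
  - apply D0_ex; [definable|]. apply D0_and; [|exact HP].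
    apply D0_eq; [definable | exact (DT_reindex M S _ Ht)].
Qed.

Lemma D0_is_rat t : DT M t -> D0 M (fun e => is_rat (t e)).
Proof.
  intros Ht. apply (D0_comp is_rat); [|exact Ht].
  eapply D0_ext; [intros e; apply is_rat_bounded|]. definable.
Qed.

(** Take the least positive [d'] for which [x * d'] is a multiple of [d]. A common factor of [d']
    and [x'] could be cancelled and would give a smaller such number. *)
Lemma reduce_fraction x d : 0 < d ->
  exists x' d', 0 < d' /\ coprime x' d' /\ x * d' = x' * d.
Proof.
  intros Hd.
  destruct (delta0_least (fun d' => 0 < d' /\ dvd d (x * d')) d) as (d' & [Hd' [x' E]] & Hmin).
  - definable.
  - split; [assumption|]. apply dvd_mull, dvd_refl.
  - exists x', d'. split; [assumption|]. split; [|rewrite E; ring].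
    intros c [[u ->] [v ->]].
    destruct (zero_or_succ c) as [->|(c' & _ & ->)]; [rewrite mul0n in Hd'; now apply ltN_irrefl in Hd'|].
    destruct (zero_or_succ c') as [->|(b & _ & ->)]; [ring|].
    exfalso. assert (Hv : 0 < v).
    { apply lt0_neq0. intros ->. rewrite muln0 in Hd'. now apply ltN_irrefl in Hd'. }
    apply (Hmin v).
    + apply lt_def. apply lt_def in Hv as [w ->]. exists (b * w + b + w). ring.
    + split; [assumption|]. exists u. apply (mulIn (b + 1 + 1)); [apply lt0S|].
      transitivity (x * ((b + 1 + 1) * v)); [ring|]. rewrite E. ring.
Qed.

Lemma ratio_exists m n d : 0 < d ->
  exists q m' n' d', ratio q m' n' d' /\ m * d' + n' * d = m' * d + n * d'.
Proof.
  intros Hd. destruct (le_lt_total n m) as [[x ->]%le_def | [x ->]%lt_def].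
  - destruct (reduce_fraction x d Hd) as (x' & d' & Hd' & Hc & E).
    exists (cp (cp x' 0) d'), x', 0, d'. split.
    + repeat split; auto. now rewrite addn0.
    + rewrite mulnDl, E. ring.
  - destruct (reduce_fraction (x + 1) d Hd) as (x' & d' & Hd' & Hc & E).
    exists (cp (cp 0 x') d'), 0, x', d'. split.
    + repeat split; auto. now rewrite add0n.
    + rewrite (mulnDl m), E. ring.
Qed.

Lemma coprime_fraction_unique x d x' d' :
  0 < d -> coprime x d -> coprime x' d' -> x * d' = x' * d -> x = x' /\ d = d'.
Proof.
  intros Hd H H' E.
  assert (d = d') as <-.
  { apply dvd_antisym.
    - apply gauss with x; [now apply coprime_sym|]. exists x'. rewrite E. ring.
    - apply gauss with x'; [now apply coprime_sym|]. exists x. rewrite <- E. ring. }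
  split; [|reflexivity]. now apply mulIn in E.
Qed.

Lemma ratio_unique q m n d q' m' n' d' :
  ratio q m n d -> ratio q' m' n' d' -> m * d' + n' * d = m' * d + n * d' -> q = q'.
Proof.
  intros (-> & Hd & H0 & Hc) (-> & Hd' & H0' & Hc') E.
  (* Each fraction has a vanishing part. For equal signs the equation is one of the two claims and
     the other is trivial; for opposite signs a sum is zero, hence so are both summands. *)
  assert (Hm : m * d' = m' * d /\ n * d' = n' * d).
  { destruct H0 as [-> | ->], H0' as [-> | ->]; rewrite ?mul0n, ?addn0, ?add0n in *.
    - now split.
    - symmetry in E. apply addn_eq0 in E as [E1 E2]. now rewrite E1, E2.
    - apply addn_eq0 in E as [E1 E2]. now rewrite E1, E2.
    - now split. }
  destruct Hm as [Hm Hn].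
  destruct (coprime_fraction_unique (m + n) d (m' + n') d') as [_ <-]; auto.
  - now rewrite !mulnDl, Hm, Hn.
  - apply mulIn in Hm; [|assumption]. apply mulIn in Hn; [|assumption]. now subst.
Qed.

(** * Goedel's beta function and strong collection *)

Lemma common_multiple (f : N -> N) (K : N) :
  DT M (fun e => f (e 0%nat)) -> (forall k, 0 < f k) ->
  exists c, 0 < c /\ forall k, k < K -> dvd (f k) c.
Proof.
  intros Hf Hpos.
  (* The product of the [f k] is not a term of the language; the induction only asserts that some
     common multiple exists. *)
  pattern K. eapply (sigma1_ind M (fun x c => 0 < c /\ forall k, k < x -> dvd (f k) c)).
  - definable.
  - exists 1. split; [apply lt_def; exists 0; ring|]. intros k Hk. now apply ltn0 in Hk.
  - intros x (c & Hc & H). exists (c * f x). split; [now apply muln_gt0|].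
    intros k [Hk| ->]%ltnS; [apply dvd_mulr; auto | apply dvd_mull, dvd_refl].
Qed.

(** A common divisor [t] divides the difference [w * (d + 1)]. It is coprime to [w], since it
    divides a multiple of [w] plus one; so it divides [d + 1], which divides [w], and [t = 1]. *)
Lemma beta_coprime (K w j d : N) :
  (forall k, k < K -> dvd (k + 1) w) -> d < K ->
  coprime ((j + 1) * w + 1) ((j + (d + 1) + 1) * w + 1).
Proof.
  intros Hw Hd t [Ht1 Ht2].
  assert (Htw : coprime t w).
  { intros c [Hc1 Hc2].
    assert (H1 : dvd c 1).
    { apply dvd_add_cancel with ((j + 1) * w); [now apply dvd_mull|]. now apply dvd_trans with t. }
    destruct H1 as [u Hu]. symmetry in Hu. now apply muln_eq1 in Hu. }
  assert (Htd : dvd t (w * (d + 1))).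
  { apply dvd_add_cancel with ((j + 1) * w + 1); [assumption|].
    replace ((j + 1) * w + 1 + w * (d + 1)) with ((j + (d + 1) + 1) * w + 1) by ring.
    assumption. }
  apply gauss in Htd; [|assumption]. apply Htw. split; [apply dvd_refl|].
  eapply dvd_trans; [exact Htd | now apply Hw].
Qed.

(* The set of [k < K] with [exists i, P k i] is coded, as in Goedel's beta
   function, by the least common multiple of the corresponding pairwise coprime
   numbers [(k + 1) * w + 1]; it exists by the least number principle for
   Pi^0_1, and Sigma^0_1-collection then applies to the coded set. *)
Lemma strong_sigma1_collection (P : N -> N -> Prop) (K : N) :
  D0 M (fun e => P (e 1%nat) (e 0%nat)) ->
  exists b, forall k, k < K -> (exists i, P k i) -> exists i, i < b /\ P k i.
Proof.
  intros HD.
  (* Below a bounded quantifier over [k] it is [k] that sits in slot 0 and the stage in slot 1, so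
     [definable] needs the certificate with the slots exchanged. *)
  pose proof (D0_reindex M (fun n => match n with O => 1 | S _ => 0 end)%nat _ HD) as HD'.
  cbv beta iota in HD'.
  destruct (common_multiple (fun k => k + 1) K) as (w & Hw0 & Hw);
    [definable | apply lt0S |].
  set (p := fun k => (k + 1) * w + 1).
  assert (Hp : DT M (fun e => p (e 0%nat))) by (unfold p; definable).
  assert (Hp0 : forall k, 0 < p k) by (intros k; apply lt0S).
  assert (Hcop : forall j k, j < K -> k < K -> j <> k -> coprime (p j) (p k)).
  { intros j k Hj Hk Hjk. unfold p.
    destruct (le_lt_total j k) as [[H|H]|H]; [|contradiction|].
    - apply lt_def in H as [d ->]. apply beta_coprime with K; [assumption|].
      eapply leN_ltN_trans; [|exact Hk]. eapply leN_trans; [apply le_addr|]. apply le_addl.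
    - apply lt_def in H as [d ->]. apply coprime_sym, beta_coprime with K; [assumption|].
      eapply leN_ltN_trans; [|exact Hj]. eapply leN_trans; [apply le_addr|]. apply le_addl. }
  destruct (common_multiple p K Hp Hp0) as (B & HB0 & HB).
  destruct (pi1_least (fun c z => 0 < c /\ forall k, k < K -> P k z -> dvd (p k) c) B)
    as (c & Hc & Hmin).
  - unfold p. definable.
  - intros z. split; [assumption|]. intros k Hk _. now apply HB.
  - assert (Hc0 : 0 < c) by apply (Hc 0).
    (* Otherwise the factor [p k] could be removed: by coprimality the quotient is still divisible
       by every [p j] that is required, which contradicts the minimality of [c]. *)
    assert (Hdec : forall k, k < K -> dvd (p k) c -> exists i, P k i).
    { intros k Hk [c' Ec]. apply NNPP. intros Hno.
      assert (Hc'0 : 0 < c').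
      { apply lt0_neq0. intros ->. rewrite Ec, muln0 in Hc0. now apply ltN_irrefl in Hc0. }
      destruct (Hmin c') as [z Hz].
      - rewrite Ec. rewrite <- (mul1n c') at 1. apply ltn_mul2r; [assumption|].
        unfold p. apply lt_def.
        destruct (zero_or_succ w) as [->|(v & _ & ->)].
        + now apply ltN_irrefl in Hw0.
        + exists (k * v + k + v). ring.
      - apply Hz. split; [assumption|]. intros j Hj Hjz.
        assert (j <> k) by (intros ->; apply Hno; eauto).
        apply gauss with (p k); [now apply Hcop|]. rewrite <- Ec. now apply (Hc z). }
    destruct (sigma1_collection (fun k i => dvd (p k) c -> P k i) K) as [b Hb].
    + unfold p. definable.
    + intros k Hk. destruct (classic (dvd (p k) c)) as [H|H].
      * destruct (Hdec k Hk H) as [i Hi]. eauto.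
      * exists 0. contradiction.
    + exists b. intros k Hk [i Hi]. destruct (Hb k Hk) as (i' & Hi' & H).
      exists i'. split; [assumption|]. apply H. now apply (Hc i).
Qed.

End Arithmetic.

(** * The field of coded rationals *)

Definition rational (M : rca_model) : Type := {q : num M | is_rat M q}.

Section Fractions.
Variable M : rca_model.
Notation N := (num M).
Notation "0" := (zero M).
Notation "1" := (one M).
Notation "x + y" := (add M x y).
Notation "x * y" := (mul M x y).
Notation "x < y" := (lt M x y).
Notation "x <= y" := (le M x y).
Notation Q := (rational M).
Add Ring model_ring : (model_semiring M).

Lemma lt01 : 0 < 1.
Proof. rewrite <- (add0n M 1). apply lt0S. Qed.

Lemma rational_inj (p q : Q) : proj1_sig p = proj1_sig q -> p = q.
Proof.
  destruct p as [p Hp], q as [q Hq]; simpl. intros ->. f_equal. apply proof_irrelevance.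
Qed.

Definition frac_spec (m n d : N) (q : Q) : Prop :=
  exists m' n' d', ratio M (proj1_sig q) m' n' d' /\ m * d' + n' * d = m' * d + n * d'.

Lemma frac_exists m n d : 0 < d -> exists q, frac_spec m n d q.
Proof.
  intros Hd. destruct (ratio_exists M m n d Hd) as (q & m' & n' & d' & H & E).
  assert (Hq : is_rat M q) by now exists m', n', d'.
  exists (exist _ q Hq), m', n', d'. now split.
Qed.

Lemma rational_inhabited : inhabited Q.
Proof. destruct (frac_exists 0 0 1 lt01) as [q _]. now constructor. Qed.

(* [(m - n) / d], with a junk value when [d] is zero. *)
Definition frac (m n d : N) : Q := epsilon rational_inhabited (frac_spec m n d).

Lemma frac_specP m n d : 0 < d -> frac_spec m n d (frac m n d).
Proof. intros Hd. unfold frac. apply epsilon_spec. now apply frac_exists. Qed.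

Lemma cross_trans m n d m0 n0 d0 m' n' d' : 0 < d0 ->
  m * d0 + n0 * d = m0 * d + n * d0 -> m' * d0 + n0 * d' = m0 * d' + n' * d0 ->
  m * d' + n' * d = m' * d + n * d'.
Proof.
  intros Hd0 E E'. apply (mulIn M d0); [assumption|]. apply (addIn M (n0 * d * d')).
  transitivity ((m * d0 + n0 * d) * d' + n' * d0 * d); [ring|]. rewrite E.
  transitivity ((m0 * d' + n' * d0) * d + n * d0 * d'); [ring|]. rewrite <- E'. ring.
Qed.

Lemma frac_eq m n d m' n' d' : 0 < d -> 0 < d' ->
  frac m n d = frac m' n' d' <-> m * d' + n' * d = m' * d + n * d'.
Proof.
  intros Hd Hd'.
  destruct (frac_specP m n d Hd) as (m0 & n0 & d0 & H & E).
  destruct (frac_specP m' n' d' Hd') as (m1 & n1 & d1 & H' & E').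
  pose proof H as (Q0 & Hd0 & _). pose proof H' as (Q1 & Hd1 & _).
  split.
  - intros Eq. rewrite <- Eq, Q0 in Q1.
    apply cp_inj in Q1 as [Q1 <-]. apply cp_inj in Q1 as [<- <-].
    now apply cross_trans with m0 n0 d0.
  - intros Eq. apply rational_inj. eapply ratio_unique; [exact H | exact H' |].
    apply cross_trans with m n d; [assumption | |].
    + now symmetry.
    + apply cross_trans with m' n' d'; [assumption | | assumption]. now symmetry.
Qed.

Lemma frac_ratio q m n d : ratio M q m n d -> proj1_sig (frac m n d) = q.
Proof.
  intros H. pose proof H as (_ & Hd & _).
  destruct (frac_specP m n d Hd) as (m0 & n0 & d0 & H' & E).
  eapply ratio_unique; [exact H' | exact H |]. now symmetry.
Qed.

Lemma rational_ratio (q : Q) :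
  exists m n d, ratio M (proj1_sig q) m n d /\ q = frac m n d.
Proof.
  destruct (proj2_sig q) as (m & n & d & H). exists m, n, d. split; [assumption|].
  apply rational_inj. symmetry. now apply frac_ratio.
Qed.

Lemma frac_surj (q : Q) : exists m n d, 0 < d /\ q = frac m n d.
Proof.
  destruct (rational_ratio q) as (m & n & d & H & ->). exists m, n, d. split; [apply H | reflexivity].
Qed.

(** Operations are given on arbitrary fractions and transferred to rationals by choosing a
    representation; [on_fracE] shows that the choice is irrelevant once [f] respects
    cross-multiplied equality. Binary operations are curried instances. *)
Definition unary_spec (f : N -> N -> N -> Q) (p q : Q) : Prop :=
  exists m n d, 0 < d /\ p = frac m n d /\ q = f m n d.
Definition on_frac (f : N -> N -> N -> Q) (p : Q) : Q :=
  epsilon rational_inhabited (unary_spec f p).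

Lemma on_fracE f :
  (forall m n d m' n' d', 0 < d -> 0 < d' -> m * d' + n' * d = m' * d + n * d' ->
     f m n d = f m' n' d') ->
  forall m n d, 0 < d -> on_frac f (frac m n d) = f m n d.
Proof.
  intros Hf m n d Hd.
  assert (H : unary_spec f (frac m n d) (on_frac f (frac m n d))).
  { unfold on_frac. apply epsilon_spec. exists (f m n d), m, n, d. auto. }
  destruct H as (m' & n' & d' & Hd' & E & ->). symmetry. apply frac_eq in E; auto.
Qed.

Definition rzero : Q := frac 0 0 1.
Definition rone : Q := frac 1 0 1.
Definition ropp : Q -> Q := on_frac (fun m n d => frac n m d).
Definition radd (p : Q) : Q -> Q :=
  on_frac (fun m' n' d' => on_frac (fun m n d => frac (m * d' + m' * d) (n * d' + n' * d) (d * d')) p).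
Definition rmul (p : Q) : Q -> Q :=
  on_frac (fun m' n' d' => on_frac (fun m n d => frac (m * m' + n * n') (m * n' + n * m') (d * d')) p).

Lemma ropp_frac m n d : 0 < d -> ropp (frac m n d) = frac n m d.
Proof.
  revert m n d. apply on_fracE. intros m n d m' n' d' Hd Hd' E. apply frac_eq; auto.
  transitivity (m' * d + n * d'); [ring|]. rewrite <- E. ring.
Qed.

Ltac frac_inj :=
  apply frac_eq; [auto using muln_gt0 | auto using muln_gt0 |].

Lemma radd_frac m n d m' n' d' : 0 < d -> 0 < d' ->
  radd (frac m n d) (frac m' n' d') = frac (m * d' + m' * d) (n * d' + n' * d) (d * d').
Proof.
  assert (H1 : forall m' n' d', 0 < d' -> forall m n d, 0 < d ->
    on_frac (fun m n d => frac (m * d' + m' * d) (n * d' + n' * d) (d * d')) (frac m n d)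
    = frac (m * d' + m' * d) (n * d' + n' * d) (d * d')).
  { intros m2 n2 d2 Hd2. apply on_fracE. intros m0 n0 d0 m1 n1 d1 H0 H1 E. frac_inj.
    transitivity ((m0 * d1 + n1 * d0) * (d2 * d2) + (m2 + n2) * d2 * (d0 * d1)); [ring|].
    rewrite E. ring. }
  intros Hd Hd'. unfold radd. rewrite on_fracE; auto.
  intros m0 n0 d0 m1 n1 d1 H0 H2 E.
  destruct (frac_surj (frac m n d)) as (a & b & c & Hc & ->).
  rewrite !H1; auto. frac_inj.
  transitivity ((m0 * d1 + n1 * d0) * (c * c) + (a + b) * c * (d0 * d1)); [ring|].
  rewrite E. ring.
Qed.

Lemma rmul_frac m n d m' n' d' : 0 < d -> 0 < d' ->
  rmul (frac m n d) (frac m' n' d') = frac (m * m' + n * n') (m * n' + n * m') (d * d').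
Proof.
  assert (H1 : forall m' n' d', 0 < d' -> forall m n d, 0 < d ->
    on_frac (fun m n d => frac (m * m' + n * n') (m * n' + n * m') (d * d')) (frac m n d)
    = frac (m * m' + n * n') (m * n' + n * m') (d * d')).
  { intros m2 n2 d2 Hd2. apply on_fracE. intros m0 n0 d0 m1 n1 d1 H0 H1 E. frac_inj.
    (* Without subtraction the hypothesis enters twice: multiplied by [m2 * d2], and read backwards
       and multiplied by [n2 * d2]. *)
    transitivity ((m0 * d1 + n1 * d0) * (m2 * d2) + (m1 * d0 + n0 * d1) * (n2 * d2)); [ring|].
    transitivity ((m1 * d0 + n0 * d1) * (m2 * d2) + (m0 * d1 + n1 * d0) * (n2 * d2)); [now rewrite E | ring]. }
  intros Hd Hd'. unfold rmul. rewrite on_fracE; auto.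
  intros m0 n0 d0 m1 n1 d1 H0 H2 E.
  destruct (frac_surj (frac m n d)) as (a & b & c & Hc & ->).
  rewrite !H1; auto. frac_inj.
    transitivity ((m0 * d1 + n1 * d0) * (a * c) + (m1 * d0 + n0 * d1) * (b * c)); [ring|].
    transitivity ((m1 * d0 + n0 * d1) * (a * c) + (m0 * d1 + n1 * d0) * (b * c)); [now rewrite E | ring].
Qed.

Ltac fracs :=
  repeat match goal with
  | x : Q |- _ => let m := fresh "m" in let n := fresh "n" in let d := fresh "d" in
      let H := fresh "H" in destruct (frac_surj x) as (m & n & d & H & ->)
  end;
  unfold rzero, rone; pose proof lt01;
  repeat (rewrite radd_frac || rewrite rmul_frac || rewrite ropp_frac);
  auto using muln_gt0.

Lemma raddA x y z : radd x (radd y z) = radd (radd x y) z.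
Proof. fracs. frac_inj. ring. Qed.
Lemma raddC x y : radd x y = radd y x.
Proof. fracs. frac_inj. ring. Qed.
Lemma radd0 x : radd rzero x = x.
Proof. fracs. frac_inj. ring. Qed.
Lemma raddN x : radd (ropp x) x = rzero.
Proof. fracs. frac_inj. ring. Qed.
Lemma rmulA x y z : rmul x (rmul y z) = rmul (rmul x y) z.
Proof. fracs. frac_inj. ring. Qed.
Lemma rmulC x y : rmul x y = rmul y x.
Proof. fracs. frac_inj. ring. Qed.
Lemma rmul1 x : rmul rone x = x.
Proof. fracs. frac_inj. ring. Qed.
Lemma rmulD x y z : rmul (radd x y) z = radd (rmul x z) (rmul y z).
Proof. fracs. frac_inj. ring. Qed.

Lemma frac_eq0 m n d : 0 < d -> frac m n d = rzero <-> m = n.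
Proof.
  intros Hd. unfold rzero. rewrite frac_eq; auto using lt01. split.
  - intros E. apply (addIn M (0 * d)). rewrite <- (mul1n M m), mulnC, E. ring.
  - intros ->. ring.
Qed.

Lemma rone_neq0 : rone <> rzero.
Proof.
  unfold rone. rewrite frac_eq0 by apply lt01. intros E. apply (ltN_irrefl M 0).
  rewrite <- E at 2. apply lt01.
Qed.

(** The value at zero is prescribed because MathComp fields have zero as the inverse of zero. *)
Lemma rinv_exists x : exists y, (x <> rzero -> rmul y x = rone) /\ (x = rzero -> y = rzero).
Proof.
  destruct (classic (x = rzero)) as [Hx|Hx]; [now exists rzero|].
  destruct (rational_ratio x) as (m & n & d & (_ & Hd & H0 & _) & ->).
  rewrite frac_eq0 in Hx by assumption.
  assert (Hmn : 0 < m + n).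
  { apply lt0_neq0. intros [-> ->]%addn_eq0. now apply Hx. }
  exists (if excluded_middle_informative (n = 0) then frac d 0 (m + n) else frac 0 d (m + n)).
  split; [|rewrite frac_eq0; tauto]. intros _.
  destruct excluded_middle_informative as [->|Hn]; fracs; frac_inj.
  - ring.
  - destruct H0 as [->|]; [ring | contradiction].
Qed.

Definition rinv (x : Q) : Q :=
  epsilon rational_inhabited (fun y => (x <> rzero -> rmul y x = rone) /\ (x = rzero -> y = rzero)).

Lemma rmulV x : x <> rzero -> rmul (rinv x) x = rone.
Proof. unfold rinv. apply (epsilon_spec rational_inhabited _ (rinv_exists x)). Qed.

Lemma rinv0 : rinv rzero = rzero.
Proof. now apply (epsilon_spec rational_inhabited _ (rinv_exists rzero)). Qed.

Definition rnonneg (x : Q) : Prop := exists m n d, 0 < d /\ x = frac m n d /\ n <= m.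

Lemma rnonneg_frac m n d : 0 < d -> rnonneg (frac m n d) <-> n <= m.
Proof.
  intros Hd. split; [|intros H; now exists m, n, d].
  intros (m' & n' & d' & Hd' & E & H). apply frac_eq in E; [|assumption..].
  apply le_not_lt. intros [w ->]%lt_def. apply le_def in H as [v ->].
  rewrite !mulnDl in E.
  assert (E' : m * d' + n' * d = m * d' + n' * d + (v * d + (w * d' + 1 * d'))).
  { rewrite E at 1. ring. }
  rewrite <- (addn0 M (m * d' + n' * d)) in E' at 1. apply addnI in E'.
  symmetry in E'. apply addn_eq0 in E' as [_ E']. apply addn_eq0 in E' as [_ E'].
  rewrite mul1n in E'. subst. now apply ltN_irrefl in Hd'.
Qed.

Lemma rnonneg_add x y : rnonneg x -> rnonneg y -> rnonneg (radd x y).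
Proof.
  fracs. rewrite !rnonneg_frac; auto using muln_gt0.
  intros A1 A2. apply le_add; apply le_mul; auto; apply leN_refl.
Qed.

Lemma rnonneg_mul x y : rnonneg x -> rnonneg y -> rnonneg (rmul x y).
Proof.
  fracs. rewrite !rnonneg_frac; auto using muln_gt0.
  intros [a ->]%le_def [b ->]%le_def. apply le_def. exists (a * b). ring.
Qed.

Lemma rnonneg_anti x : rnonneg x -> rnonneg (ropp x) -> x = rzero.
Proof.
  intros H1 H2. destruct (frac_surj x) as (m & n & d & Hd & ->).
  rewrite ropp_frac in H2 by assumption. rewrite rnonneg_frac in H1, H2 by assumption.
  apply frac_eq0; [assumption | now apply leN_antisym].
Qed.

Lemma rnonneg_total x : rnonneg x \/ rnonneg (ropp x).
Proof.
  fracs. rewrite !rnonneg_frac by assumption.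
  destruct (le_lt_total M n m); [now left | right; now left].
Qed.

Definition rnat (a : N) : Q := frac a 0 1.

Lemma rnatD a b : rnat (a + b) = radd (rnat a) (rnat b).
Proof. unfold rnat. fracs. frac_inj. ring. Qed.

Lemma rnatM a b : rnat (a * b) = rmul (rnat a) (rnat b).
Proof. unfold rnat. fracs. frac_inj. ring. Qed.

Lemma rnat_le a b : rnonneg (radd (rnat b) (ropp (rnat a))) <-> a <= b.
Proof.
  unfold rnat. fracs. rewrite rnonneg_frac by auto using muln_gt0.
  now replace (0 * 1 + a * 1) with a by ring; replace (b * 1 + 0 * 1) with b by ring.
Qed.

Lemma frac_rnat m n d : 0 < d -> rmul (frac m n d) (rnat d) = radd (rnat m) (ropp (rnat n)).
Proof. intros Hd. unfold rnat. fracs. frac_inj. ring. Qed.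

End Fractions.

From HB Require Import structures.
From mathcomp Require Import ssreflect ssrfun ssrbool eqtype choice order ssralg ssrnum.
From mathcomp Require boolp.
From mathcomp Require Import ring lra.
Import GRing.Theory Num.Theory Order.TTheory.
Local Open Scope ring_scope.

(** * The ordered field structure *)

Section RationalField.
Variable M : rca_model.

HB.instance Definition _ := boolp.gen_eqMixin (rational M).
HB.instance Definition _ := boolp.gen_choiceMixin (rational M).
HB.instance Definition _ := GRing.isZmodule.Build (rational M)
  (@raddA M) (@raddC M) (@radd0 M) (@raddN M).
Fact rone_neq0b : rone M != rzero M.
Proof. apply/eqP; exact: rone_neq0. Qed.
HB.instance Definition _ := GRing.Zmodule_isComNzRing.Build (rational M)
  (@rmulA M) (@rmulC M) (@rmul1 M) (@rmulD M) rone_neq0b.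
Fact rmulVb (x : rational M) : x != 0 -> rinv M x * x = 1.
Proof. by move/eqP; exact: rmulV. Qed.
HB.instance Definition _ := GRing.ComNzRing_isField.Build (rational M)
  rmulVb (rinv0 M).

(** Order and equality are made boolean by excluded middle, as the MathComp interfaces demand; no
    decision procedure inside the model is meant. *)
Definition rle (x y : rational M) : bool := boolp.asbool (rnonneg M (y - x)).
Definition rlt (x y : rational M) : bool := (y != x) && rle x y.
Definition rnorm (x : rational M) : rational M := if rle 0 x then x else - x.

Fact rle0D x y : rle 0 x -> rle 0 y -> rle 0 (x + y).
Proof. by rewrite /rle !subr0 => /boolp.asboolP Hx /boolp.asboolP Hy; apply/boolp.asboolP/rnonneg_add. Qed.
Fact rle0M x y : rle 0 x -> rle 0 y -> rle 0 (x * y).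
Proof. by rewrite /rle !subr0 => /boolp.asboolP Hx /boolp.asboolP Hy; apply/boolp.asboolP/rnonneg_mul. Qed.
Fact rle0_anti x : rle 0 x -> rle x 0 -> x = 0.
Proof. by rewrite /rle subr0 sub0r => /boolp.asboolP Hx /boolp.asboolP Hy; apply: rnonneg_anti. Qed.
Fact rsub_ge0 x y : rle 0 (y - x) = rle x y.
Proof. by rewrite /rle subr0. Qed.
Fact rle0_total x : rle 0 x || rle x 0.
Proof.
rewrite /rle subr0 sub0r; apply/orP.
by case: (rnonneg_total M x) => H; [left|right]; apply/boolp.asboolP.
Qed.
Fact rnormN x : rnorm (- x) = rnorm x.
Proof.
rewrite /rnorm opprK; case: ifPn => H1; case: ifPn => H2 //.
  have : x = 0 by apply: rle0_anti => //; rewrite -rsub_ge0 sub0r.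
  by move=> ->; rewrite oppr0.
have /orP[] := rle0_total x; first by rewrite (negbTE H2).
by rewrite -rsub_ge0 sub0r (negbTE H1).
Qed.
Fact rge0_norm x : rle 0 x -> rnorm x = x.
Proof. by rewrite /rnorm => ->. Qed.
Fact rlt_def x y : rlt x y = (y != x) && rle x y.
Proof. by []. Qed.
HB.instance Definition _ := Num.IntegralDomain_isLeReal.Build (rational M)
  rle0D rle0M rle0_anti rsub_ge0 rle0_total rnormN rge0_norm rlt_def.

Notation K := (rational M).

Definition nat_rat (a : num M) : K := rnat M a.

Lemma nat_ratD a b : nat_rat (add M a b) = nat_rat a + nat_rat b.
Proof. exact: rnatD. Qed.
Lemma nat_ratM a b : nat_rat (mul M a b) = nat_rat a * nat_rat b.
Proof. exact: rnatM. Qed.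
Lemma nat_rat0 : nat_rat (zero M) = 0. Proof. by []. Qed.
Lemma nat_rat1 : nat_rat (one M) = 1. Proof. by []. Qed.
Lemma nat_rat_le a b : (nat_rat a <= nat_rat b) <-> le M a b.
Proof.
rewrite -(rnat_le M a b); split => [/boolp.asboolP|] H; [exact: H|exact/boolp.asboolP].
Qed.
Lemma nat_rat_lt a b : (nat_rat a < nat_rat b) <-> lt M a b.
Proof.
rewrite ltNge lt_not_le; split; first by move=> /negP H /nat_rat_le.
by move=> H; apply/negP => /nat_rat_le.
Qed.
Lemma frac_nat_rat m n d : lt M (zero M) d -> frac M m n d = (nat_rat m - nat_rat n) / nat_rat d.
Proof.
move=> Hd.
have Hd' : nat_rat d != 0 by rewrite gt_eqF // -nat_rat0 nat_rat_lt.
by apply: (mulIf Hd'); rewrite divfK //; exact: frac_rnat.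
Qed.
End RationalField.

(** * Codes of rationals and bounded comparison *)

Section Codes.
Variable M : rca_model.
Notation N := (num M).
Notation K := (rational M).
Notation "x +N y" := (add M x y) (at level 50, left associativity).
Notation "x *N y" := (mul M x y) (at level 40, left associativity).
Notation "x <N y" := (lt M x y) (at level 70).
Notation "x <=N y" := (le M x y) (at level 70).
Notation "0N" := (zero M).
Notation "1N" := (one M).
Definition code (a : K) : N := proj1_sig a.
Notation nat_rat := (nat_rat M).
Notation ratio := (ratio M).

Lemma nat_rat_gt0 d : 0 < nat_rat d <-> 0N <N d.
Proof. by rewrite -nat_rat_lt nat_rat0. Qed.

Lemma nat_rat_ge0 d : 0 <= nat_rat d.
Proof. rewrite -nat_rat0; apply/nat_rat_le; exact: le0n. Qed.

Lemma nat_rat_inj a b : nat_rat a = nat_rat b -> a = b.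
Proof. by move=> E; apply: leN_antisym; apply/nat_rat_le; rewrite E. Qed.

Lemma ratio_code (a : K) m n d : ratio (code a) m n d ->
  0 < nat_rat d /\ nat_rat m = a * nat_rat d + nat_rat n.
Proof.
move=> H; have Hd : 0 < nat_rat d by apply/nat_rat_gt0; case: H => _ [].
split=> //; have -> : a = frac M m n d.
  by apply: rational_inj; rewrite (frac_ratio M _ _ _ _ H).
rewrite frac_nat_rat ?divfK ?subrK //; first by rewrite gt_eqF.
exact/nat_rat_gt0.
Qed.

Lemma code_ratio (a : K) : exists m n d, ratio (code a) m n d.
Proof. exact: proj2_sig a. Qed.

Lemma ratio_decode q m n d : ratio q m n d -> exists a : K, q = code a.
Proof.
move=> H; have Hq : is_rat M q by exists m, n, d.
by exists (exist _ q Hq).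
Qed.

Lemma code_inj (a b : K) : code a = code b -> a = b.
Proof. exact: rational_inj. Qed.

Definition q_zeroM : N := cp M (cp M 0N 0N) 1N.
Definition q_oneM : N := cp M (cp M 1N 0N) 1N.
Definition q_invM (n : N) : N := cp M (cp M 1N 0N) n.

Lemma ratio_inv n : 0N <N n -> ratio (q_invM n) 1N 0N n.
Proof.
move=> Hn; split=> //; split=> //; split; first by right.
move=> c [[x Hx] _]; rewrite addn0 in Hx; symmetry in Hx; exact: muln_eq1 Hx.
Qed.

Lemma ratio_zero : ratio q_zeroM 0N 0N 1N.
Proof.
split=> //; split; first exact: lt01. split; first by right.
move=> c [_ [x Hx]]; symmetry in Hx; exact: muln_eq1 Hx.
Qed.

Lemma code_invN n : 0N <N n -> q_invM n = code (nat_rat n)^-1.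
Proof.
move=> Hn; have H := ratio_inv n Hn.
have [a Ha] := ratio_decode _ _ _ _ H; rewrite Ha in H *; congr code.
have [Hd E] := ratio_code _ _ _ _ H.
rewrite nat_rat0 nat_rat1 addr0 in E.
have Hd' : nat_rat n != 0 by rewrite gt_eqF.
by apply: (mulIf Hd'); rewrite mulVf.
Qed.

Lemma code_zero : q_zeroM = code 0.
Proof.
have H := ratio_zero.
have [a Ha] := ratio_decode _ _ _ _ H; rewrite Ha in H *; congr code.
have [_ E] := ratio_code _ _ _ _ H.
by move: E; rewrite nat_rat0 nat_rat1 addr0 mulr1.
Qed.

Lemma code_one : q_oneM = code 1.
Proof. by rewrite -[q_oneM]/(q_invM 1N) code_invN ?nat_rat1 ?invr1 //; exact: lt01. Qed.

Definition q_ltM (p q : N) : Prop :=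
  exists m n d m' n' d', ratio p m n d /\ ratio q m' n' d' /\
    lt M (m *N d' +N n' *N d) (m' *N d +N n *N d').
Definition q_leM (p q : N) : Prop :=
  exists m n d m' n' d', ratio p m n d /\ ratio q m' n' d' /\
    le M (m *N d' +N n' *N d) (m' *N d +N n *N d').
Definition q_sumM (p q s : N) : Prop :=
  exists m1 n1 d1 m2 n2 d2 m3 n3 d3,
    ratio p m1 n1 d1 /\ ratio q m2 n2 d2 /\ ratio s m3 n3 d3 /\
    m1 *N (d2 *N d3) +N m2 *N (d1 *N d3) +N n3 *N (d1 *N d2) =
    n1 *N (d2 *N d3) +N n2 *N (d1 *N d3) +N m3 *N (d1 *N d2).
Definition q_absM (p q : N) : Prop :=
  exists m n d, ratio p m n d /\ q = cp M (cp M (m +N n) 0N) d.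
Definition is_pos_ratM (q : N) : Prop := is_rat M q /\ q_ltM q_zeroM q.
Definition q_dist_ltM (p q e : N) : Prop :=
  exists s t, q_sumM s q p /\ q_absM s t /\ q_ltM t e.

Lemma q_leP (a b : K) : q_leM (code a) (code b) <-> (a <= b).
Proof.
have key m n d m' n' d' : ratio (code a) m n d -> ratio (code b) m' n' d' ->
    m *N d' +N n' *N d <=N m' *N d +N n *N d' <-> (a <= b).
  move=> /ratio_code [Hd E] /ratio_code [Hd' E'].
  rewrite -nat_rat_le !nat_ratD !nat_ratM E E'.
  have Hdd : 0 < nat_rat d * nat_rat d' by rewrite mulr_gt0.
  rewrite -subr_ge0; set u := (X in 0 <= X).
  have -> : u = (b - a) * (nat_rat d * nat_rat d') by rewrite /u; ring.
  by rewrite pmulr_lge0 // subr_ge0.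
split; first by move=> [m [n [d [m' [n' [d' [H [H' /key]]]]]]]]; exact.
have [m [n [d H]]] := code_ratio a; have [m' [n' [d' H']]] := code_ratio b.
by move=> Hab; exists m, n, d, m', n', d'; split=> //; split=> //; apply/key.
Qed.

Lemma q_ltP (a b : K) : q_ltM (code a) (code b) <-> (a < b).
Proof.
have key m n d m' n' d' : ratio (code a) m n d -> ratio (code b) m' n' d' ->
    m *N d' +N n' *N d <N m' *N d +N n *N d' <-> (a < b).
  move=> /ratio_code [Hd E] /ratio_code [Hd' E'].
  rewrite -nat_rat_lt !nat_ratD !nat_ratM E E'.
  have Hdd : 0 < nat_rat d * nat_rat d' by rewrite mulr_gt0.
  rewrite -subr_gt0; set u := (X in 0 < X).
  have -> : u = (b - a) * (nat_rat d * nat_rat d') by rewrite /u; ring.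
  by rewrite pmulr_lgt0 // subr_gt0.
split; first by move=> [m [n [d [m' [n' [d' [H [H' /key]]]]]]]]; exact.
have [m [n [d H]]] := code_ratio a; have [m' [n' [d' H']]] := code_ratio b.
by move=> Hab; exists m, n, d, m', n', d'; split=> //; split=> //; apply/key.
Qed.

Lemma q_sumP (a b : K) s : q_sumM (code a) (code b) s <-> s = code (a + b).
Proof.
have key m1 n1 d1 m2 n2 d2 m3 n3 d3 (c : K) :
    ratio (code a) m1 n1 d1 -> ratio (code b) m2 n2 d2 -> ratio (code c) m3 n3 d3 ->
    m1 *N (d2 *N d3) +N m2 *N (d1 *N d3) +N n3 *N (d1 *N d2) =
    n1 *N (d2 *N d3) +N n2 *N (d1 *N d3) +N m3 *N (d1 *N d2) <-> c = a + b.
  move=> /ratio_code [H1 E1] /ratio_code [H2 E2] /ratio_code [H3 E3].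
  have H0 : nat_rat d1 * nat_rat d2 * nat_rat d3 != 0.
    by rewrite gt_eqF // !mulr_gt0.
  split.
  - move=> /(congr1 nat_rat); rewrite !nat_ratD !nat_ratM E1 E2 E3 => E.
    apply: (mulIf H0); apply/eqP; rewrite -subr_eq0; apply/eqP.
    by move/eqP: E; rewrite -subr_eq0 => /eqP E; rewrite -[RHS]oppr0 -[in RHS]E; ring.
  - by move=> E; apply: nat_rat_inj; rewrite !nat_ratD !nat_ratM E1 E2 E3 E; ring.
split.
- move=> [m1 [n1 [d1 [m2 [n2 [d2 [m3 [n3 [d3 [H1 [H2 [H3 E]]]]]]]]]]]].
  have [c Hc] := ratio_decode _ _ _ _ H3; rewrite Hc in H3 *.
  by congr code; apply/(key _ _ _ _ _ _ _ _ _ c H1 H2 H3).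
- move=> ->.
  have [m1 [n1 [d1 H1]]] := code_ratio a; have [m2 [n2 [d2 H2]]] := code_ratio b.
  have [m3 [n3 [d3 H3]]] := code_ratio (a + b).
  exists m1, n1, d1, m2, n2, d2, m3, n3, d3; do 3 split=> //.
  exact/(key _ _ _ _ _ _ _ _ _ (a + b) H1 H2 H3).
Qed.

Lemma q_absP (a : K) t : q_absM (code a) t <-> t = code `|a|.
Proof.
have key m n d : ratio (code a) m n d -> cp M (cp M (m +N n) 0N) d = code `|a|.
  move=> H; have [Hd E] := ratio_code _ _ _ _ H.
  have H' : ratio (cp M (cp M (m +N n) 0N) d) (m +N n) 0N d.
    case: H => _ [H1 [_ H2]]; split=> //; split=> //; split; first by right.
    by rewrite addn0.
  have [b Hb] := ratio_decode _ _ _ _ H'; rewrite Hb in H' *; congr code.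
  have [_ E'] := ratio_code _ _ _ _ H'.
  have Hd' : nat_rat d != 0 by rewrite gt_eqF.
  apply: (mulIf Hd'); rewrite nat_rat0 addr0 nat_ratD in E'; rewrite -E'.
  have [Hm Hn] : 0 <= nat_rat m /\ 0 <= nat_rat n by split; exact: nat_rat_ge0.
  rewrite -(gtr0_norm Hd) -normrM.
  case: H => _ [_ [[Hz|Hz] _]]; rewrite Hz nat_rat0 in E *.
  - have -> : a * nat_rat d = - nat_rat n by rewrite -[RHS]add0r [in RHS]E; ring.
    by rewrite normrN ger0_norm // add0r.
  - by rewrite addr0 in E; rewrite -E ger0_norm // addr0.
split; first by move=> [m [n [d [/key H ->]]]].
by move=> ->; have [m [n [d H]]] := code_ratio a; exists m, n, d; split=> //; rewrite (key _ _ _ H).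
Qed.

Lemma q_dist_ltP (a b e : K) : q_dist_ltM (code a) (code b) (code e) <-> `|a - b| < e.
Proof.
split.
- move=> [s [t [Hs [Ht Hlt]]]].
  have [x Hx] : exists x : K, s = code x.
    by case: Ht => [m [n [d [/ratio_decode H _]]]].
  rewrite Hx in Hs Ht; move: Hs => /q_sumP /code_inj Ea.
  move: Ht => /q_absP Et; rewrite Et in Hlt; move: Hlt => /q_ltP.
  by rewrite Ea addrK.
- move=> H; exists (code (a - b)), (code `|a - b|); split; last split.
  + by apply/q_sumP; rewrite subrK.
  + exact/q_absP.
  + exact/q_ltP.
Qed.

Lemma is_ratP q : is_rat M q <-> exists a : K, q = code a.
Proof. by split=> [H|[a ->]]; [exists (exist _ q H) | exact: proj2_sig]. Qed.

Lemma is_pos_ratP q : is_pos_ratM q <-> exists a : K, 0 < a /\ q = code a.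
Proof.
split; rewrite /is_pos_ratM code_zero.
  by move=> [/is_ratP [a ->] /q_ltP H]; exists a.
by move=> [a [H ->]]; split; [exact: proj2_sig | apply/q_ltP].
Qed.

(* The inequality [p1 + p2 <= p3 + p4] between coded rationals. *)
Definition with_parts (p : N) (P : N -> N -> N -> Prop) : Prop :=
  exists m, m <N p +N 1N /\ exists n, n <N p +N 1N /\ exists d, d <N p +N 1N /\
    (p = cp M (cp M m n) d /\ P m n d).

Definition le4 (p1 p2 p3 p4 : N) : Prop :=
  with_parts p1 (fun m1 n1 d1 => with_parts p2 (fun m2 n2 d2 =>
  with_parts p3 (fun m3 n3 d3 => with_parts p4 (fun m4 n4 d4 =>
    m1 *N (d2 *N d3 *N d4) +N m2 *N (d1 *N d3 *N d4) +N
      n3 *N (d1 *N d2 *N d4) +N n4 *N (d1 *N d2 *N d3) <=N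
    n1 *N (d2 *N d3 *N d4) +N n2 *N (d1 *N d3 *N d4) +N
      m3 *N (d1 *N d2 *N d4) +N m4 *N (d1 *N d2 *N d3))))).

Lemma with_partsP (a : K) m n d P : ratio (code a) m n d -> (with_parts (code a) P <-> P m n d).
Proof.
move=> [E H]; split.
- move=> [m' [_ [n' [_ [d' [_ [E' HP]]]]]]]; rewrite E in E'.
  by move: E' => /cp_inj [/cp_inj [<- <-] <-] in HP.
- move=> HP; have [H1 [H2 H3]] := cp_bounds M m n d; rewrite -E in H1 H2 H3.
  by exists m; split=> //; exists n; split=> //; exists d; split.
Qed.

(** All comparisons inside comprehension are reduced to this predicate, because [q_leM] and [q_sumM]
    are written with unbounded quantifiers. Four summands suffice to express distances: an absolute
    value becomes a combination of two such inequalities. *)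
Lemma le4P (a b c d : K) : le4 (code a) (code b) (code c) (code d) <-> (a + b <= c + d).
Proof.
have [m1 [n1 [d1 H1]]] := code_ratio a; have [m2 [n2 [d2 H2]]] := code_ratio b.
have [m3 [n3 [d3 H3]]] := code_ratio c; have [m4 [n4 [d4 H4]]] := code_ratio d.
rewrite /le4 (with_partsP _ _ _ _ _ H1) (with_partsP _ _ _ _ _ H2).
rewrite (with_partsP _ _ _ _ _ H3) (with_partsP _ _ _ _ _ H4).
move: H1 H2 H3 H4 => /ratio_code [H1 E1] /ratio_code [H2 E2] /ratio_code [H3 E3] /ratio_code [H4 E4].
rewrite -nat_rat_le !nat_ratD !nat_ratM E1 E2 E3 E4.
have H0 : 0 < nat_rat d1 * nat_rat d2 * nat_rat d3 * nat_rat d4 by rewrite !mulr_gt0.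
rewrite -subr_ge0; set u := (X in 0 <= X).
have -> : u = (c + d - (a + b)) * (nat_rat d1 * nat_rat d2 * nat_rat d3 * nat_rat d4).
  by rewrite /u; ring.
by rewrite pmulr_lge0 // subr_ge0.
Qed.
End Codes.

(** A term parameter under nested bounded quantifiers sees an environment shifted once per
    quantifier. The shift is found by trial; [le4] nests twelve quantifiers. *)
Ltac reindex_with M f t H fuel :=
  first [ exact (DT_reindex M f t H)
        | match fuel with S ?k =>
            let f' := eval cbv beta in (fun n : nat => S (f n)) in
            reindex_with M f' t H k
          end ].

Ltac definable_hook ::=
  first
  [ apply D0_le; definable
  | apply D0_dvd; definable
  | apply DT_cp; definable
  | apply D0_is_rat; definable
  | match goal with
    | H : DT ?M ?t |- DT ?M (fun e => ?t _) => reindex_with M S t H 14%nat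
    end ].

Lemma D0_le4 (M : rca_model) t1 t2 t3 t4 : DT M t1 -> DT M t2 -> DT M t3 -> DT M t4 ->
  D0 M (fun e => le4 M (t1 e) (t2 e) (t3 e) (t4 e)).
Proof. intros H1 H2 H3 H4. unfold le4, with_parts. definable. Qed.

Lemma DT_q_inv (M : rca_model) t : DT M t -> DT M (fun e => q_invM M (t e)).
Proof. intros H. unfold q_invM. definable. Qed.

Ltac definable_hook ::=
  first
  [ apply D0_le; definable
  | apply D0_dvd; definable
  | apply DT_cp; definable
  | apply D0_is_rat; definable
  | apply D0_le4; definable
  | apply DT_q_inv; definable ].

(** * Reals in a model *)

Section Sem.
Variable M : rca_model.
Notation N := (num M).
Notation S := (set M).
Notation "x <N y" := (lt M x y) (at level 70).
Notation "x <=N y" := (le M x y) (at level 70).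
Notation "0N" := (zero M).
Notation cp := (cp M).
Notation elem := (elem M).

(* The suffix M marks the interpretation in [M] of a definition of Defs, copied
   connective by connective so that the statements below are convertible to the
   truth in [M] of the two sentences. *)
Definition is_functionM (D E : N -> Prop) (F : S) : Prop :=
  (forall c, elem c F -> exists a b, c = cp a b /\ D a /\ E b) /\
  (forall a, D a -> exists b, elem (cp a b) F) /\
  (forall a b b', elem (cp a b) F /\ elem (cp a b') F -> b = b').
Definition any_natM (n : N) : Prop := n = n.
Definition rat_nat_pairM (c : N) : Prop := exists q i, c = cp q i /\ is_rat M q.

Definition seqM : Type := N -> N -> Prop.
Definition seq_ofM (X : S) : seqM := fun n q => elem (cp n q) X.
Definition r_constM (a : N) : seqM := fun _ q => q = a.
Definition r_subM (x y : seqM) : seqM :=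
  fun n q => exists u v, x n u /\ y n v /\ q_sumM M q v u.
Definition r_absM (x : seqM) : seqM := fun n q => exists u, x n u /\ q_absM M u q.
Definition is_realM (X : S) : Prop :=
  is_functionM any_natM (is_rat M) X /\
  forall e, is_pos_ratM M e -> exists n0, forall m n, n0 <=N m /\ n0 <=N n ->
    exists u v, seq_ofM X m u /\ seq_ofM X n v /\ q_dist_ltM M u v e.
Definition r_leM (x y : seqM) : Prop :=
  forall e, is_pos_ratM M e -> exists n0, forall n, n0 <=N n ->
    exists u v w, x n u /\ y n v /\ q_sumM M v e w /\ q_leM M u w.
Definition r_eqM (x y : seqM) : Prop := r_leM x y /\ r_leM y x.
Definition r_ltM (x y : seqM) : Prop := r_leM x y /\ ~ r_eqM x y.
Definition in_ballM (d : N) (y z : seqM) : Prop :=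
  r_ltM (r_absM (r_subM y z)) (r_constM d).
Definition is_open_codeM (U : S) : Prop :=
  forall c, elem c U ->
    exists n a r, c = cp (cp n a) r /\ is_rat M a /\ is_pos_ratM M r.
Definition in_openM (x : seqM) (U : S) : Prop :=
  exists n0 a r, is_rat M a /\ is_pos_ratM M r /\ in_ballM r (r_constM a) x /\
    forall n, n0 <=N n -> elem (cp (cp n a) r) U.
Definition is_partial_contM (F : S) : Prop := is_functionM rat_nat_pairM (is_rat M) F.
Definition entryM (F : S) (q i u : N) : Prop := elem (cp (cp q i) u) F.
Definition in_domM (x : seqM) (F : S) : Prop :=
  forall e, is_pos_ratM M e -> exists n0, 0N <N n0 /\
    forall q r i j,
      is_rat M q /\ is_rat M r /\
      in_ballM (q_invM M n0) x (r_constM q) /\ in_ballM (q_invM M n0) x (r_constM r) /\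
      n0 <=N i /\ n0 <=N j ->
      exists u v, entryM F q i u /\ entryM F r j v /\ q_dist_ltM M u v e.
Definition valueM (F : S) (x : seqM) : seqM :=
  fun n q => exists u, x n u /\ entryM F u n q.
Definition is_contM (F : S) : Prop :=
  is_partial_contM F /\ forall X, is_realM X -> in_domM (seq_ofM X) F.

Definition preimage_open_statement : Prop :=
  forall F V, is_contM F /\ is_open_codeM V ->
       exists U, is_open_codeM U /\
         forall X, is_realM X ->
           ((in_openM (seq_ofM X) U -> in_openM (valueM F (seq_ofM X)) V) /\
            (in_openM (valueM F (seq_ofM X)) V -> in_openM (seq_ofM X) U)).

Definition open_cozero_statement : Prop :=
  forall U, is_open_codeM U ->
       exists G, is_contM G /\
         (forall X, is_realM X ->
            r_leM (r_constM (q_zeroM M)) (valueM G (seq_ofM X)) /\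
            r_leM (valueM G (seq_ofM X)) (r_constM (q_oneM M))) /\
         (forall X, is_realM X ->
            ((in_openM (seq_ofM X) U ->
             r_ltM (r_constM (q_zeroM M)) (valueM G (seq_ofM X)) /\
             r_leM (valueM G (seq_ofM X)) (r_constM (q_oneM M))) /\
            (r_ltM (r_constM (q_zeroM M)) (valueM G (seq_ofM X)) /\
             r_leM (valueM G (seq_ofM X)) (r_constM (q_oneM M)) -> 
             in_openM (seq_ofM X) U))).
End Sem.

(** * Cauchy sequences, balls and continuity in the model *)

Section Analysis.
Variable M : rca_model.
Notation N := (num M).
Notation K := (rational M).
Notation S := (set M).
Notation "x +N y" := (add M x y) (at level 50, left associativity).
Notation "x <N y" := (lt M x y) (at level 70).
Notation "x <=N y" := (le M x y) (at level 70).
Notation "0N" := (zero M).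
Notation "1N" := (one M).
Notation code := (code M).
Notation nat_rat := (nat_rat M).
Notation cp := (cp M).
Notation elem := (elem M).

Notation seq_ofM := (seq_ofM M).
Notation r_constM := (r_constM M).

Definition ev (P : N -> Prop) : Prop := exists n0, forall n, n0 <=N n -> P n.

Lemma ev_and P Q : ev P -> ev Q -> ev (fun n => P n /\ Q n).
Proof.
move=> [a Ha] [b Hb]; exists (a +N b) => n Hn; split.
  by apply: Ha; apply: leN_trans Hn; exact: le_addr.
by apply: Hb; apply: leN_trans Hn; exact: le_addl.
Qed.

Lemma ev_mono (P Q : N -> Prop) : (forall n, P n -> Q n) -> ev P -> ev Q.
Proof. by move=> H [a Ha]; exists a => n /Ha /H. Qed.

Lemma ev_ge k : ev (fun n => k <=N n).
Proof. by exists k. Qed.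

Lemma ev_ex P : ev P -> exists n, P n.
Proof. by move=> [a Ha]; exists a; apply: Ha; exact: leN_refl. Qed.

Definition cauchy (x : N -> K) : Prop := forall e : K, 0 < e ->
  exists n0, forall m n, n0 <=N m -> n0 <=N n -> `|x m - x n| < e.
Definition sle (x y : N -> K) : Prop := forall e : K, 0 < e -> ev (fun n => x n <= y n + e).
Definition slt (x y : N -> K) : Prop := sle x y /\ ~ (sle x y /\ sle y x).

Lemma cauchy_contract (x y : N -> K) :
  cauchy x -> (forall m n, `|y m - y n| <= `|x m - x n|) -> cauchy y.
Proof.
move=> Hx H e /Hx [n0 Hn0]; exists n0 => m n Hm Hn.
exact: le_lt_trans (H m n) (Hn0 m n Hm Hn).
Qed.

Lemma dist_contract (a b c : K) : `| `|b - a| - `|c - a| | <= `|b - c|.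
Proof. by apply: le_trans (ler_dist_dist _ _) _; rewrite opprB addrA subrK. Qed.

(** The strict order is defined by a negation, which only yields entries [x n < c - e] at
    arbitrarily late [n]. The Cauchy property spreads this to all late entries at the cost of half
    the gap. *)
Lemma slt_const_r x (c : K) : cauchy x ->
  (slt x (fun=> c) <-> exists d : K, 0 < d /\ ev (fun n => x n <= c - d)).
Proof.
move=> Hx; split.
- move=> [H1 H2]; have [e He] : exists e, 0 < e /\ ~ ev (fun n => c <= x n + e).
    apply: NNPP => H; apply: H2; split=> // e He; apply: NNPP => H'; apply: H; by exists e.
  case: He => He Hn; have He2 : 0 < e / 2 by lra.
  have [n0 Hn0] := Hx _ He2.
  have [n [Hnn Hnx]] : exists n, n0 <=N n /\ x n + e < c.
    apply: NNPP => H; apply: Hn; exists n0 => n Hnn; rewrite leNgt; apply/negP => Hlt.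
    by apply: H; exists n.
  exists (e / 2); split=> //; exists n0 => m Hm.
  by have := Hn0 m n Hm Hnn; rewrite ltr_norml; lra.
- move=> [d [Hd Hev]]; split.
    by move=> e He; apply: ev_mono Hev => n; lra.
  move=> [_ H]; have Hd2 : 0 < d / 2 by lra.
  by have [n] := ev_ex _ (ev_and _ _ Hev (H _ Hd2)); lra.
Qed.

Lemma slt_const_l x (c : K) : cauchy x ->
  (slt (fun=> c) x <-> exists d : K, 0 < d /\ ev (fun n => c + d <= x n)).
Proof.
move=> Hx; split.
- move=> [H1 H2]; have [e He] : exists e, 0 < e /\ ~ ev (fun n => x n <= c + e).
    apply: NNPP => H; apply: H2; split=> // e He; apply: NNPP => H'; apply: H; by exists e.
  case: He => He Hn; have He2 : 0 < e / 2 by lra.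
  have [n0 Hn0] := Hx _ He2.
  have [n [Hnn Hnx]] : exists n, n0 <=N n /\ c + e < x n.
    apply: NNPP => H; apply: Hn; exists n0 => n Hnn; rewrite leNgt; apply/negP => Hlt.
    by apply: H; exists n.
  exists (e / 2); split=> //; exists n0 => m Hm.
  by have := Hn0 m n Hm Hnn; rewrite ltr_norml; lra.
- move=> [d [Hd Hev]]; split.
    by move=> e He; apply: ev_mono Hev => n; lra.
  move=> [_ H]; have Hd2 : 0 < d / 2 by lra.
  by have [n] := ev_ex _ (ev_and _ _ Hev (H _ Hd2)); lra.
Qed.

(** Bridge from the relational sequences of the formal statement to functions into the field; it
    covers derived sequences such as values and distances, for which no set of the model is
    needed. *)
Definition Repr (R : seqM M) (x : N -> K) : Prop := forall n q, R n q <-> q = code (x n).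

Lemma Repr_const a : Repr (r_constM (code a)) (fun=> a).
Proof. by []. Qed.

Lemma Repr_sub R T x y : Repr R x -> Repr T y -> Repr (r_subM M R T) (fun n => x n - y n).
Proof.
move=> HR HT n q; split.
- move=> [u [v [/HR -> [/HT -> H]]]].
  have [a Ha] : exists a : K, q = code a.
    by case: H => [m [k [d [_ [_ [_ [_ [_ [_ [/ratio_decode H _]]]]]]]]]].
  rewrite Ha in H *; move: H => /q_sumP /code_inj ->; by rewrite addrK.
- move=> ->; exists (code (x n)), (code (y n)); split; first exact/HR.
  by split; [exact/HT | apply/q_sumP; rewrite subrK].
Qed.

Lemma Repr_abs R x : Repr R x -> Repr (r_absM M R) (fun n => `|x n|).
Proof.
move=> HR n q; split; first by move=> [u [/HR -> /q_absP]].
by move=> ->; exists (code (x n)); split; [exact/HR | exact/q_absP].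
Qed.

Lemma r_leP R T x y : Repr R x -> Repr T y -> (r_leM M R T <-> sle x y).
Proof.
move=> HR HT; split=> H e He.
- have [|n0 Hn0] := H (code e); first by apply/is_pos_ratP; exists e.
  exists n0 => n /Hn0 [u [v [w [/HR -> [/HT -> [/q_sumP -> /q_leP]]]]]].
  exact.
- move: He => /is_pos_ratP [a [Ha ->]]; have [n0 Hn0] := H a Ha.
  exists n0 => n /Hn0 Hn; exists (code (x n)), (code (y n)), (code (y n + a)).
  by split; [exact/HR | split; [exact/HT | split; [exact/q_sumP | exact/q_leP]]].
Qed.

Lemma r_ltP R T x y : Repr R x -> Repr T y -> (r_ltM M R T <-> slt x y).
Proof.
move=> HR HT; rewrite /r_ltM /r_eqM /slt.
by rewrite (r_leP _ _ _ _ HR HT) (r_leP _ _ _ _ HT HR).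
Qed.

Lemma in_ballP R T x y (d : K) : Repr R x -> Repr T y ->
  (in_ballM M (code d) R T <-> slt (fun n => `|x n - y n|) (fun=> d)).
Proof.
move=> HR HT; apply: r_ltP (Repr_const d).
exact/Repr_abs/Repr_sub.
Qed.

Lemma function_values D F : is_functionM M D (is_rat M) F ->
  exists g : N -> K, forall c u, D c -> (elem (cp c u) F <-> u = code (g c)).
Proof.
move=> [H1 [H2 H3]].
have /boolp.choice [g Hg] : forall c, exists y : K, D c -> elem (cp c (code y)) F.
  move=> c.
  case: (classic (D c)) => [Hc|]; last by exists 0.
  have [b Hb] := H2 c Hc; have [a' [b' [E [_ /is_ratP [y Ey]]]]] := H1 _ Hb.
  by move: E => /cp_inj [_ Eb]; exists y => _; rewrite -Ey -Eb.
exists g => c u Hc; split; last by move=> ->; exact: Hg.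
by move=> Hu; apply: (H3 c); split=> //; exact: Hg.
Qed.

Lemma real_values X : is_realM M X -> exists x, Repr (seq_ofM X) x /\ cauchy x.
Proof.
move=> [HF HC]; have [x Hx] := function_values _ _ HF.
have HR : Repr (seq_ofM X) x by move=> n q; exact: Hx.
exists x; split=> // e He.
have [|n0 Hn0] := HC (code e); first by apply/is_pos_ratP; exists e.
exists n0 => m n Hm Hn; have [u [v [/HR -> [/HR -> /q_dist_ltP]]]] := Hn0 m n (conj Hm Hn).
exact.
Qed.

Definition function_repr (F : S) (f : K -> N -> K) : Prop :=
  forall a i u, entryM M F (code a) i u <-> u = code (f a i).

Lemma cont_values F : is_partial_contM M F -> exists f, function_repr F f.
Proof.
move=> HF; have [g Hg] := function_values _ _ HF.
exists (fun a i => g (cp (code a) i)) => a i u; apply: Hg.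
by exists (code a), i; split=> //; apply/is_ratP; exists a.
Qed.

Lemma Repr_value F f R x : function_repr F f -> Repr R x ->
  Repr (valueM M F R) (fun n => f (x n) n).
Proof.
move=> Hf HR n q; split; first by move=> [u [/HR -> /Hf]].
by move=> ->; exists (code (x n)); split; [exact/HR | exact/Hf].
Qed.

Notation iv n := ((nat_rat n)^-1).

Lemma iv_gt0 n : 0N <N n -> 0 < iv n.
Proof. by move=> /nat_rat_gt0; rewrite invr_gt0. Qed.

Lemma iv_le m n : 0N <N m -> m <=N n -> iv n <= iv m.
Proof.
move=> Hm Hmn; have Hm' : 0 < nat_rat m by exact/nat_rat_gt0.
have Hmn' : nat_rat m <= nat_rat n by exact/nat_rat_le.
by rewrite lef_pV2 // posrE //; lra.
Qed.

Lemma iv1 : iv 1N = 1. Proof. by rewrite nat_rat1 invr1. Qed.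

(** This holds relative to the numbers of the model: a positive [(m - n) / d] has [m >= n + 1], so
    it is at least [1 / d] and exceeds [1 / (d + 1)]. *)
Lemma archimedean e : 0 < e -> exists n, 0N <N n /\ iv n < e.
Proof.
move=> He; have [m [n [d H]]] := code_ratio M e.
have [Hd E] := ratio_code _ _ _ _ _ H.
have Hed : 0 < e * nat_rat d by rewrite mulr_gt0.
have Hnm : n <N m by apply/nat_rat_lt; rewrite E; lra.
have {}Hnm : nat_rat n + 1 <= nat_rat m.
  by rewrite -nat_rat1 -nat_ratD nat_rat_le; apply/ltS_le.
exists (d +N 1N); split; first exact: lt0S.
rewrite -div1r ltr_pdivrMr; last by rewrite nat_ratD nat_rat1; lra.
by rewrite nat_ratD nat_rat1; nra.
Qed.

Lemma in_domP R x F f : Repr R x -> function_repr F f -> (in_domM M R F <->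
  forall e : K, 0 < e -> exists n0, 0N <N n0 /\ forall (q r : K) i j,
    slt (fun n => `|x n - q|) (fun=> iv n0) -> slt (fun n => `|x n - r|) (fun=> iv n0) ->
    n0 <=N i -> n0 <=N j -> `|f q i - f r j| < e).
Proof.
move=> HR Hf; split=> H e He.
- have [|n0 [Hn0 H0]] := H (code e); first by apply/is_pos_ratP; exists e.
  exists n0; split=> // q r i j Hq Hr Hi Hj.
  have [|u [v [/Hf -> [/Hf -> /q_dist_ltP]]]] := H0 (code q) (code r) i j; last exact.
  rewrite code_invN //; split; first by apply/is_ratP; exists q.
  split; first by apply/is_ratP; exists r.
  split; first exact/(in_ballP _ _ _ _ _ HR (Repr_const q)).
  by split; first exact/(in_ballP _ _ _ _ _ HR (Repr_const r)).
- move: He => /is_pos_ratP [a [Ha ->]]; have [n0 [Hn0 H0]] := H a Ha.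
  exists n0; split=> // q r i j [/is_ratP [q' ->]] [/is_ratP [r' ->]].
  rewrite code_invN //.
  move=> [/(in_ballP _ _ _ _ _ HR (Repr_const q')) Hq].
  move=> [/(in_ballP _ _ _ _ _ HR (Repr_const r')) Hr [Hi Hj]].
  exists (code (f q' i)), (code (f r' j)); split; first exact/Hf.
  by split; [exact/Hf | apply/q_dist_ltP; exact: H0].
Qed.

Lemma cauchy_dist a x : cauchy x -> cauchy (fun n => `|a - x n|).
Proof.
by move=> Hx; apply: cauchy_contract Hx _ => m n; rewrite !(distrC a); exact: dist_contract.
Qed.

Lemma in_ball_const R x a r : Repr R x -> cauchy x ->
  (in_ballM M (code r) (r_constM (code a)) R <->
   exists d : K, 0 < d /\ ev (fun n => `|a - x n| <= r - d)).
Proof.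
move=> HR Hx; rewrite (in_ballP _ _ _ _ _ (Repr_const a) HR).
by apply: slt_const_r; exact: cauchy_dist.
Qed.

(** Late entries of a real lie in any ball around it, so the continuity condition, which speaks of
    rationals near [x], applies to the entries used in the value. *)
Lemma cauchy_near x d : cauchy x -> 0 < d ->
  ev (fun i => slt (fun n => `|x n - x i|) (fun=> d)).
Proof.
move=> Hx Hd; have Hd2 : 0 < d / 2 by lra.
have [n0 Hn0] := Hx _ Hd2; exists n0 => i Hi.
apply/slt_const_r.
  by apply: cauchy_contract Hx _ => m n; exact: dist_contract.
exists (d / 2); split=> //; exists n0 => n Hn.
by have := Hn0 n i Hn Hi; lra.
Qed.

Lemma cauchy_value x (f : K -> N -> K) : cauchy x ->
  (forall e : K, 0 < e -> exists n0, 0N <N n0 /\ forall (q r : K) i j,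
    slt (fun n => `|x n - q|) (fun=> iv n0) -> slt (fun n => `|x n - r|) (fun=> iv n0) ->
    n0 <=N i -> n0 <=N j -> `|f q i - f r j| < e) ->
  cauchy (fun n => f (x n) n).
Proof.
move=> Hx Hf e /Hf [n0 [Hn0 H0]].
have [n1 Hn1] := ev_and _ _ (cauchy_near _ _ Hx (iv_gt0 _ Hn0)) (ev_ge n0).
by exists n1 => m n /Hn1 [? ?] /Hn1 [? ?]; apply: H0.
Qed.
End Analysis.

(** * Preimages of open sets *)

Section PartA.
Variable M : rca_model.
Notation N := (num M).
Notation K := (rational M).
Notation S := (set M).
Notation "x +N y" := (add M x y) (at level 50, left associativity).
Notation "x <N y" := (lt M x y) (at level 70).
Notation "x <=N y" := (le M x y) (at level 70).
Notation "0N" := (zero M).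
Notation "1N" := (one M).
Notation code := (code M).
Notation nat_rat := (nat_rat M).
Notation cp := (cp M).
Notation elem := (elem M).

Notation q_invM := (q_invM M).
Notation le4 := (le4 M).
Notation iv n := ((nat_rat n)^-1).

Lemma le4_ball (q a r : K) :
  (~ le4 (code a) (code r) (code q) (code 0) /\ ~ le4 (code q) (code r) (code a) (code 0))
  <-> `|q - a| < r.
Proof.
rewrite !le4P ltr_norml; split.
  by move=> [/negP H1 /negP H2]; lra.
by move=> H; split; apply/negP; lra.
Qed.

(* The radius [r = 1 / (code of (n0, b, s, j) + 1)] carries the data of a ball
   [B_s(b)] that belongs to [V] from stage [n0] on; the free component [j] makes
   such radii arbitrarily small. *)
Definition preimage_at (F V : S) (n a r : N) : Prop :=
  exists n0, n0 <N r +N 1N /\ exists b, b <N r +N 1N /\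
  exists s, s <N r +N 1N /\ exists j, j <N r +N 1N /\
  (r = q_invM (cp (cp (cp n0 b) s) j +N 1N) /\ 0N <N n0 /\ is_rat M b /\ is_rat M s /\
   (forall m, m <N n +N 1N -> n0 <=N m -> elem (cp (cp m b) s) V) /\
   (forall q, q <N n +N 1N -> is_rat M q ->
      ~ le4 a r q (code 0) /\ ~ le4 q r a (code 0) ->
      forall i, i <N n +N 1N -> n0 <=N i ->
      forall u, u <N n +N 1N -> elem (cp (cp q i) u) F ->
      le4 u (q_invM n0) b s /\ le4 b (q_invM n0) u s)).

Lemma preimage_code F V : exists U, forall c, elem c U <->
  exists n, n <N c +N 1N /\ exists a, a <N c +N 1N /\ exists r, r <N c +N 1N /\
    (c = cp (cp n a) r /\ is_rat M a /\ preimage_at F V n a r).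
Proof. apply: delta0_comprehension; rewrite /preimage_at; definable. Qed.

Lemma elem_bounded (P : N -> N -> N -> Prop) n a r :
  (exists n', n' <N cp (cp n a) r +N 1N /\ exists a', a' <N cp (cp n a) r +N 1N /\
   exists r', r' <N cp (cp n a) r +N 1N /\ (cp (cp n a) r = cp (cp n' a') r' /\ P n' a' r'))
  <-> P n a r.
Proof.
split.
  by move=> [n' [_ [a' [_ [r' [_ [/cp_inj [/cp_inj [<- <-] <-] H]]]]]]].
have [H1 [H2 H3]] := cp_bounds M n a r => H.
by exists n; split=> //; exists a; split=> //; exists r.
Qed.

Section Preimage.
Variables (F V : S) (f : K -> N -> K).
Hypothesis Hf : function_repr M F f.

(** The $\Pi^0_1$ condition approximated by [preimage_at]. The margin [iv n0] keeps the limit of the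
    values strictly inside the ball, although only non-strict inequalities are tested. *)
Definition ball_maps_into (n0 : N) (b s a r : K) : Prop :=
  (forall m, n0 <=N m -> elem (cp (cp m (code b)) (code s)) V) /\
  (forall q i, `|q - a| < r -> n0 <=N i -> `|f q i - b| + iv n0 <= s).

Lemma preimage_elim a r k :
  (forall n, k <=N n -> preimage_at F V n (code a) (code r)) ->
  exists n0 b s, 0N <N n0 /\ ball_maps_into n0 b s a r.
Proof.
move=> H.
have [n0 [_ [b' [_ [s' [_ [j [_ [E [Hn0 [/is_ratP [b Eb] [/is_ratP [s Es] _]]]]]]]]]]]] :=
  H k (leN_refl M k).
rewrite {b'}Eb {s'}Es in E; exists n0, b, s; split=> //.
(* The radius is the same at all stages and determines [n0], [b] and [s] by injectivity of coding,
   so every stage speaks about the data read off at stage [k]. *)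
have {}H n : k <=N n ->
   (forall m, m <N n +N 1N -> n0 <=N m -> elem (cp (cp m (code b)) (code s)) V) /\
   (forall q, q <N n +N 1N -> is_rat M q ->
      ~ le4 (code a) (code r) q (code 0) /\ ~ le4 q (code r) (code a) (code 0) ->
      forall i, i <N n +N 1N -> n0 <=N i ->
      forall u, u <N n +N 1N -> elem (cp (cp q i) u) F ->
      le4 u (q_invM n0) (code b) (code s) /\ le4 (code b) (q_invM n0) u (code s)).
  move=> /H [n1 [_ [b' [_ [s' [_ [j' [_ [E' [_ [_ [_ H']]]]]]]]]]]].
  rewrite E in E'; move: E' => /cp_inj [_ /addIn E'].
  by move: E' => /cp_inj [/cp_inj [/cp_inj [-> ->] ->] _].
split.
- move=> m Hm; have [|H' _] := H (k +N m); first exact: le_addr.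
  by apply: H' => //; apply/le_ltS; exact: le_addl.
- move=> q i Hq Hi.
  (* A stage at which the point, the index and the code of the value are all within the bounds of
     the search. *)
  pose n := k +N (code q +N (i +N code (f q i))).
  have [|_ H'] := H n; first exact: le_addr.
  have Hn1 : code q <N n +N 1N.
    by apply/le_ltS; apply: leN_trans (le_addl _ _ _); exact: le_addr.
  have Hn2 : i <N n +N 1N.
    apply/le_ltS; apply: leN_trans (le_addl _ _ _); apply: leN_trans (le_addl _ _ _); exact: le_addr.
  have Hn3 : code (f q i) <N n +N 1N.
    by apply/le_ltS; do 3 (apply: leN_trans (le_addl _ _ _)); exact: leN_refl.
  have Hrat : is_rat M (code q) by apply/is_ratP; exists q.
  have [] := H' _ Hn1 Hrat (proj2 (le4_ball _ _ _) Hq) _ Hn2 Hi _ Hn3 (proj2 (Hf _ _ _) erefl).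
  rewrite code_invN // !le4P => H1 H2.
  have : `|f q i - b| <= s - iv n0 by rewrite ler_norml; lra.
  by lra.
Qed.

Lemma preimage_intro n0 b s j a n :
  0N <N n0 ->
  ball_maps_into n0 b s a (iv (cp (cp (cp n0 (code b)) (code s)) j +N 1N)) ->
  preimage_at F V n (code a) (code (iv (cp (cp (cp n0 (code b)) (code s)) j +N 1N))).
Proof.
set D := cp _ j; move=> Hn0 [H1 H2].
have HD : 0N <N D +N 1N by exact: lt0S.
rewrite -code_invN //.
(* The rational is small, but its code is a pair with second component [D + 1]; hence everything
   packed into [D] lies below the code of the radius. *)
have HDr : D +N 1N <=N q_invM (D +N 1N) by exact: le_cp_r.
have lt_r x : x <=N D -> x <N q_invM (D +N 1N) +N 1N.
  move=> Hx; apply/le_ltS; apply: leN_trans HDr; apply: leN_trans Hx _; exact: le_addr.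
exists n0; split.
  by apply: lt_r; do 3 (apply: leN_trans (le_cp_l _ _ _)); exact: leN_refl.
exists (code b); split.
  by apply: lt_r; do 2 (apply: leN_trans (le_cp_l _ _ _)); exact: le_cp_r.
exists (code s); split.
  by apply: lt_r; apply: leN_trans (le_cp_l _ _ _); exact: le_cp_r.
exists j; split; first by apply: lt_r; exact: le_cp_r.
do 2 (split=> //); split; first by apply/is_ratP; exists b.
split; first by apply/is_ratP; exists s.
split; first by move=> m _; exact: H1.
move=> q _ /is_ratP [q' ->]; rewrite code_invN // => /le4_ball Hq i _ Hi u _ /Hf ->.
have := H2 _ _ Hq Hi; rewrite code_invN // !le4P => H.
have : `|f q' i - b| <= s - iv n0 by lra.
by rewrite ler_norml => /andP [? ?]; split; lra.
Qed.
End Preimage.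

Theorem preimage_open : preimage_open_statement M.
Proof.
move=> F V [[HF Hdom] HV].
have [f Hf] := cont_values _ _ HF.
have [U HU] := preimage_code F V.
have HUmem n a r : elem (cp (cp n a) r) U <-> is_rat M a /\ preimage_at F V n a r.
  by rewrite HU (elem_bounded (fun n a r => is_rat M a /\ preimage_at F V n a r)).
exists U; split.
  move=> c /HU [n [_ [a [_ [r [_ [-> [Ha H]]]]]]]]; exists n, a, r; split=> //; split=> //.
  move: H => [n0 [_ [b [_ [s [_ [j [_ [-> _]]]]]]]]].
  apply/is_pos_ratP; have HD := lt0S M (cp (cp (cp n0 b) s) j).
  by eexists; split; [exact: iv_gt0 HD | exact: code_invN HD].
move=> X HX; have [x [Hx Cx]] := real_values _ _ HX.
have Hv := Repr_value _ _ _ _ _ Hf Hx.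
have Hdomf := proj1 (in_domP _ _ _ _ _ Hx Hf) (Hdom X HX).
have Cv := cauchy_value _ _ _ Cx Hdomf.
split.
- move=> [k [a' [r' [/is_ratP [a ->] [/is_pos_ratP [r [Hr ->]] [Hball Hmem]]]]]].
  have [n0 [b [s [Hn0 [HbV Hbf]]]]] : exists n0 b s, 0N <N n0 /\ ball_maps_into V f n0 b s a r.
    apply: (preimage_elim _ _ _ Hf _ _ k) => n Hn.
    by have /HUmem [] := Hmem n Hn.
  move: Hball => /(in_ball_const _ _ _ _ _ Hx Cx) [d [Hd Hev]].
  (* The margin [iv n0] serves below as the gap required by [in_ball_const]. The estimate also
     yields [0 < s], which is not among the recorded data. *)
  have Hvev : ev M (fun n => `|b - f (x n) n| <= s - iv n0).
    apply: ev_mono (ev_and _ _ _ Hev (ev_ge _ n0)) => n [Hn Hn0n].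
    rewrite distrC; have := Hbf (x n) n; rewrite distrC in Hn.
    by move=> /(_ ltac:(lra) Hn0n); lra.
  have Hivn0 := iv_gt0 _ _ Hn0.
  exists n0, (code b), (code s); split; first by apply/is_ratP; exists b.
  split.
    apply/is_pos_ratP; exists s; split=> //.
    by have [n Hn] := ev_ex _ _ Hvev; have := normr_ge0 (b - f (x n) n); lra.
  split; last exact: HbV.
  by apply/(in_ball_const _ _ _ _ _ Hv Cv); exists (iv n0).
- move=> [k [b' [s' [/is_ratP [b ->] [/is_pos_ratP [s [Hs ->]] [Hball Hmem]]]]]].
  move: Hball => /(in_ball_const _ _ _ _ _ Hv Cv) [d [Hd Hev]].
  have Hd2 : 0 < d / 2 by lra.
  have [n1 [Hn1 Hosc]] := Hdomf _ Hd2.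
  have [n2 [Hn2 Hivn2]] := archimedean _ _ Hd2.
  have Hivn1 := iv_gt0 _ _ Hn1.
  (* The ball of radius [r] about an approximation of [x] within [r / 2] stays within [3 * r / 2] of
     [x]; with [r < iv n1 / 4] this is less than [iv n1 / 2], well inside the ball on which the
     oscillation estimate holds. *)
  have [j [Hj Hivj]] := archimedean M (iv n1 / 4) ltac:(lra).
  (* From [k] on the ball is listed in [V], from [n1] on values near [x] differ by less than
     [d / 2], and beyond [n2] the margin [iv n0] is less than [d / 2]. The two halves use up the gap
     [d]. *)
  pose n0 := k +N (n1 +N n2).
  have Hn1n0 : n1 <=N n0 by apply: leN_trans (le_addl _ _ _); exact: le_addr.
  have Hn2n0 : n2 <=N n0 by apply: leN_trans (le_addl _ _ _); exact: le_addl.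
  have Hn0 : 0N <N n0 by exact: ltN_leN_trans Hn1 Hn1n0.
  pose D := cp (cp (cp n0 (code b)) (code s)) j.
  pose r := iv (D +N 1N).
  have Hr : 0 < r by apply: iv_gt0; exact: lt0S.
  have Hr1 : r < iv n1 / 4.
    apply: le_lt_trans Hivj; apply: iv_le => //.
    by apply: leN_trans (le_addr _ _ _); exact: le_cp_r.
  have [i0 Hi0] := Cx (r / 2) ltac:(lra).
  have Hi0' := leN_refl M i0.
  exists n0, (code (x i0)), (code r).
  split; first by apply/is_ratP; exists (x i0).
  split; first by apply/is_pos_ratP; exists r.
  split.
    apply/(in_ball_const _ _ _ _ _ Hx Cx); exists (r / 2); split; first by lra.
    by exists i0 => n Hn; have := Hi0 _ _ Hi0' Hn; lra.
  move=> n _; apply/HUmem; split; first by apply/is_ratP; exists (x i0).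
  apply: (preimage_intro _ _ _ Hf _ _ _ _ _ _ Hn0); split.
    by move=> m Hm; apply: Hmem; apply: leN_trans Hm; exact: le_addr.
  move=> q i Hq Hi.
  (* A late entry stands in for [f(x)]: it is within [s - d] of [b], and it takes part in the
     oscillation estimate. *)
  have [m [Hm1 [Hm2 Hm3]]] :=
    ev_ex _ _ (ev_and _ _ _ Hev (ev_and _ _ _ (ev_ge _ n1) (cauchy_near _ _ _ Cx Hivn1))).
  have Hball : slt M (fun n => `|x n - q|) (fun=> iv n1).
    apply/slt_const_r.
      by apply: cauchy_contract Cx _ => u v; exact: dist_contract.
    exists (iv n1 / 2); split; first by lra.
    exists i0 => u Hu; have := Hi0 _ _ Hu Hi0'.
    have := ler_distD (x i0) (x u) q; rewrite (distrC (x i0) q); rewrite -/D -/r in Hq; lra.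
  have := Hosc _ _ _ _ Hball Hm3 (leN_trans M _ _ _ Hn1n0 Hi) Hm2.
  have := ler_distD (f (x m) m) (f q i) b; rewrite (distrC (f (x m) m) b).
  have := iv_le _ _ _ Hn2 Hn2n0; lra.
Qed.
End PartA.

(** * Open sets as cozero sets *)

Section PartB.
Variable M : rca_model.
Notation N := (num M).
Notation K := (rational M).
Notation S := (set M).
Notation "x +N y" := (add M x y) (at level 50, left associativity).
Notation "x <N y" := (lt M x y) (at level 70).
Notation "x <=N y" := (le M x y) (at level 70).
Notation "0N" := (zero M).
Notation "1N" := (one M).
Notation code := (code M).
Notation nat_rat := (nat_rat M).
Notation cp := (cp M).
Notation elem := (elem M).

Notation seq_ofM := (seq_ofM M).
Notation r_constM := (r_constM M).

Notation q_invM := (q_invM M).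
Notation le4 := (le4 M).
Notation iv n := ((nat_rat n)^-1).

Lemma le0_code (u : K) : le4 (code 0) (code 0) (code u) (code 0) <-> 0 <= u.
Proof. by rewrite le4P !addr0. Qed.

Section Separation.
Variable U : S.

(* [k] codes a triple [(n0, a, r)] which is in [U] at all stages from [n0] up to [i]. *)
Definition active_code (k i a r : N) : Prop :=
  exists n0, n0 <N k +N 1N /\ (k = cp (cp n0 a) r /\ is_rat M a /\ is_rat M r /\
    forall n, n <N i +N 1N -> n0 <=N n -> elem (cp (cp n a) r) U).

(* [u] is the maximum of [0] and of the numbers [min (1 / (k + 1)) (r - |q - a|)]
   for the codes [k < j] of triples [(n0, a, r)] that are active at stage [i]. *)
Definition max_code (q i j u : N) : Prop :=
  is_rat M u /\ le4 (code 0) (code 0) u (code 0) /\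
  (forall k, k <N j -> forall a, a <N k +N 1N -> forall r, r <N k +N 1N -> active_code k i a r ->
     le4 (q_invM (k +N 1N)) (code 0) u (code 0) \/ le4 r a u q \/ le4 r q u a) /\
  (u = code 0 \/
   exists k, k <N j /\ exists a, a <N k +N 1N /\ exists r, r <N k +N 1N /\
     (active_code k i a r /\ le4 u (code 0) (q_invM (k +N 1N)) (code 0) /\
      le4 u q r a /\ le4 u a r q)).

Definition active (k i : N) (a r : K) : Prop :=
  exists n0, k = cp (cp n0 (code a)) (code r) /\
    forall n, n <=N i -> n0 <=N n -> elem (cp (cp n (code a)) (code r)) U.

(** A minimum is at most [u] if one of its arguments is, and at least [u] if both are; the two
    clauses use this to avoid both the minimum and subtraction. *)
Definition is_max (q : K) (i j : N) (u : K) : Prop :=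
  0 <= u /\
  (forall k a r, k <N j -> active k i a r -> iv (k +N 1N) <= u \/ r <= u + `|q - a|) /\
  (u = 0 \/ exists k a r, k <N j /\ active k i a r /\ u <= iv (k +N 1N) /\ u + `|q - a| <= r).

Lemma active_codeP k i (a r : K) : active_code k i (code a) (code r) <-> active k i a r.
Proof.
split.
- move=> [n0 [_ [E [_ [_ H]]]]]; exists n0; split=> // n Hn; apply: H.
  exact/le_ltS.
- move=> [n0 [E H]]; exists n0; split; first by rewrite E; case: (cp_bounds M n0 (code a) (code r)).
  split=> //; split; first by apply/is_ratP; exists a.
  split; first by apply/is_ratP; exists r.
  by move=> n /le_ltS; exact: H.
Qed.

Lemma active_code_rat k i a r : active_code k i a r ->
  a <N k +N 1N /\ r <N k +N 1N /\ exists a' r' : K, a = code a' /\ r = code r'.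
Proof.
move=> [n0 [_ [-> [/is_ratP [a' ->] [/is_ratP [r' ->] _]]]]].
have [_ [H1 H2]] := cp_bounds M n0 (code a') (code r').
by split=> //; split=> //; exists a', r'.
Qed.

Lemma le4_upper (r a u q : K) :
  le4 (code r) (code a) (code u) (code q) \/ le4 (code r) (code q) (code u) (code a) <->
  r <= u + `|q - a|.
Proof.
rewrite !le4P; case: (ger0P (q - a)) => H; split.
- by case; lra.
- by left; lra.
- by case; lra.
- by right; lra.
Qed.

Lemma le4_attain (r a u q : K) :
  le4 (code u) (code q) (code r) (code a) /\ le4 (code u) (code a) (code r) (code q) <->
  u + `|q - a| <= r.
Proof. by rewrite !le4P; case: (ger0P (q - a)) => H; split=> [[? ?]|?]; try split; lra. Qed.

Lemma le4_inv_l k (u : K) :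
  le4 (q_invM (k +N 1N)) (code 0) (code u) (code 0) <-> iv (k +N 1N) <= u.
Proof. by rewrite code_invN ?le4P ?addr0 //; exact: lt0S. Qed.

Lemma le4_inv_r k (u : K) :
  le4 (code u) (code 0) (q_invM (k +N 1N)) (code 0) <-> u <= iv (k +N 1N).
Proof. by rewrite code_invN ?le4P ?addr0 //; exact: lt0S. Qed.

Lemma max_codeP (q u : K) i j : max_code (code q) i j (code u) <-> is_max q i j u.
Proof.
split.
- move=> [_ [/le0_code H0 [H1 H2]]]; split=> //; split.
  + move=> k a r Hk /active_codeP Ha; have [Hak [Hrk _]] := active_code_rat _ _ _ _ Ha.
    case: (H1 k Hk _ Hak _ Hrk Ha) => [/le4_inv_l|/le4_upper]; by [left|right].
  + case: H2 => [/code_inj|[k [Hk [a [_ [r [_ [Ha [/le4_inv_r Hu H]]]]]]]]]; first by left.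
    have [_ [_ [a' [r' [Ea Er]]]]] := active_code_rat _ _ _ _ Ha.
    rewrite Ea Er in Ha H; right; exists k, a', r'; split=> //; split; first exact/active_codeP.
    by split=> //; apply/le4_attain.
- move=> [H0 [H1 H2]]; split; first by apply/is_ratP; exists u.
  split; first exact/le0_code.
  split.
  + move=> k Hk a _ r _ Ha; have [_ [_ [a' [r' [Ea Er]]]]] := active_code_rat _ _ _ _ Ha.
    rewrite Ea Er in Ha *; move: Ha => /active_codeP Ha.
    by case: (H1 k a' r' Hk Ha) => H; [left; apply/le4_inv_l|right; apply/le4_upper].
  + case: H2 => [->|[k [a [r [Hk [Ha [Hu H]]]]]]]; first by left.
    move: Ha => /active_codeP Ha; have [Hak [Hrk _]] := active_code_rat _ _ _ _ Ha.
    right; exists k; split=> //; exists (code a); split=> //; exists (code r); split=> //.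
    by split=> //; split; [apply/le4_inv_r|apply/le4_attain].
Qed.

Lemma active_fun k i i' a r a' r' : active k i a r -> active k i' a' r' -> a = a' /\ r = r'.
Proof. by move=> [n [-> _]] [n' [/cp_inj [/cp_inj [_ /code_inj ->] /code_inj ->] _]]. Qed.

(** Induction on the number [j] of codes considered, with the code of the maximum as $\Sigma^0_1$
    witness. By [active_fun] a new code adds at most one candidate. *)
Lemma is_max_exists (q : K) i j : exists u, is_max q i j u.
Proof.
have [y [u [_ Hu]]] : exists y, exists u, y = code u /\ is_max q i j u; last by exists u.
have : exists y, max_code (code q) i j y.
  move: j; apply: sigma1_ind.
  - rewrite /max_code /active_code; definable.
  - exists (code 0); apply/max_codeP; split=> //; split; last by left.
    by move=> k a r /ltn0.
  - move=> j [y Hy]; have [u Eu] : exists u : K, y = code u by apply/is_ratP; case: Hy.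
    rewrite {y}Eu in Hy; move: Hy => /max_codeP [H0 [H1 H2]].
    have old : (forall a r, active j i a r -> iv (j +N 1N) <= u \/ r <= u + `|q - a|) ->
        is_max q i (j +N 1N) u.
      move=> Hj; split=> //; split.
        by move=> k a r /ltnS [Hk|->]; [exact: H1|exact: Hj].
      case: H2 => [?|[k [a [r [Hk H]]]]]; [by left|right].
      by exists k, a, r; split=> //; apply/ltnS; left.
    (* Either the candidate of code [j] exceeds [u] and takes over as [v], or [u] remains the
       maximum. *)
    have [[a [r [Ha [Hr1 Hr2]]]]|Hno] := classic (exists a r,
        active j i a r /\ u < iv (j +N 1N) /\ u + `|q - a| < r); last first.
      exists (code u); apply/max_codeP/old => a r Ha.
      have [?|Hlt] := lerP (iv (j +N 1N)) u; [by left|right].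
      by rewrite leNgt; apply/negP => Hlt'; apply: Hno; exists a, r.
    pose v := Order.min (iv (j +N 1N)) (r - `|q - a|).
    have Huv : u <= v by rewrite le_min; apply/andP; split; lra.
    have [Hv1 Hv2] : v <= iv (j +N 1N) /\ v + `|q - a| <= r.
      split; first by rewrite ge_min lexx.
      have : v <= r - `|q - a| by rewrite ge_min lexx orbT.
      by lra.
    exists (code v); apply/max_codeP; split; first by lra.
    split.
      move=> k a' r' /ltnS [Hk|->] Hact.
        by case: (H1 k a' r' Hk Hact) => ?; [left|right]; lra.
      have [-> ->] := active_fun _ _ _ _ _ _ _ Hact Ha.
      rewrite /v; case: (leP (iv (j +N 1N)) (r - `|q - a|)) => _; [left|right]; lra.
    right; exists j, a, r; split; first by apply/ltnS; right.
    by [].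
move=> [y Hy]; have [u Eu] : exists u : K, y = code u by apply/is_ratP; case: Hy.
by exists y, u; split=> //; apply/max_codeP; rewrite -Eu.
Qed.

Lemma is_max_le (q : K) i j u v : is_max q i j u -> is_max q i j v -> u <= v.
Proof.
move=> [_ [_ H]] [Hv [Hup _]]; case: H => [->//|[k [a [r [Hk [Ha [Hu1 Hu2]]]]]]].
by case: (Hup k a r Hk Ha); lra.
Qed.

Lemma separation_code : exists G, forall c, elem c G <->
  exists q, q <N c +N 1N /\ exists i, i <N c +N 1N /\ exists u, u <N c +N 1N /\
    (c = cp (cp q i) u /\ is_rat M q /\ max_code q i (i +N 1N) u).
Proof. apply: delta0_comprehension; rewrite /max_code /active_code; definable. Qed.

Lemma separation_function : exists G g, is_partial_contM M G /\ function_repr M G g /\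
  forall q i, is_max q i (i +N 1N) (g q i).
Proof.
have [G HG] := separation_code.
have HGmem q i u : elem (cp (cp q i) u) G <-> is_rat M q /\ max_code q i (i +N 1N) u.
  by rewrite HG (elem_bounded _ (fun q i u => is_rat M q /\ max_code q i (i +N 1N) u)).
have HP : is_partial_contM M G.
  split.
    move=> c /HG [q [_ [i [_ [u [_ [-> [Hq Hu]]]]]]]]; exists (cp q i), u; split=> //.
    by split; [exists q, i|case: Hu].
  split.
    move=> _ [q [i [-> /is_ratP [q' ->]]]]; have [u Hu] := is_max_exists q' i (i +N 1N).
    by exists (code u); apply/HGmem; split; [apply/is_ratP; exists q'|apply/max_codeP].
  move=> c y y' [Hy Hy'].
  have [c1 [c2 [E _]]] : exists q i, c = cp q i /\ True.
    by move: Hy => /HG [q [_ [i [_ [u [_ [/cp_inj [-> _] _]]]]]]]; exists q, i.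
  rewrite {c}E in Hy Hy'; move: Hy Hy' => /HGmem [/is_ratP [q ->] Hy] /HGmem [_ Hy'].
  have [u Eu] : exists u : K, y = code u by apply/is_ratP; case: Hy.
  have [v Ev] : exists v : K, y' = code v by apply/is_ratP; case: Hy'.
  rewrite Eu Ev in Hy Hy' *; move: Hy Hy' => /max_codeP Hu /max_codeP Hv.
  by congr code; apply: le_anti; rewrite (is_max_le _ _ _ _ _ Hu Hv) (is_max_le _ _ _ _ _ Hv Hu).
have [g Hg] := cont_values _ _ HP.
exists G, g; split=> //; split=> // q i.
by apply/max_codeP; have /HGmem [] := proj2 (Hg q i _) erefl.
Qed.

(** Strong collection, applied to the stages at which a triple is found missing, gives a [b] before
    which every triple with code below [k0] that ever fails has failed. One that is still active at
    a stage from [b] on therefore never fails. *)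
Lemma eventually_active (k0 : N) : exists b, forall k i a r, k <N k0 -> b <=N i ->
  active k i a r -> forall i', active k i' a r.
Proof.
pose dead k i := exists n0, n0 <N k +N 1N /\ exists a, a <N k +N 1N /\ exists r, r <N k +N 1N /\
  (k = cp (cp n0 a) r /\ n0 <=N i /\ ~ elem (cp (cp i a) r) U).
have [|b Hb] := strong_sigma1_collection M dead k0; first by rewrite /dead; definable.
exists b => k i a r Hk Hi [n0 [Ek Hact]] i'; exists n0; split=> // n _ Hn.
apply: NNPP => Hdead.
have [H1 [H2 H3]] := cp_bounds M n0 (code a) (code r); rewrite -Ek in H1 H2 H3.
have [|j [Hj Hj']] := Hb k Hk.
  exists n, n0; split=> //; exists (code a); split=> //; exists (code r); split=> //.
move: Hj' => [m [_ [a' [_ [r' [_ [Ek' [Hm Hjd]]]]]]]].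
move: Ek' Hm Hjd; rewrite Ek => /cp_inj [/cp_inj [<- <-] <-] Hm; apply.
apply: Hact Hm; apply: leN_trans Hi; exact: ltNW.
Qed.

Section Values.
Variables (g : K -> N -> K).
Hypothesis Hg : forall q i, is_max q i (i +N 1N) (g q i).

Lemma g_ge0 q i : 0 <= g q i. Proof. by case: (Hg q i). Qed.

Lemma g_le1 q i : g q i <= 1.
Proof.
case: (Hg q i) => _ [_ [->|[k [a [r [_ [_ [H _]]]]]]]]; first by lra.
by have := iv_le _ _ _ (lt01 M) (le_addl M 1N k); rewrite iv1; lra.
Qed.

(** A maximum attained by a code from [k0] on is at most [iv (k0 +N 1N)]. One attained by a smaller
    code belongs to a triple that stays active, so this triple also competes at [q'] and [j], where
    its contribution is lower by at most the distance of [q] and [q']. *)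
Lemma oscillation (k0 : N) : exists b, forall i j q q', b <=N i -> b <=N j ->
  `|g q i - g q' j| <= `|q - q'| + iv (k0 +N 1N).
Proof.
have [b Hb] := eventually_active k0.
(* The summand [b] settles activity; [k0] ensures that all codes below [k0] are among those
   considered at stage [j]. *)
have half i j q q' : b +N k0 <=N i -> b +N k0 <=N j ->
    g q i - g q' j <= `|q - q'| + iv (k0 +N 1N).
  move=> Hi Hj; have Hiv := iv_gt0 _ _ (lt0S M k0).
  have := normr_ge0 (q - q'); have := g_ge0 q' j.
  case: (Hg q i) => _ [_ [->|[k [a [r [Hk [Ha [Hu1 Hu2]]]]]]]]; first by lra.
  have [Hk0|Hk0] := le_lt_total M k0 k.
    have Hk1 : k0 +N 1N <=N k +N 1N by apply: le_add => //; exact: leN_refl.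
    by have := iv_le _ _ _ (lt0S M k0) Hk1; lra.
  have Ha' := Hb k i a r Hk0 (leN_trans M _ _ _ (le_addr M b k0) Hi) Ha j.
  have Hkj : k <N j +N 1N.
    apply/le_ltS; apply: leN_trans (ltNW _ _ _ Hk0) _; apply: leN_trans Hj; exact: le_addl.
  case: (Hg q' j) => _ [H _]; case: (H k a r Hkj Ha') => H'; first by lra.
  by have := ler_distD q q' a; rewrite (distrC q' q); lra.
exists (b +N k0) => i j q q' Hi Hj; rewrite ler_norml; apply/andP; split; last exact: half.
by have := half j i q' q Hj Hi; rewrite (distrC q' q); lra.
Qed.

Lemma separation_dom x : cauchy M x -> forall e : K, 0 < e -> exists n0, 0N <N n0 /\
  forall (q r : K) i j,
    slt M (fun n => `|x n - q|) (fun=> iv n0) -> slt M (fun n => `|x n - r|) (fun=> iv n0) ->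
    n0 <=N i -> n0 <=N j -> `|g q i - g r j| < e.
Proof.
move=> Cx e He.
(* Both rationals are within [e / 4] of a late entry of [x], and the codes from [k0] on account for
   less than another [e / 4]. The stage [n0] does not depend on [x]. *)
have [k0 [Hk0 Hivk0]] := archimedean M (e / 4) ltac:(lra).
have [b Hb] := oscillation k0.
exists (b +N k0); split.
  by apply: ltN_leN_trans Hk0 _; exact: le_addl.
have Hn0 : iv (b +N k0) <= iv k0 by apply: iv_le => //; exact: le_addl.
have Hk1 : iv (k0 +N 1N) <= iv k0 by apply: iv_le => //; exact: le_addr.
move=> q r i j Hq Hr Hi Hj.
have near y : slt M (fun n => `|x n - y|) (fun=> iv (b +N k0)) ->
    ev M (fun n => `|x n - y| <= e / 4).
  move=> /slt_const_r [|d [Hd Hev]].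
    by apply: cauchy_contract Cx _ => u v; exact: dist_contract.
  by apply: ev_mono Hev => n; lra.
have [n [Hnq Hnr]] := ev_ex _ _ (ev_and _ _ _ (near q Hq) (near r Hr)).
have := ler_distD (x n) q r; rewrite (distrC q (x n)).
have := Hb i j q r (leN_trans M _ _ _ (le_addr M b k0) Hi) (leN_trans M _ _ _ (le_addr M b k0) Hj).
by lra.
Qed.
End Values.
End Separation.

Theorem open_cozero : open_cozero_statement M.
Proof.
move=> U HU.
have [G [g [HP [HGg Hg]]]] := separation_function U.
have Hval X : is_realM M X -> exists x, Repr M (seq_ofM X) x /\ cauchy M x /\
    Repr M (valueM M G (seq_ofM X)) (fun n => g (x n) n).
  move=> /real_values [x [Hx Cx]]; exists x; split=> //; split=> //.
  exact: (Repr_value _ _ _ _ _ HGg Hx).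
have H01 X : is_realM M X ->
    r_leM M (r_constM (q_zeroM M)) (valueM M G (seq_ofM X)) /\
    r_leM M (valueM M G (seq_ofM X)) (r_constM (q_oneM M)).
  move=> /Hval [x [_ [_ Hv]]]; rewrite code_zero code_one.
  split; [apply/(r_leP _ _ _ _ _ (Repr_const _ _) Hv)|apply/(r_leP _ _ _ _ _ Hv (Repr_const _ _))].
    by move=> e He; exists 0N => n _; have := g_ge0 U g Hg (x n) n; lra.
  by move=> e He; exists 0N => n _; have := g_le1 U g Hg (x n) n; lra.
exists G; split.
  split=> // X /Hval [x [Hx [Cx Hv]]]; apply/(in_domP _ _ _ _ _ Hx HGg).
  exact: separation_dom Hg _ Cx.
split=> // X HX; have [x [Hx [Cx Hv]]] := Hval X HX.
have Cv := cauchy_value _ _ _ Cx (separation_dom _ _ Hg _ Cx).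
rewrite [in q_zeroM M]code_zero.
split.
- move=> [n0 [a' [r' [/is_ratP [a ->] [/is_pos_ratP [r [Hr ->]] [Hball Hmem]]]]]].
  split; last by case: (H01 X HX).
  move: Hball => /(in_ball_const _ _ _ _ _ Hx Cx) [d [Hd Hev]].
  pose k := cp (cp n0 (code a)) (code r).
  have Hk := iv_gt0 _ _ (lt0S M k).
  apply/(r_ltP _ _ _ _ _ (Repr_const _ _) Hv)/(slt_const_l _ _ _ Cv).
  (* From stage [k] on the code [k] of the given triple is considered and active, so the value is at
     least its contribution, whose two arguments are bounded below by [iv (k +N 1N)] and [d]. *)
  exists (Order.min d (iv (k +N 1N))); split; first by rewrite lt_min Hd.
  apply: ev_mono (ev_and _ _ _ Hev (ev_ge _ k)) => n [Hn Hkn].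
  have Hact : active U k n a r by exists n0; split=> // m _; exact: Hmem.
  have [_ [H _]] := Hg (x n) n.
  rewrite add0r ge_min; case: (H k a r (proj1 (le_ltS _ _ _) Hkn) Hact) => H'.
    by rewrite H' orbT.
  by rewrite distrC in Hn; apply/orP; left; lra.
- move=> [/(r_ltP _ _ _ _ _ (Repr_const _ _) Hv)/(slt_const_l _ _ _ Cv) [e [He Hev]] _].
  have [k0 [Hk0 Hivk0]] := archimedean _ _ He.
  have [b Hb] := eventually_active U k0.
  have [n1 Hn1] := Cx (e / 2) ltac:(lra).
  have [i [Hi1 [Hi2 Hi3]]] := ev_ex _ _ (ev_and _ _ _ Hev (ev_and _ _ _ (ev_ge _ b) (ev_ge _ n1))).
  (* The value is at least [e], which exceeds [iv k0], and at most [iv (k +N 1N)] for the code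
     attaining it. Hence [k < k0], and the choice of [b] keeps this triple active forever. *)
  have [_ [_ [H0|[k [a [r [_ [Hact [Hu1 Hu2]]]]]]]]] := Hg (x i) i; first by lra.
  have Hkk0 : k <N k0.
    apply/lt_not_le => Hle.
    have := iv_le _ _ _ Hk0 (leN_trans M _ _ _ Hle (le_addr M k 1N)); lra.
  have Hr : 0 < r by have := normr_ge0 (x i - a); lra.
  have Hfor := Hb k i a r Hkk0 Hi2 Hact.
  have [n0 [Ek _]] := Hact.
  exists n0, (code a), (code r); split; first by apply/is_ratP; exists a.
  split; first by apply/is_pos_ratP; exists r.
  split.
    (* The entry [x i] is at distance at most [r - e] from [a], and later entries are within [e / 2]
       of it. *)
    apply/(in_ball_const _ _ _ _ _ Hx Cx); exists (e / 2); split; first by lra.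
    exists n1 => m Hm; have := Hn1 m i Hm Hi3.
    by have := ler_distD (x i) (x m) a; rewrite (distrC a); lra.
  move=> n Hn; have [n0' [Ek' Hn']] := Hfor n.
  apply: Hn'; first exact: leN_refl.
  by move: Ek'; rewrite Ek => /cp_inj [/cp_inj [<- _] _].
Qed.
End PartB.

Theorem proposition4p4 :
  proves RCA0 (sentence
    (allS F V, is_cont F /\ is_open_code V ->
       exS U, is_open_code U /\
         allS X, is_real X ->
           (in_open (seq_of X) U <-> in_open (value F (seq_of X)) V))%L2)
  /\
  proves RCA0 (sentence
    (allS U, is_open_code U ->
       exS G, is_cont G /\
         (allS X, is_real X ->
            r_le (r_const q_zero) (value G (seq_of X)) /\
            r_le (value G (seq_of X)) (r_const q_one)) /\
         (allS X, is_real X ->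
            (in_open (seq_of X) U <->
             r_lt (r_const q_zero) (value G (seq_of X)) /\
             r_le (value G (seq_of X)) (r_const q_one))))%L2).
Proof.
split; apply: completeness => M HM s r.
- exact: (preimage_open (RCAModel M HM)).
- exact: (open_cozero (RCAModel M HM)).
Qed.
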